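(* Let $X$ be a biquandle and $D$ a diagram of an oriented link in $\mathbb{R}^3$. For any quandle coloring $\mathcal{C}\in\mathrm{Col}_{\mathcal{Q}(X)}(D)$, we have $$\psi_*\bigl((\Xi_{\mathcal{Q}(X)}(D))(\mathcal{C})\bigr)=(\Xi_X(D))(\Psi(\mathcal{C}))\in\pi_2(B^QX).$$ In particular, if $X$ is finite, then $\psi_*(\Xi_{\mathcal{Q}(X)}(D))=\Xi_X(D)\in\mathbb{Z}[\pi_2(B^QX)]$.
   Context: A quandle is a set $Q$ with a binary operation $\ast$ such that $a\ast a=a$; for every $a$ the map $\bullet\mapsto\bullet\ast a$ is bijective; and $(a\ast b)\ast c=(a\ast c)\ast(b\ast c)$. A biquandle is a set $X$ with binary operations $\underline{\ast},\overline{\ast}$ such that (BQ1) $x\,\underline{\ast}\,x=x\,\overline{\ast}\,x$; (BQ2) for every $x$ the maps $\bullet\mapsto\bullet\,\underline{\ast}\,x$ and $\bullet\mapsto\bullet\,\overline{\ast}\,x$ are bijective (with inverses $\underline{\ast}^{-1}x$, $\overline{\ast}^{-1}x$), and $(x,y)\mapsto(y\,\overline{\ast}\,x,x\,\underline{\ast}\,y)$ is a bijection of $X\times X$; (BQ3) $(x\underline{\ast}y)\underline{\ast}(z\underline{\ast}y)=(x\underline{\ast}z)\underline{\ast}(y\overline{\ast}z)$, $(x\overline{\ast}y)\overline{\ast}(z\overline{\ast}y)=(x\overline{\ast}z)\overline{\ast}(y\underline{\ast}z)$, $(x\underline{\ast}y)\overline{\ast}(z\underline{\ast}y)=(x\overline{\ast}z)\underline{\ast}(y\overline{\ast}z)$.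 $\mathcal{Q}(X)$ is the quandle with underlying set $X$ and $x\ast y:=(x\,\underline{\ast}\,y)\,\overline{\ast}^{-1}y$. A quandle $(Q,\ast)$ is regarded as a biquandle with $\underline{\ast}=\ast$ and $x\,\overline{\ast}\,y=x$. Diagrams: every strand of an oriented link diagram $D\subset\mathbb{R}^2$ has a normal vector, obtained by rotating its direction counterclockwise by $90^\circ$. $\mathcal{A}(D)$: arcs (cut at under-crossings). $\mathcal{SA}(D)$: semi-arcs (cut over- and under-strands at all crossings). The specified region of a semi-arc $\sigma$ is the region $\rho_\sigma$ adjacent to $\sigma$ from which the normal of $\sigma$ points to the other side; the specified region of a crossing is the one from which both normals point away. A quandle coloring by $Q$ is a map $\mathcal{C}:\mathcal{A}(D)\to Q$ with $\mathcal{C}(\alpha_i)\ast\mathcal{C}(\alpha_j)=\mathcal{C}(\alpha_k)$ at each crossing, where $\alpha_j$ is the over-arc, whose normal points from the side of the under-arc $\alpha_i$ to that of the under-arc $\alpha_k$. A biquandle coloring by $X$ is a map $\mathcal{C}:\mathcal{SA}(D)\to X$ with $\mathcal{C}(\sigma_i)\,\underline{\ast}\,\mathcal{C}(\sigma_j)=\mathcal{C}(\sigma_k)$ and $\mathcal{C}(\sigma_j)\,\overline{\ast}\,\mathcal{C}(\sigma_i)=\mathcal{C}(\sigma_l)$ at each crossing, where $\sigma_i$ (under), $\sigma_j$ (over) are adjacent to the specified region and $\sigma_k$ (under), $\sigma_l$ (over) are the other two semi-arcs. A quandle coloring is regarded as a biquandle coloring by giving each semi-arc the color of its arc. $\mathrm{Col}_Q(D)$,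 $\mathrm{Col}_X(D)$ are the sets of colorings. Associated group and shadow coloring: $\mathrm{As}(X)=\langle x\ (x\in X)\mid x\cdot(y\,\overline{\ast}\,x)=y\cdot(x\,\underline{\ast}\,y)\rangle$ (so $\mathrm{As}(Q)=\langle a\mid a\cdot b=b\cdot(a\ast b)\rangle$ for a quandle). For a coloring $\mathcal{C}$, the region coloring $\mathcal{C}^R$ is the unique map from the set of regions to the associated group sending the unbounded region to $e$ and with $\mathcal{C}^R(R_1)\cdot\mathcal{C}(\sigma)=\mathcal{C}^R(R_2)$ whenever the normal of $\sigma$ points from $R_1$ to $R_2$; and $\mathcal{C}^S(\sigma)=(\mathcal{C}^R(\rho_\sigma),\mathcal{C}(\sigma))$. The maps $\psi$, $\psi_{\mathrm{As}}$, $\Psi$: let $k:X\to X$ be the unique bijection with $k(x)\,\overline{\ast}\,k(x)=x$. $\psi:\mathrm{As}(\mathcal{Q}(X))\times\mathcal{Q}(X)\to X$ is the well-defined map with $\psi(e,a)=a$, $\psi(p\cdot b,a)=\psi(p,a)\,\overline{\ast}\,\psi(p,b)$, $\psi(p\cdot b^{-1},a)=\psi(p,a)\,\overline{\ast}^{-1}k(\psi(p,b))$. $\psi_{\mathrm{As}}:\mathrm{As}(\mathcal{Q}(X))\to\mathrm{As}(X)$ is the well-defined map with $\psi_{\mathrm{As}}(e)=e$, $\psi_{\mathrm{As}}(p\cdot a)=\psi_{\mathrm{As}}(p)\cdot\psi(p,a)$, $\psi_{\mathrm{As}}(p\cdot a^{-1})=\psi_{\mathrm{As}}(p)\cdot\psi(p\cdot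 a^{-1},a)^{-1}$. The bijection $\Psi:\mathrm{Col}_{\mathcal{Q}(X)}(D)\to\mathrm{Col}_X(D)$ is given by $\Psi(\mathcal{C})=\psi\circ\mathcal{C}^S$ (it is constructed diagrammatically in the paper and coincides with this formula). Biquandle space: $B^QX$ is the quotient of $\bigsqcup_{n\ge0}[0,1]^n\times X^n$ ($X$ discrete) by the relations $(t_1,\dots,t_n;x_1,\dots,x_n)$ with $t_i=0$ $\sim$ $(t_1,\dots,\widehat{t_i},\dots,t_n;x_1,\dots,\widehat{x_i},\dots,x_n)$; $(t_1,\dots,t_n;x_1,\dots,x_n)$ with $t_i=1$ $\sim$ $(t_1,\dots,\widehat{t_i},\dots,t_n;x_1\underline{\ast}x_i,\dots,x_{i-1}\underline{\ast}x_i,x_{i+1}\overline{\ast}x_i,\dots,x_n\overline{\ast}x_i)$; and $\sim_D$: if $x_i=x_{i+1}$ and $t_i+t_{i+1}=t_i'+t_{i+1}'$, then $(t_1,\dots,t_i,t_{i+1},\dots,t_n;x_1,\dots,x_n)\sim_D(t_1,\dots,t_i',t_{i+1}',\dots,t_n;x_1,\dots,x_n)$. It is a CW complex with a single 0-cell and with $n$-cells labeled by the set $X^n_{ND}$ of $(x_1,\dots,x_n)$ with $x_i\ne x_{i+1}$ for all $i$; $\pi_1(B^QX)\cong\mathrm{As}(X)$. Its universal covering $\widetilde{B^QX}$, with covering map $p_X$, is the quotient of $\bigsqcup_n[0,1]^n\times\mathrm{As}(X)\times X^n$ by the lifted relations: $(t_1,\dots,t_n;g,x_1,\dots,x_n)$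 with $t_i=0$ $\sim$ $(t_1,\dots,\widehat{t_i},\dots,t_n;g,x_1,\dots,\widehat{x_i},\dots,x_n)$; $(t_1,\dots,t_n;g,x_1,\dots,x_n)$ with $t_i=1$ $\sim$ $(t_1,\dots,\widehat{t_i},\dots,t_n;g\cdot x_i,x_1\underline{\ast}x_i,\dots,x_{i-1}\underline{\ast}x_i,x_{i+1}\overline{\ast}x_i,\dots,x_n\overline{\ast}x_i)$; and $\sim_D$ is imposed for fixed $g$; $p_X$ forgets $g$. Its $n$-cells are labeled by $\mathrm{As}(X)\times X^n_{ND}$. The isomorphism $\psi_*$: $(t;p,a_1,\dots,a_n)\mapsto(t;\psi_{\mathrm{As}}(p),\psi(p,a_1),\dots,\psi(p,a_n))$ induces an isomorphism of CW complexes $\psi^Q_B:\widetilde{B^Q\mathcal{Q}(X)}\to\widetilde{B^QX}$. For $n\ge2$, $\psi_*:\pi_n(B^Q\mathcal{Q}(X))\to\pi_n(B^QX)$ is $p_{X*}\circ\psi^Q_{B*}\circ(p_{\mathcal{Q}(X)*})^{-1}$ (base points: the 0-cells, and the 0-cells labeled $e$ in the coverings). The same symbol denotes the induced isomorphism of group rings. Homotopy invariant: for a biquandle $X$ and $\mathcal{C}\in\mathrm{Col}_X(D)$, $(\Xi_X(D))(\mathcal{C})\in\pi_2(B^QX)$ is the class of the following map from $S^2=\mathbb{R}^2\cup\{\infty\}$ (base point $\infty$), defined using the cell decomposition dual to $D$: 0-cells (regions) go to the 0-cell; the 1-cell dual to a semi-arc $\sigma$, directed along the normal of $\sigma$, goes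 to the 1-cell labeled $\mathcal{C}(\sigma)$; the 2-cell dual to a crossing goes to the 2-cell labeled $(\mathcal{C}(\sigma_1),\mathcal{C}(\sigma_2))$, where $\sigma_1$ (under) and $\sigma_2$ (over) are the semi-arcs adjacent to the specified region of the crossing. Explicitly, and for arbitrary $D$: with thin bicollars around the strands having normal coordinate $t\in[0,1]$ increasing along the normal, a point in the collar of $\sigma$ away from crossings goes to $[t;\mathcal{C}(\sigma)]$, a point near a crossing with under-strand coordinate $t_1$ and over-strand coordinate $t_2$ goes to $[t_1,t_2;\mathcal{C}(\sigma_1),\mathcal{C}(\sigma_2)]$, and all other points go to the 0-cell. When $X$ is finite, $\Xi_X(D)$ also denotes $\sum_{\mathcal{C}\in\mathrm{Col}_X(D)}(\Xi_X(D))(\mathcal{C})\in\mathbb{Z}[\pi_2(B^QX)]$. For $\mathcal{Q}(X)$, the same definitions are applied to the quandle regarded as a biquandle. *)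

(* Defs.v *)
From HB Require Import structures.
From Stdlib Require Import Relation_Operators.
From mathcomp Require Import all_boot all_order all_algebra.
From mathcomp Require Import all_classical all_reals all_analysis.
From mathcomp Require Import lra zify.
From mathcomp.multinomials Require Import freeg.
Set Implicit Arguments.
Unset Strict Implicit.
Unset Printing Implicit Defensive.
Import Order.TTheory GRing.Theory Num.Theory numFieldNormedType.Exports.

Local Open Scope quotient_scope.
Local Open Scope classical_set_scope.
Local Open Scope ring_scope.

Section GenQuotient.
Variables (T : choiceType) (r : T -> T -> Prop).

Definition gen_equiv (x y : T) : bool := `[< clos_refl_sym_trans T r x y >].

Lemma gen_equiv_refl : reflexive gen_equiv.
Proof. by move=> x; apply/asboolP; exact: rst_refl. Qed.

Lemma gen_equiv_sym : symmetric gen_equiv.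
Proof.
by move=> x y; apply/idP/idP => /asboolP h; apply/asboolP; exact: rst_sym.
Qed.

Lemma gen_equiv_trans : transitive gen_equiv.
Proof.
move=> y x z /asboolP xy /asboolP yz; apply/asboolP.
exact: rst_trans xy yz.
Qed.

Canonical gen_equiv_rel :=
  EquivRel gen_equiv gen_equiv_refl gen_equiv_sym gen_equiv_trans.

Definition gen_quot := {eq_quot gen_equiv_rel}.
HB.instance Definition _ := Choice.on gen_quot.
HB.instance Definition _ := EqQuotient.on gen_quot.

Definition gen_class (x : T) : gen_quot := \pi_gen_quot%qT x.

Lemma gen_classP x y : gen_class x = gen_class y <-> clos_refl_sym_trans T r x y.
Proof.
split; first by move=> /eqmodP /asboolP.
by move=> h; apply/eqmodP/asboolP.
Qed.

Lemma gen_class_step x y : r x y -> gen_class x = gen_class y.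
Proof. by move=> h; apply/gen_classP; exact: rst_step. Qed.

Lemma gen_quotP (q : gen_quot) : gen_class (repr q) = q.
Proof. exact: reprK. Qed.

Lemma gen_class_lift (S : Type) (f : T -> S) :
  (forall x y, r x y -> f x = f y) -> forall x, f (repr (gen_class x)) = f x.
Proof.
move=> hf x.
have aux a b : clos_refl_sym_trans T r a b -> f a = f b.
  by elim=> {a b} [a b /hf|//|a b _ ->|a b c _ -> _ ->].
by apply: aux; apply/gen_classP; rewrite gen_quotP.
Qed.

End GenQuotient.

Record quandle := Quandle {
  qd_sort :> choiceType;
  qop : qd_sort -> qd_sort -> qd_sort;
  qopV : qd_sort -> qd_sort -> qd_sort;
  qop_idem : forall a, qop a a = a;
  qopK : forall a, cancel (qop^~ a) (qopV^~ a);
  qopVK : forall a, cancel (qopV^~ a) (qop^~ a);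
  qop_dist : forall a b c, qop (qop a b) c = qop (qop a c) (qop b c) }.

(* [bun x y] is x \underline{*} y and [bov x y] is x \overline{*} y.  Here and *)
(* in [quandle] the suffix V marks the inverse of a right translation, which  *)
(* is uniquely determined by the cancellation laws.                           *)
Record biquandle := Biquandle {
  bq_sort :> choiceType;
  bun : bq_sort -> bq_sort -> bq_sort;
  bov : bq_sort -> bq_sort -> bq_sort;
  bunV : bq_sort -> bq_sort -> bq_sort;
  bovV : bq_sort -> bq_sort -> bq_sort;
  bq1 : forall x, bun x x = bov x x;
  bunK : forall x, cancel (bun^~ x) (bunV^~ x);
  bunVK : forall x, cancel (bunV^~ x) (bun^~ x);
  bovK : forall x, cancel (bov^~ x) (bovV^~ x);
  bovVK : forall x, cancel (bovV^~ x) (bov^~ x);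
  bq2 : bijective (fun z : bq_sort * bq_sort => (bov z.2 z.1, bun z.1 z.2));
  bq3un : forall x y z,
    bun (bun x y) (bun z y) = bun (bun x z) (bov y z);
  bq3ov : forall x y z,
    bov (bov x y) (bov z y) = bov (bov x z) (bun y z);
  bq3 : forall x y z,
    bov (bun x y) (bun z y) = bun (bov x z) (bov y z) }.

Section QuandleOfBiquandle.
Variable X : biquandle.
Implicit Types x y z : X.

Definition qX_op x y : X := bovV (bun x y) y.

Lemma qX_opE x y : bov (qX_op x y) y = bun x y.
Proof. exact: bovVK. Qed.

Lemma bov_inj y : injective (fun x : X => bov x y).
Proof. exact: can_inj (bovK y). Qed.

Lemma qX_op_bov x y z : qX_op (bov x z) (bov y z) = bov (qX_op x y) z.
Proof.
apply: (@bov_inj (bov y z)); rewrite qX_opE -bq3 -(qX_opE x y).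
by rewrite bq3ov.
Qed.

Lemma qX_op_idem x : qX_op x x = x.
Proof. by rewrite /qX_op bq1 bovK. Qed.

Definition qX_opV x y : X := bunV (bov x y) y.

Lemma qX_opK x : cancel (qX_op^~ x) (qX_opV^~ x).
Proof. by move=> y; rewrite /qX_opV qX_opE bunK. Qed.

Lemma qX_opVK x : cancel (qX_opV^~ x) (qX_op^~ x).
Proof. by move=> y; rewrite /qX_op /qX_opV bunVK bovK. Qed.

Lemma qX_op_dist x y z :
  qX_op (qX_op x y) z = qX_op (qX_op x z) (qX_op y z).
Proof.
apply: (@bov_inj y); apply: (@bov_inj (bov z y)); symmetry.
have := bq3un x z y.
rewrite -[LHS]qX_opE -[RHS]qX_opE -(qX_opE x z) -(qX_opE y z) qX_op_bov.
rewrite -(qX_opE x y) qX_op_bov => <-.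
by rewrite qX_opE bq3ov.
Qed.

Definition quandle_of_biquandle : quandle :=
  Quandle qX_op_idem qX_opK qX_opVK qX_op_dist.

Lemma kmap_ex x : exists y, bov y y = x.
Proof.
have [g _ gK] := bq2 X.
have := gK (x, x); case: (g (x, x)) => a b /= [oba uab].
have oE z : bov z a = bov z b.
  by apply: (@bov_inj x); rewrite -{1}oba -{1}uab bq3ov.
have ab : a = b.
  by apply: (can_inj (bunK b)); rewrite uab -oba oE bq1.
by exists a; rewrite -[in RHS]oba ab.
Qed.

Definition kmap x : X := xget x [set y | bov y y = x].

Lemma kmapE x : bov (kmap x) (kmap x) = x.
Proof. by rewrite /kmap; case: xgetP => // /(_ _) h; have [y /h] := kmap_ex x. Qed.

Lemma kmapK x : kmap (bov x x) = x.
Proof.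
have := kmapE (bov x x); set y := kmap _ => e.
have [g gK _] := bq2 X.
by apply: (congr1 fst (can_inj gK (x1 := (y, y)) (x2 := (x, x)) _)) => /=; rewrite !bq1 e.
Qed.

End QuandleOfBiquandle.

Section BiquandleOfQuandle.
Variable Q : quandle.

Let ov (x _ : Q) : Q := x.

Lemma quandle_bq2 : bijective (fun z : Q * Q => (ov z.2 z.1, qop z.1 z.2)).
Proof.
by exists (fun z => (qopV z.2 z.1, z.1)) => -[x y] /=; rewrite ?qopK ?qopVK.
Qed.

Definition biquandle_of_quandle : biquandle :=
  @Biquandle Q (@qop Q) ov (@qopV Q) ov (@qop_idem Q) (@qopK Q) (@qopVK Q)
    (fun _ _ => erefl) (fun _ _ => erefl) quandle_bq2
    (fun x y z => esym (qop_dist x z y)) (fun _ _ _ => erefl)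
    (fun _ _ _ => erefl).

End BiquandleOfQuandle.

(* Q(X), regarded as a biquandle.                                             *)
Definition QX (X : biquandle) : biquandle :=
  biquandle_of_quandle (quandle_of_biquandle X).

Section AssociatedGroup.
Variable X : biquandle.

(* Group words: the letter (x, true) is x, the letter (x, false) is x^-1.     *)
Definition word := seq (X * bool).
HB.instance Definition _ := Choice.on word.

Inductive as_rel : word -> word -> Prop :=
| AsCancel x b : as_rel [:: (x, b); (x, ~~ b)] [::]
| AsRelator x y :
    as_rel [:: (x, true); (bov y x, true)] [:: (y, true); (bun x y, true)].

Definition as_step (u v : word) : Prop :=
  exists p q w w', [/\ as_rel w w', u = p ++ w ++ q & v = p ++ w' ++ q].

Definition As := gen_quot as_step.
HB.instance Definition _ := Choice.on As.

Let cls : word -> As := gen_class as_step.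

Lemma as_step_cat p q u v : as_step u v -> as_step (p ++ u ++ q) (p ++ v ++ q).
Proof.
move=> [p' [q' [w [w' [h -> ->]]]]]; exists (p ++ p'), (q' ++ q), w, w'.
by split; rewrite // -!catA.
Qed.

Lemma as_cat u u' v v' : cls u = cls u' -> cls v = cls v' ->
  cls (u ++ v) = cls (u' ++ v').
Proof.
have aux p q a b : clos_refl_sym_trans _ as_step a b ->
    cls (p ++ a ++ q) = cls (p ++ b ++ q).
  elim=> {a b} [a b h|//|a b _ ->|a b c _ -> _ ->//] //.
  by apply: gen_class_step; exact: as_step_cat.
move=> /gen_classP eu /gen_classP ev.
have /= -> := aux [::] v _ _ eu.
by have := aux u' [::] _ _ ev; rewrite !cats0.
Qed.

Definition inv_word (u : word) : word := rev [seq (l.1, ~~ l.2) | l <- u].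

Lemma inv_wordK u : inv_word (inv_word u) = u.
Proof.
rewrite /inv_word map_rev revK -map_comp -[RHS]map_id.
by apply: eq_map => -[x b] /=; rewrite negbK.
Qed.

Lemma cat_inv_word u : cls (u ++ inv_word u) = cls [::].
Proof.
elim/last_ind: u => [//|u [x b] IH].
rewrite /inv_word map_rcons rev_rcons -/(inv_word u) -cats1 -catA /=.
rewrite -IH; apply: gen_class_step.
by exists u, (inv_word u), [:: (x, b); (x, ~~ b)], [::]; split=> //; constructor.
Qed.

Lemma inv_word_cat u : cls (inv_word u ++ u) = cls [::].
Proof. by rewrite -{2}[u]inv_wordK cat_inv_word. Qed.

Definition as_one : As := cls [::].
Definition as_mul (g h : As) : As := cls (repr g ++ repr h).
Definition as_inv (g : As) : As := cls (inv_word (repr g)).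

Lemma as_mulE u v : as_mul (cls u) (cls v) = cls (u ++ v).
Proof. by apply: as_cat; exact: gen_quotP. Qed.

Lemma as_ind (P : As -> Prop) : (forall u, P (cls u)) -> forall g, P g.
Proof. by move=> h g; rewrite -(gen_quotP g). Qed.

Lemma as_mulA : associative as_mul.
Proof.
by do 3!elim/as_ind=> ?; rewrite !as_mulE catA.
Qed.

Lemma as_mul1g : left_id as_one as_mul.
Proof. by elim/as_ind=> u; rewrite as_mulE. Qed.

Lemma as_mulg1 : right_id as_one as_mul.
Proof. by elim/as_ind=> u; rewrite as_mulE cats0. Qed.

Lemma as_mulVg : left_inverse as_one as_inv as_mul.
Proof. by move=> g; rewrite -{2}[g]gen_quotP as_mulE inv_word_cat. Qed.

Lemma as_mulgV : right_inverse as_one as_inv as_mul.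
Proof. by move=> g; rewrite -{1}[g]gen_quotP as_mulE cat_inv_word. Qed.

HB.instance Definition _ := isGroup.Build As
  as_mulA as_mul1g as_mulg1 as_mulVg as_mulgV.

Definition as_gen (x : X) : As := cls [:: (x, true)].

Lemma as_genV x : (as_gen x)^-1%g = cls [:: (x, false)].
Proof.
apply: (@mulgI _ (as_gen x)); rewrite mulgV; symmetry.
by rewrite [LHS]as_mulE; exact: (cat_inv_word [:: (x, true)]).
Qed.

Lemma as_relator x y :
  (as_gen x * as_gen (bov y x) = as_gen y * as_gen (bun x y))%g.
Proof.
rewrite [LHS]as_mulE [RHS]as_mulE; apply: gen_class_step.
by exists [::], [::], [:: (x, true); (bov y x, true)],
  [:: (y, true); (bun x y, true)]; split=> //; constructor.
Qed.

Lemma as_class_cons x b u :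
  cls (rcons u (x, b)) = (cls u * if b then as_gen x else (as_gen x)^-1)%g.
Proof. by case: b; rewrite ?as_genV [RHS]as_mulE cats1. Qed.

End AssociatedGroup.

Section Psi.
Variable X : biquandle.

(* A letter on the right of p changes psi(p, -) according to the recursion    *)
(* formulas of psi(p b, a) and psi(p b^-1, a) (see [psiM] and [psiMV]).       *)
Definition psi_letter (f : X -> X) (l : X * bool) : X -> X :=
  if l.2 then fun a => bov (f a) (f l.1)
  else fun a => bovV (f a) (kmap (f l.1)).

Definition psi_word (w : word (QX X)) : X -> X := foldl psi_letter id w.

Definition psi (p : As (QX X)) (a : X) : X := psi_word (repr p) a.

Let qhom (f : X -> X) := forall a b, f (qX_op a b) = qX_op (f a) (f b).

Lemma psi_letter_hom f l : qhom f -> qhom (psi_letter f l).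
Proof.
case: l => b [] hf a c; rewrite /psi_letter /=; first by rewrite hf qX_op_bov.
apply: (@bov_inj _ (kmap (f b))).
by rewrite -qX_op_bov !bovVK hf.
Qed.

Lemma foldl_psi_hom w f : qhom f -> qhom (foldl psi_letter f w).
Proof. by elim: w f => //= l w IH f hf; apply/IH/psi_letter_hom. Qed.

Lemma psi_letter_rel f w w' : qhom f -> as_rel (w : word (QX X)) w' ->
  foldl psi_letter f w = foldl psi_letter f w'.
Proof.
move=> hf [x []|x y] /=; rewrite /psi_letter /=; apply/funext => a.
- by rewrite kmapK bovK.
- have -> : bovV (f x) (kmap (f x)) = kmap (f x).
    by rewrite -{1}[f x]kmapE bovK.
  by rewrite bovVK.
- by rewrite hf qX_opE bq3ov.
Qed.

Lemma psi_word_step w w' : as_step (w : word (QX X)) w' ->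
  psi_word w = psi_word w'.
Proof.
move=> [p [q [u [u' [h -> ->]]]]]; rewrite /psi_word !foldl_cat.
by congr foldl; apply: psi_letter_rel => //; exact: foldl_psi_hom.
Qed.

Lemma psi_wordE (w : word (QX X)) : psi (gen_class _ w) = psi_word w.
Proof. exact: (gen_class_lift psi_word_step). Qed.

Lemma psi1 a : psi 1%g a = a.
Proof. by rewrite [psi _]psi_wordE. Qed.

Lemma psiM p b a : psi (p * as_gen (X := QX X) b)%g a = bov (psi p a) (psi p b).
Proof.
elim/(@as_ind (QX X)): p => w.
rewrite -(as_class_cons _ true) !psi_wordE /psi_word -cats1.
by rewrite foldl_cat.
Qed.

Lemma psiMV p b a : psi (p * (as_gen (X := QX X) b)^-1)%g a =
  bovV (psi p a) (kmap (psi p b)).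
Proof.
elim/(@as_ind (QX X)): p => w.
rewrite -(as_class_cons _ false) !psi_wordE /psi_word -cats1.
by rewrite foldl_cat.
Qed.

Lemma psi_qX_op p a b : psi p (qX_op a b) = qX_op (psi p a) (psi p b).
Proof. exact: foldl_psi_hom. Qed.

(* State of the recursion for psi_As on a word: the pair (psi_As(p), psi(p, -)). *)
Definition psiAs_letter (s : As X * (X -> X)) (l : X * bool) :
    As X * (X -> X) :=
  let f := psi_letter s.2 l in
  (if l.2 then s.1 * as_gen (s.2 l.1) else s.1 * (as_gen (f l.1))^-1, f)%g.

Definition psiAs_word (w : word (QX X)) : As X :=
  (foldl psiAs_letter (1%g, id) w).1.

Definition psiAs (p : As (QX X)) : As X := psiAs_word (repr p).

Lemma psiAs_foldl2 w s :
  (foldl psiAs_letter s w).2 = foldl psi_letter s.2 w.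
Proof. by elim: w s => //= l w IH s; rewrite IH. Qed.

Lemma psiAs_letter_rel s w w' : qhom s.2 -> as_rel (w : word (QX X)) w' ->
  foldl psiAs_letter s w = foldl psiAs_letter s w'.
Proof.
case: s => g f /= hf h; rewrite [LHS]surjective_pairing [RHS]surjective_pairing.
rewrite !psiAs_foldl2 /= (psi_letter_rel hf h); congr pair.
case: h => [x []|x y] //=; rewrite /psi_letter /=.
- by rewrite kmapK bovK mulgK.
- by rewrite mulgVK.
- by rewrite hf qX_opE -!mulgA as_relator.
Qed.

Lemma psiAs_word_step w w' : as_step (w : word (QX X)) w' ->
  psiAs_word w = psiAs_word w'.
Proof.
move=> [p [q [u [u' [h -> ->]]]]]; rewrite /psiAs_word !foldl_cat.
congr (foldl _ _ _).1; apply: psiAs_letter_rel => //.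
by rewrite psiAs_foldl2; exact: foldl_psi_hom.
Qed.

Lemma psiAs_wordE (w : word (QX X)) : psiAs (gen_class _ w) = psiAs_word w.
Proof. exact: (gen_class_lift psiAs_word_step). Qed.

Lemma psiAs1 : psiAs 1%g = 1%g.
Proof. by rewrite [psiAs _]psiAs_wordE. Qed.

Lemma psiAsM p a : (psiAs (p * as_gen (X := QX X) a) = psiAs p * as_gen (psi p a))%g.
Proof.
elim/(@as_ind (QX X)): p => w.
rewrite -(as_class_cons _ true) !psiAs_wordE !psi_wordE /psiAs_word -cats1.
by rewrite foldl_cat /= psiAs_foldl2.
Qed.

Lemma psiAsMV p a : (psiAs (p * (as_gen (X := QX X) a)^-1) =
  psiAs p * (as_gen (psi (p * (as_gen (X := QX X) a)^-1) a))^-1)%g.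
Proof.
rewrite psiMV; elim/(@as_ind (QX X)): p => w.
rewrite -(as_class_cons _ false) !psiAs_wordE !psi_wordE /psiAs_word -cats1.
by rewrite foldl_cat /= psiAs_foldl2.
Qed.

End Psi.

Notation unit_interval R := (set_type `[(0 : R), 1]%classic).

Section CubicalSpace.
Variables (R : realType) (X : biquandle).
(* The quotient of the disjoint union of the [0,1]^n x A x X^n, where a label *)
(* a in A is replaced by [act a x] when a coordinate coloured x equals 1.     *)
Variables (A : choiceType) (act : A -> X -> A).
Local Notation I := (unit_interval R).

Definition precube :=
  {n : nat & ('rV[I]_n * discrete_topology (A * n.-tuple X)%type)%type}.
HB.instance Definition _ := Topological.on precube.

(* A point (t_1, ..., t_n; a, x_1, ..., x_n) read as a and the list of the    *)
(* pairs (t_i, x_i).                                                          *)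
Definition reading (c : precube) : A * seq (I * X) :=
  let: existT n (t, (a, x)) := c in
  (a, [seq (t ord0 i, tnth x i) | i <- enum 'I_n]).

Inductive cube_rel : A * seq (I * X) -> A * seq (I * X) -> Prop :=
| CubeFace0 a s1 (t : I) x s2 : set_val t = 0 ->
    cube_rel (a, s1 ++ (t, x) :: s2) (a, s1 ++ s2)
| CubeFace1 a s1 (t : I) x s2 : set_val t = 1 ->
    cube_rel (a, s1 ++ (t, x) :: s2)
      (act a x, [seq (p.1, bun p.2 x) | p <- s1] ++
                [seq (p.1, bov p.2 x) | p <- s2])
| CubeDegenerate a s1 (t1 t2 u1 u2 : I) x s2 :
    set_val t1 + set_val t2 = set_val u1 + set_val u2 ->
    cube_rel (a, s1 ++ (t1, x) :: (t2, x) :: s2)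
             (a, s1 ++ (u1, x) :: (u2, x) :: s2).

Definition precube_rel (c c' : precube) : Prop :=
  cube_rel (reading c) (reading c').

Definition cubical : Type := quotient_topology (gen_quot precube_rel).
HB.instance Definition _ := Topological.on cubical.

Definition precube_of (a : A) (s : seq (I * X)) : precube :=
  existT _ (size s) (\row_i (tnth (in_tuple s) i).1,
                     (a, map_tuple snd (in_tuple s))).

Lemma reading_of a s : reading (precube_of a s) = (a, s).
Proof.
rewrite /reading /precube_of; congr pair.
rewrite (eq_map (g := tnth (in_tuple s))); last first.
  by move=> i /=; rewrite mxE tnth_map -surjective_pairing.
by rewrite map_tnth_enum.
Qed.

Lemma precube_ofK c : precube_of (reading c).1 (reading c).2 = c.
Proof.
case: c => n [t [a x]] /=.
have aux m (s : m.-tuple (I * X)) : precube_of a s =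
    existT _ m (\row_i (tnth s i).1, (a, map_tuple snd s)).
  case: s => s /= sm; move: (sm); rewrite -(eqP sm) => e.
  rewrite /precube_of; congr existT.
  suff -> : in_tuple s = Tuple e by [].
  exact: val_inj.
rewrite -[[seq _ | _ <- _]]/(tval [tuple (t ord0 i, tnth x i) | i < n]) aux.
have -> : \row_i (tnth [tuple (t ord0 i, tnth x i) | i < n] i).1 = t.
  by apply/rowP => i; rewrite mxE tnth_mktuple.
have -> // : map_tuple snd [tuple (t ord0 i, tnth x i) | i < n] = x.
by apply: eq_from_tnth => i; rewrite tnth_map tnth_mktuple.
Qed.

Lemma reading_inj : injective reading.
Proof. by move=> c d e; rewrite -(precube_ofK c) -(precube_ofK d) e. Qed.

(* The point [t_1, ..., t_n; a, x_1, ..., x_n].                               *)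
Definition cube_pt (a : A) (s : seq (I * X)) : cubical :=
  gen_class precube_rel (precube_of a s).

Lemma cube_pt_rel a s b s' : cube_rel (a, s) (b, s') ->
  cube_pt a s = cube_pt b s'.
Proof. by move=> h; apply: gen_class_step; rewrite /precube_rel !reading_of. Qed.

Lemma cube_pt_cvg (T : Type) (F : set_system T) {FF : Filter F} a (z : T)
    (s : seq ((T -> I) * X)) :
  (forall i : 'I_(size s), (tnth (in_tuple s) i).1 w @[w --> F] -->
     (tnth (in_tuple s) i).1 z) ->
  cube_pt a [seq (p.1 w, p.2) | p <- s] @[w --> F] -->
    cube_pt a [seq (p.1 z, p.2) | p <- s].
Proof.
move=> hs.
pose g (w : T) : precube := existT _ (size s)
  (\row_i (tnth (in_tuple s) i).1 w, (a, map_tuple snd (in_tuple s))).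
have gE w : cube_pt a [seq (p.1 w, p.2) | p <- s] = gen_class _ (g w).
  congr gen_class; apply: reading_inj; rewrite reading_of /=; congr pair.
  under [RHS]eq_map do rewrite mxE tnth_map /=.
  have es : [seq tnth (in_tuple s) i | i <- enum 'I_(size s)] = s.
    exact: (map_tnth_enum (in_tuple s)).
  rewrite -[in LHS]es -map_comp.
  by apply: eq_map => i.
rewrite gE; under eq_fun do rewrite gE.
apply: (cvg_comp g (gen_class _)); last first.
  exact: (@pi_continuous _ (gen_quot precube_rel) (g z)).
move=> U; rewrite /nbhs /= /sigT_nbhs /= => -[[V W] /= [[P Pz PV] Wx] VW].
have : \forall w \near F, forall i, P ord0 i ((tnth (in_tuple s) i).1 w).
  apply: filter_forall => i; apply: (hs i).
  by have := Pz ord0 i; rewrite mxE.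
apply: filterS => w Pw; apply: (VW (_, _)); split => /=.
  by apply: PV => i j; rewrite mxE ord1.
exact: nbhs_singleton Wx.
Qed.

End CubicalSpace.

Section CubicalMap.
Variables (R : realType) (X X' : biquandle) (A A' : choiceType).
Variables (act : A -> X -> A) (act' : A' -> X' -> A').
Variables (al : A -> A') (f : A -> X -> X').
Hypothesis al_act : forall a x, al (act a x) = act' (al a) (f a x).
Hypothesis f_un : forall a x y, f (act a x) (bun y x) = bun (f a y) (f a x).
Hypothesis f_ov : forall a x y, f (act a x) (bov y x) = bov (f a y) (f a x).
Local Notation I := (unit_interval R).

Definition precube_map (c : precube R X A) : precube R X' A' :=
  let: existT n (t, (a, x)) := c in
  existT _ n (t, (al a, map_tuple (f a) x)).

Definition cube_map : cubical R act -> cubical R act' :=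
  (gen_class (precube_rel act') \o precube_map) \o repr.

Let rd (r : A * seq (I * X)) : A' * seq (I * X') :=
  (al r.1, [seq (p.1, f r.1 p.2) | p <- r.2]).

Lemma reading_map c : reading (precube_map c) = rd (reading c).
Proof.
case: c => n [t [a x]]; rewrite /rd /= -map_comp; congr pair.
by apply: eq_map => i /=; rewrite tnth_map.
Qed.

Lemma cube_rel_map r r' : cube_rel act r r' -> cube_rel act' (rd r) (rd r').
Proof.
case=> [a s1 t x s2 t0|a s1 t x s2 t1|a s1 t1 t2 u1 u2 x s2 e];
  rewrite /rd /= !map_cat /=.
- exact: CubeFace0.
- have -> : [seq (p.1, f (act a x) p.2) | p <- [seq (p.1, bun p.2 x) | p <- s1]] =
      [seq (p.1, bun p.2 (f a x)) | p <- [seq (p.1, f a p.2) | p <- s1]].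
    by rewrite -!map_comp; apply: eq_map => p /=; rewrite f_un.
  have -> : [seq (p.1, f (act a x) p.2) | p <- [seq (p.1, bov p.2 x) | p <- s2]] =
      [seq (p.1, bov p.2 (f a x)) | p <- [seq (p.1, f a p.2) | p <- s2]].
    by rewrite -!map_comp; apply: eq_map => p /=; rewrite f_ov.
  by rewrite al_act; exact: CubeFace1.
- exact: CubeDegenerate.
Qed.

Lemma precube_map_rel c c' : precube_rel act c c' ->
  gen_class (precube_rel act') (precube_map c) =
  gen_class (precube_rel act') (precube_map c').
Proof.
by move=> h; apply: gen_class_step; rewrite /precube_rel !reading_map;
   exact: cube_rel_map.
Qed.

Lemma cube_map_pt a s :
  cube_map (cube_pt act a s) = cube_pt act' (al a) [seq (p.1, f a p.2) | p <- s].
Proof.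
rewrite /cube_map /cube_pt /=.
rewrite (gen_class_lift precube_map_rel (precube_of a s)).
congr gen_class; apply: reading_inj; rewrite reading_map !reading_of.
by [].
Qed.

Lemma precube_map_continuous : continuous precube_map.
Proof.
move=> [n [t [a x]]] U.
rewrite /nbhs /= /sigT_nbhs /= => -[[V W] /= [Vt Wx] VW].
exists (V, [set (a, x)]); first by split => //; exact: discrete_set1.
move=> -[t' ax'] /= [Vt' ->] /=; apply: (VW (_, _)); split => //=.
exact: nbhs_singleton Wx.
Qed.

Lemma cube_map_continuous : continuous cube_map.
Proof.
apply: repr_comp_continuous => [|c c' /eqP cc'].
- move=> c; apply: continuous_comp; first exact: precube_map_continuous.
  exact: pi_continuous.
- have h d := gen_class_lift precube_map_rel d.
  by apply/eqP; rewrite -[LHS]h -[RHS]h /=; congr (gen_class _ (precube_map (repr _))).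
Qed.

End CubicalMap.

Section BiquandleSpaces.
Variables (R : realType) (X : biquandle).
Local Notation I := (unit_interval R).

(* B^Q X (trivial labels) and its universal covering (labels in As(X)).       *)
Definition BQ := @cubical R X unit (fun _ _ => tt).
Definition EQ := @cubical R X (As X) (fun g x => g * as_gen x)%g.
HB.instance Definition _ := Topological.on BQ.
HB.instance Definition _ := Topological.on EQ.

(* The point [t_1, ..., t_n; x_1, ..., x_n] of B^Q X.                         *)
Definition bpt (s : seq (I * X)) : BQ := cube_pt _ tt s.

Definition BQ0 : BQ := bpt [::].
Definition EQ0 : EQ := cube_pt _ 1%g [::].

Definition covering : EQ -> BQ :=
  cube_map (fun _ _ => tt) (fun=> tt) (fun _ => id).

Lemma covering_continuous : continuous covering.
Proof. exact: cube_map_continuous. Qed.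

Lemma covering_base : covering EQ0 = BQ0.
Proof. exact: cube_map_pt. Qed.

End BiquandleSpaces.
Arguments covering {R X} _.

Section PsiB.
Variables (R : realType) (X : biquandle).

Definition psiB : EQ R (QX X) -> EQ R X :=
  @cube_map R (QX X) X (As (QX X)) (As X) (fun g x => g * as_gen x)%g
    (fun g x => g * as_gen x)%g (@psiAs X) (@psi X).

Lemma psi_bun (p : As (QX X)) (x y : QX X) :
  psi (p * as_gen x)%g (bun y x) = bun (psi p y) (psi p x).
Proof. by rewrite psiM psi_qX_op qX_opE. Qed.

Lemma psiB_pt (p : As (QX X)) s : psiB (cube_pt _ p s) =
  cube_pt _ (psiAs p) [seq (c.1, psi p c.2) | c <- s].
Proof.
apply: cube_map_pt => *; [exact: psiAsM | exact: psi_bun | exact: psiM].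
Qed.

Lemma psiB_continuous : continuous psiB.
Proof.
apply: cube_map_continuous => *;
  [exact: psiAsM | exact: psi_bun | exact: psiM].
Qed.

Lemma psiB_base : psiB (EQ0 R (QX X)) = EQ0 R X.
Proof. by rewrite psiB_pt /= psiAs1. Qed.

End PsiB.
Arguments psiB {R X} _.

Notation plane R := ((R : Type) * (R : Type))%type.
(* S^2 as the one-point compactification of the plane; [None] is infinity.    *)
Notation sphere R := (one_point_compactification (plane R)).

Record sphere_map (R : realType) (Y : topologicalType) (y : Y) := SphereMap {
  smap :> sphere R -> Y;
  smap_continuous : continuous smap;
  smap_base : smap None = y }.

HB.instance Definition _ (R : realType) (Y : topologicalType) (y : Y) :=
  gen_eqMixin (sphere_map R y).
HB.instance Definition _ (R : realType) (Y : topologicalType) (y : Y) :=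
  gen_choiceMixin (sphere_map R y).

Section Pi2.
Variables (R : realType) (Y : topologicalType) (y : Y).
Local Notation I := (unit_interval R).

Definition based_homotopic (f g : sphere_map R y) : Prop :=
  exists H : sphere R * I -> Y, [/\ continuous H,
    forall z (t : I), set_val t = 0 -> H (z, t) = f z,
    forall z (t : I), set_val t = 1 -> H (z, t) = g z &
    forall t, H (None, t) = y].

(* Based homotopy is already an equivalence relation.                         *)
Definition pi2 := gen_quot based_homotopic.
HB.instance Definition _ := Choice.on pi2.

Definition pi2_class (f : sphere_map R y) : pi2 := gen_class based_homotopic f.

Lemma const_continuous_base : continuous (fun _ : sphere R => y).
Proof. exact: cst_continuous. Qed.

Definition pi2_one : pi2 :=
  pi2_class (SphereMap const_continuous_base erefl).

End Pi2.

Section Pi2Map.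
Variables (R : realType) (Y Z : topologicalType) (y : Y) (z : Z) (h : Y -> Z).
Hypotheses (h_cts : continuous h) (h_base : h y = z).

Lemma sphere_comp_continuous (f : sphere_map R y) : continuous (h \o f).
Proof.
by move=> x; apply: continuous_comp; [exact: smap_continuous | exact: h_cts].
Qed.

Lemma sphere_comp_base (f : sphere_map R y) : (h \o f) None = z.
Proof. by rewrite /= smap_base. Qed.

Definition sphere_comp (f : sphere_map R y) : sphere_map R z :=
  SphereMap (@sphere_comp_continuous f) (sphere_comp_base f).

Definition pi2_map (a : pi2 R y) : pi2 R z := pi2_class (sphere_comp (repr a)).

Lemma pi2_mapE f : pi2_map (pi2_class f) = pi2_class (sphere_comp f).
Proof.
apply: (gen_class_lift (f := @pi2_class R Z z \o sphere_comp)).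
move=> f1 f2 [H [cH H0 H1 Hb]]; apply: gen_class_step.
exists (h \o H); split => [x|x t t0|x t t1|t] /=.
- by apply: continuous_comp; [exact: cH | exact: h_cts].
- by rewrite H0.
- by rewrite H1.
- by rewrite Hb.
Qed.

End Pi2Map.

Section PsiStar.
Variables (R : realType) (X : biquandle).

Definition covering_star (Z : biquandle) : pi2 R (EQ0 R Z) -> pi2 R (BQ0 R Z) :=
  pi2_map (@covering_continuous R Z) (@covering_base R Z).

Definition psiB_star : pi2 R (EQ0 R (QX X)) -> pi2 R (EQ0 R X) :=
  pi2_map (@psiB_continuous R X) (@psiB_base R X).

(* [covering_star] is bijective, since [covering] is the universal covering;  *)
(* its inverse is obtained by choosing a preimage.                            *)
Definition covering_star_inv (a : pi2 R (BQ0 R (QX X))) :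
    pi2 R (EQ0 R (QX X)) :=
  xget (pi2_one R (EQ0 R (QX X))) [set b | covering_star b = a].

Definition psi_star (a : pi2 R (BQ0 R (QX X))) : pi2 R (BQ0 R X) :=
  covering_star (psiB_star (covering_star_inv a)).

End PsiStar.

(* Finitely many C^1 closed curves of period 1 with nonvanishing velocity.    *)
Record closed_curves (R : realType) := ClosedCurves {
  ncomp : nat;
  curve : 'I_ncomp -> R -> plane R;
  curve_periodic : forall i s, curve i (s + 1) = curve i s;
  curve_derivable : forall i s, derivable (curve i) s 1;
  curve_C1 : forall i, continuous (derive1 (curve i));
  curve_regular : forall i s, derive1 (curve i) s != 0 }.

Section Strands.
Variables (R : realType) (L : closed_curves R).

(* A parameter on one of the curves; parameters are taken modulo [same].      *)
Definition strand : Type := ('I_(ncomp L) * R)%type.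
Implicit Types p q : strand.

Definition same p q := p.1 = q.1 /\ exists k : int, q.2 = p.2 + k%:~R.

Definition pos p : plane R := curve p.1 p.2.
Definition vel p : plane R := derive1 (curve p.1) p.2.
Definition image : set (plane R) := range pos.

Definition dot (v w : plane R) : R := v.1 * w.1 + v.2 * w.2.

(* The velocity rotated counterclockwise by 90 degrees.                       *)
Definition normal p : plane R := (- (vel p).2, (vel p).1).

Definition double p q := ~ same p q /\ pos p = pos q.
Definition crossing_pt p := exists q, double p q.

(* The piece containing p of the curves cut at the parameters in Z.           *)
Definition cut (Z : set strand) p : set strand := [set q | p.1 = q.1 /\
  exists k : int, forall s,
    (p.2 <= s <= q.2 + k%:~R) || (q.2 + k%:~R <= s <= p.2) -> ~ Z (p.1, s)].

Definition piece (Z : set strand) : Type :=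
  {A : set strand | exists2 p, ~ Z p & A = cut Z p}.

(* [A] is the piece that starts at p in the direction of the orientation      *)
(* (u > 0), or against it (u < 0).                                            *)
Definition germ (Z : set strand) p (u : R) (A : piece Z) : Prop :=
  \forall e \near 0^'+, sval A (p.1, p.2 + u * e).

(* At a crossing of the strands through p and q: the piece of the strand of p *)
(* on the side of the strand of q from which the normal of q points           *)
(* ([behind]), respectively to which it points ([ahead]).                     *)
Definition behind (Z : set strand) p q : piece Z -> Prop :=
  germ p (- Num.sg (dot (vel p) (normal q))).
Definition ahead (Z : set strand) p q : piece Z -> Prop :=
  germ p (Num.sg (dot (vel p) (normal q))).

Definition trace (Z : set strand) (A : piece Z) : set (plane R) :=
  pos @` sval A.

End Strands.
Arguments behind {R L Z} p q _.
Arguments ahead {R L Z} p q _.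

Record diagram (R : realType) := Diagram {
  curves :> closed_curves R;
  overp : strand curves -> bool;
  crossing_finite :
    finite_set [set p : strand curves | 0 <= p.2 < 1 /\ crossing_pt p];
  no_triple_point : forall p q r : strand curves,
    double p q -> double p r -> same q r;
  transverse : forall p q : strand curves,
    double p q -> dot (vel p) (normal q) != 0;
  over_under : forall p q : strand curves, double p q -> overp p = ~~ overp q }.

Section Diagrams.
Variables (R : realType) (D : diagram R).

Definition under_pt (p : strand D) : Prop := crossing_pt p /\ ~~ overp p.

Definition semiarc := piece (@crossing_pt R D).
Definition arc := piece under_pt.

(* The under-strand at p crosses the over-strand at q.                        *)
Definition crosses_under (p q : strand D) : Prop := double p q /\ ~~ overp p.

Definition crossing_at (c : plane R) (p q : strand D) : Prop :=
  pos p = c /\ crosses_under p q.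
Definition crossing := {c : plane R | exists p q, crossing_at c p q}.

(* For a crossing with under-strand at p and over-strand at q, the semi-arcs  *)
(* adjacent to the specified region are those behind the other strand.        *)
Definition is_coloring (X : biquandle) (C : semiarc -> X) : Prop :=
  forall p q si sj sk sl, crosses_under p q ->
    behind p q si -> behind q p sj -> ahead p q sk -> ahead q p sl ->
    bun (C si) (C sj) = C sk /\ bov (C sj) (C si) = C sl.

Definition is_qcoloring (Q : quandle) (C : arc -> Q) : Prop :=
  forall p q ai aj ak, crosses_under p q ->
    behind p q ai -> sval aj q -> ahead p q ak -> qop (C ai) (C aj) = C ak.

End Diagrams.

Record coloring (R : realType) (X : biquandle) (D : diagram R) := Coloring {
  color :> semiarc D -> X;
  colorP : is_coloring color }.

Record qcoloring (R : realType) (Q : quandle) (D : diagram R) := QColoring {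
  qcolor :> arc D -> Q;
  qcolorP : is_qcoloring qcolor }.

HB.instance Definition _ (R : realType) (X : biquandle) (D : diagram R) :=
  gen_eqMixin (coloring X D).
HB.instance Definition _ (R : realType) (X : biquandle) (D : diagram R) :=
  gen_choiceMixin (coloring X D).
HB.instance Definition _ (R : realType) (Q : quandle) (D : diagram R) :=
  gen_eqMixin (qcoloring Q D).
HB.instance Definition _ (R : realType) (Q : quandle) (D : diagram R) :=
  gen_choiceMixin (qcoloring Q D).

HB.instance Definition _ (R : realType) (L : closed_curves R)
  (Z : set (strand L)) := gen_eqMixin (piece Z).
HB.instance Definition _ (R : realType) (L : closed_curves R)
  (Z : set (strand L)) := gen_choiceMixin (piece Z).
HB.instance Definition _ (R : realType) (D : diagram R) :=
  gen_eqMixin (crossing D).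
HB.instance Definition _ (R : realType) (D : diagram R) :=
  gen_choiceMixin (crossing D).

Section StrandTheory.
Variables (R : realType) (L : closed_curves R).
Implicit Types (p q : strand L) (Z : set (strand L)).

Lemma curve_periodicz (i : 'I_(ncomp L)) s (k : int) :
  curve i (s + k%:~R) = curve i s.
Proof.
have nat_case n x : curve i (x + n%:R) = curve i x.
  elim: n => [|n IH]; first by rewrite addr0.
  by rewrite -natr1 addrA curve_periodic.
case: (intP k) => [|n|n].
- by rewrite addr0.
- exact: nat_case.
- have := nat_case n.+1 (s - n.+1%:R); rewrite subrK => ->.
  by rewrite mulrNz -pmulrn.
Qed.

Lemma same_refl p : same p p.
Proof. by split=> //; exists 0; rewrite addr0. Qed.

Lemma same_sym p q : same p q -> same q p.
Proof.
move=> [e [k h]]; split=> //; exists (- k).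
by rewrite h mulrNz addrK.
Qed.

Lemma same_trans p q r : same p q -> same q r -> same p r.
Proof.
move=> [e [k h]] [e' [k' h']]; split; first by rewrite e.
by exists (k + k'); rewrite h' h intrD addrA.
Qed.

Lemma same_pos p q : same p q -> pos p = pos q.
Proof.
by case: p q => [i s] [j t] [/= <- [k ->]]; rewrite /pos /= curve_periodicz.
Qed.

Lemma same_vel p q : same p q -> vel p = vel q.
Proof.
case: p q => [i s] [j t] [/= <- [k ->]]; rewrite /vel /= /derive1.
by under [in RHS]eq_fun do rewrite addrA !curve_periodicz.
Qed.

Lemma same_crossing p q : same p q -> crossing_pt p -> crossing_pt q.
Proof.
move=> pq [r [pr e]]; exists r; split; last by rewrite -(same_pos pq).
by move=> qr; apply: pr; exact: same_trans qr.
Qed.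

Section Cut.
Variable Z : set (strand L).
Hypothesis Z_same : forall p q, same p q -> Z p -> Z q.

Lemma cut_sym p q : cut Z p q -> cut Z q p.
Proof.
move=> [e [k h]]; split=> //; exists (- k) => s hs Zs.
apply: (h (s + k%:~R)).
  by move: hs; rewrite mulrNz; lra.
by apply: Z_same Zs; split=> //=; exists k.
Qed.

Lemma cut_trans p q r : cut Z p q -> cut Z q r -> cut Z p r.
Proof.
move=> [e [k h]] [e' [k' h']]; split; first by rewrite e.
exists (k + k') => s hs Zs.
have [h1|h1] := boolP ((p.2 <= s <= q.2 + k%:~R) || (q.2 + k%:~R <= s <= p.2)).
  exact: (h s).
apply: (h' (s - k%:~R)); last first.
  by apply: Z_same Zs; split=> //=; exists (- k); rewrite mulrNz.
by move: hs h1; rewrite intrD; lra.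
Qed.

Lemma cut_refl p : ~ Z p -> cut Z p p.
Proof.
move=> Zp; split=> //; exists 0 => s hs Zs; apply: Zp.
suff -> : p = (p.1, s) by [].
by rewrite [p in LHS]surjective_pairing; congr pair; lra.
Qed.

Lemma cut_same p q : ~ Z p -> same p q -> cut Z p q.
Proof.
move=> Zp [e [k h]]; split=> //; exists (- k) => s hs Zs; apply: Zp.
suff -> : p = (p.1, s) by [].
rewrite [p in LHS]surjective_pairing; congr pair.
by move: hs; rewrite h mulrNz; lra.
Qed.

Lemma cut_notin p q : cut Z p q -> ~ Z q.
Proof.
move=> [e [k h]] Zq; apply: (h (q.2 + k%:~R)); first by lra.
by apply: Z_same Zq; split=> //=; exists k.
Qed.

Lemma piece_eq (A B : piece Z) p : sval A p -> sval B p -> A = B.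
Proof.
move: A B => [A [a Za EA]] [B [b Zb EB]] /= Ap Bp; apply: eq_exist => /=.
move: Ap Bp; rewrite {}EA {}EB => ap bp; apply/seteqP; split=> x hx.
- exact: cut_trans bp (cut_trans (cut_sym ap) hx).
- exact: cut_trans ap (cut_trans (cut_sym bp) hx).
Qed.

Lemma piece_same (A : piece Z) p q : same p q -> sval A p -> sval A q.
Proof.
case: A => A [a Za EA] /= pq; rewrite EA => ap.
by apply: (cut_trans ap); apply: cut_same => //; exact: cut_notin ap.
Qed.

Lemma piece_notin (A : piece Z) p : sval A p -> ~ Z p.
Proof. by case: A => A [a Za EA] /=; rewrite EA; exact: cut_notin. Qed.

Lemma germ_eq (A B : piece Z) p q u : same p q -> germ p u A -> germ q u B ->
  A = B.
Proof.
move=> pq gA gB.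
have /filter_ex [e [Ae Be]] : \forall e \near (0 : R)^'+,
    sval A (p.1, p.2 + u * e) /\ sval B (q.1, q.2 + u * e).
  by near=> e; split; near: e.
apply: (piece_eq _ Be); apply: piece_same Ae.
by case: pq => [/= e1 [k ->]]; split=> //; exists k; rewrite /= addrAC.
Unshelve. all: by end_near. Qed.

Lemma germ_same (A : piece Z) p q u : same p q -> germ p u A -> germ q u A.
Proof.
move=> [/= e1 [k e2]]; rewrite /germ; apply: filterS => e; apply: piece_same.
by split=> //=; exists k; rewrite e2 addrAC.
Qed.

Hypothesis Z_fin : finite_set [set p : strand L | 0 <= p.2 < 1 /\ Z p].

Lemma cut_window_finite i a b : finite_set [set s | a <= s <= b /\ Z (i, s)].
Proof.
pose F0 : set (strand L) := [set p | 0 <= p.2 < 1 /\ Z p].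
pose m := Num.floor a; pose M := `|Num.floor b - m|%N.+1.
apply: (@sub_finite_set _ _ (\bigcup_(n in `I_M)
    ((fun p : strand L => p.2 + (m + n%:Z)%:~R) @` F0))); last first.
  apply: bigcup_finite => [|n _]; first exact: finite_II.
  exact: finite_image.
move=> s [/andP[as_ sb] Zs].
have fs := floor_itv s; rewrite intrD in fs.
have ms : m <= Num.floor s by apply: Num.Theory.le_floor.
have sM : Num.floor s <= Num.floor b by apply: Num.Theory.le_floor.
exists `|Num.floor s - m|%N => /=.
  by rewrite /M /=; lia.
exists (i, s - (Num.floor s)%:~R).
  split => /=; first by lra.
  apply: Z_same Zs; split=> //=; exists (- Num.floor s).
  by rewrite mulrNz.
rewrite /= gez0_abs ?subr_ge0 //.
by rewrite addrCA subrr addr0 subrK.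
Qed.

Lemma cut_isolated p : exists2 d : R, 0 < d &
  forall s, 0 < `|s - p.2| < d -> ~ Z (p.1, s).
Proof.
pose F := [set s | p.2 - 1 <= s <= p.2 + 1 /\ Z (p.1, s)] `\ p.2.
have cF : closed F.
  apply: (accessible_finite_set_closed.1 _).
    by apply: hausdorff_accessible; exact: Rhausdorff.
  by apply: finite_setD; exact: cut_window_finite.
have /nbhs_ballP[e /= e0 he] : nbhs p.2 (~` F).
  by apply: open_nbhs_nbhs; split; [exact: closed_openC | move=> [_ /=]; apply].
exists (Num.min e 1); first by rewrite lt_min e0 ltr01.
move=> s; rewrite lt_min => /andP[s0 /andP[se s1]] Zs.
apply: (he s); first by rewrite /ball /= distrC.
split; last by move=> /= sp; rewrite sp subrr normr0 ltxx in s0.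
split=> //; move: s1; rewrite ltr_norml => /andP[h1 h2].
by apply/andP; split; lra.
Qed.

Lemma germ_ex p u : `|u| = 1 -> exists A : piece Z, germ p u A.
Proof.
move=> u1; have [d d0 hd] := cut_isolated p.
pose q : strand L := (p.1, p.2 + u * (d / 2)).
have uu : u = 1 \/ u = -1.
  by have [u0|u0] := leP 0 u; [left; rewrite -u1 ger0_norm|
    right; rewrite -u1 ltr0_norm // opprK].
have Zq : ~ Z q.
  apply: hd; rewrite addrAC subrr add0r normrM u1 mul1r ger0_norm; lra.
exists (exist _ (cut Z q) (ex_intro2 _ _ q Zq erefl)).
near=> e => /=; split=> //=; exists 0 => s hs.
have e0 : 0 < e by near: e; exact: nbhs_right_gt.
have ed : e < d by near: e; exact: nbhs_right_lt.
apply: hd; case: uu hs => ->; rewrite ?mul1r ?mulN1r addr0 => hs.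
- by rewrite gtr0_norm; lra.
- by rewrite ltr0_norm; lra.
Unshelve. all: by end_near. Qed.

Lemma finite_subsingleton (T : Type) (S : set T) :
  (forall x y, S x -> S y -> x = y) -> finite_set S.
Proof.
move=> hS; have [->|/set0P[x Sx]] := eqVneq S set0; first exact: finite_set0.
by apply: (@sub_finite_set _ _ [set x]) => [y /(hS x y Sx) ->|]; [|exact: finite_set1].
Qed.

Lemma seq_max (r : seq R) x : x \in r ->
  exists2 m, m \in r & forall y, y \in r -> y <= m.
Proof.
elim: r x => // a r IH x _.
case: r IH => [_|b r IH].
  by exists a; rewrite ?inE // => y; rewrite inE => /eqP ->.
have [m mr hm] := IH b (mem_head _ _).
exists (Num.max a m) => [|y].
  by rewrite maxEle; case: ifP; rewrite inE ?mr ?eqxx ?orbT.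
rewrite inE le_max => /orP[/eqP ->|/hm ->]; first by rewrite lexx.
by rewrite orbT.
Qed.

Lemma cut_last i s t : Z (i, t) -> exists m, [/\ m <= s, Z (i, m) &
  forall y, m < y <= s -> ~ Z (i, y)].
Proof.
move=> Zt; pose k := Num.floor (s - t).
have fk : k%:~R <= s - t < k%:~R + 1.
  by have := floor_itv (s - t); rewrite intrD.
have Zk : Z (i, t + k%:~R) by apply: Z_same Zt; split=> //; exists k.
have [r rE] := (finite_seqP _).1 (cut_window_finite i (s - 1) s).
have rP y : y \in r <-> s - 1 <= y <= s /\ Z (i, y).
  by have := congr1 (fun A : set R => A y) rE => /= ->.
have /seq_max[m mr hm] : t + k%:~R \in r by apply/rP; split=> //; lra.
have [/andP[m1 m2] Zm] := (rP m).1 mr.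
exists m; split=> // y /andP[my ys] Zy.
have /hm : y \in r by apply/rP; split=> //; lra.
by rewrite leNgt my.
Qed.

Lemma piece_finite : finite_set [set: piece Z].
Proof.
pose F0 : set (strand L) := [set p | 0 <= p.2 < 1 /\ Z p].
apply: (@sub_finite_set _ _
  ((\bigcup_(p in F0) [set A : piece Z | germ p 1 A]) `|`
   (\bigcup_(i in [set: 'I_(ncomp L)]) [set A : piece Z | sval A (i, 0)])));
  last first.
  rewrite finite_setU; split.
    apply: bigcup_finite => // p _; apply: finite_subsingleton => A B gA gB.
    exact: germ_eq (same_refl p) gA gB.
  apply: bigcup_finite => [|i _]; first exact: finite_finset.
  by apply: finite_subsingleton => A B gA gB; exact: piece_eq gA gB.
move=> A _; have [[i s] Zs EA] := svalP A.
have [[t Zt]|nZ] := pselect (exists t, Z (i, t)); last first.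
  right; exists i => //=; rewrite EA; split=> //=; exists 0 => y _ Zy.
  by apply: nZ; exists y.
have [m [ms Zm hm]] := cut_last s Zt; left.
have {}ms : m < s.
  by rewrite lt_neqAle ms andbT; apply/eqP => e; apply: Zs; rewrite -e.
have fm : (Num.floor m)%:~R <= m < (Num.floor m)%:~R + 1.
  by have := floor_itv m; rewrite intrD.
exists (i, m - (Num.floor m)%:~R).
  split; first by rewrite /=; lra.
  by apply: Z_same Zm; split=> //; exists (- Num.floor m); rewrite mulrNz.
apply: (@germ_same _ (i, m)).
  by split=> //; exists (- Num.floor m); rewrite mulrNz.
near=> e; rewrite /= EA; split=> //=; exists 0 => y hy.
have e0 : 0 < e by near: e; exact: nbhs_right_gt.
have es : e < s - m by near: e; apply: nbhs_right_lt; lra.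
by apply: hm; move: hy; rewrite mul1r addr0; lra.
Unshelve. all: by end_near. Qed.

End Cut.
End StrandTheory.

Section DiagramTheory.
Variables (R : realType) (D : diagram R).
Implicit Types (p q : strand D).

Lemma double_sym p q : double p q -> double q p.
Proof. by move=> [npq e]; split=> // qp; apply: npq; exact: same_sym. Qed.

Lemma double_samel p p' q : same p p' -> double p q -> double p' q.
Proof.
move=> pp' [npq e]; split; last by rewrite -(same_pos pp').
by move=> p'q; apply: npq; exact: same_trans p'q.
Qed.

Lemma overp_same p p' : same p p' -> crossing_pt p -> overp p = overp p'.
Proof.
move=> pp' [q pq].
by rewrite (over_under pq) (over_under (double_samel pp' pq)).
Qed.

Lemma same_under p q : same p q -> under_pt p -> under_pt q.
Proof.
move=> pq [cp op]; split; first exact: same_crossing cp.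
by rewrite -(overp_same pq cp).
Qed.

Lemma crosses_under_over p q : crosses_under p q -> overp q.
Proof. by move=> [pq]; rewrite (over_under pq) negbK. Qed.

Lemma under_finite :
  finite_set [set p : strand D | 0 <= p.2 < 1 /\ under_pt p].
Proof.
by apply: sub_finite_set (crossing_finite D) => p [h [cp _]]; split.
Qed.

Lemma semiarc_finite : finite_set [set: semiarc D].
Proof. exact: piece_finite (@same_crossing _ _) (@crossing_finite R D). Qed.

Lemma sg_normal p q : double p q -> `|Num.sg (dot (vel p) (normal q))| = 1.
Proof. by move=> pq; rewrite normr_sg (transverse pq). Qed.

Lemma behind_ex p q : double p q -> exists s : semiarc D, behind p q s.
Proof.
move=> pq; apply: (germ_ex (@same_crossing _ _) (@crossing_finite R D)).
by rewrite normrN sg_normal.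
Qed.

Lemma ahead_ex p q : double p q -> exists s : semiarc D, ahead p q s.
Proof.
move=> pq; apply: (germ_ex (@same_crossing _ _) (@crossing_finite R D)).
exact: sg_normal.
Qed.

Definition arc_of (s : semiarc D) : arc D :=
  let: exist2 p np _ := cid2 (svalP s) in
  exist _ (cut (@under_pt R D) p)
    (ex_intro2 _ _ p (fun up : under_pt p => np up.1) erefl).

Lemma arc_ofP (s : semiarc D) q : sval s q -> sval (arc_of s) q.
Proof.
rewrite /arc_of; case: cid2 => p np /= ->.
move=> [e [k h]]; split=> //; exists k => t /h ht [ct _]; exact: ht.
Qed.

Lemma germ_arc_of (s : semiarc D) p u : germ p u s -> germ p u (arc_of s).
Proof. by apply: filterS => e; exact: arc_ofP. Qed.

Lemma germ_arc_mem (s : semiarc D) q u : `|u| = 1 -> germ q u s ->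
  ~ under_pt q -> sval (arc_of s) q.
Proof.
move=> u1 /nbhs_ballP[d /= d0 hd] nq.
have hs e : 0 < e < d -> sval s (q.1, q.2 + u * e).
  move=> /andP[e0 ed]; apply: (hd e) => //.
  by rewrite /ball /= sub0r normrN gtr0_norm.
have d2 : 0 < d / 2 < d by lra.
have Aq := arc_ofP (hs _ d2).
case: (arc_of s) Aq => A [p np EA] /=; rewrite EA => pq'.
apply: (cut_trans same_under pq'); apply: (cut_sym same_under).
split=> //=; exists 0 => t ht ut.
have [tq|tq] := eqVneq t q.2.
  by apply: nq; move: ut; rewrite tq -surjective_pairing.
have uu : u = 1 \/ u = -1.
  by have [u0|u0] := leP 0 u; [left; rewrite -u1 ger0_norm|
    right; rewrite -u1 ltr0_norm // opprK].
have he : 0 < u * (t - q.2) < d.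
  by case: uu ht => ->; rewrite ?mul1r ?mulN1r addr0; move: tq; lra.
apply: (piece_notin (@same_crossing _ _) (hs _ he)).
have -> : q.2 + u * (u * (t - q.2)) = t.
  by case: uu => ->; lra.
by case: ut.
Qed.

End DiagramTheory.

Section QColoringAsColoring.
Variables (R : realType) (X : biquandle) (D : diagram R).
Variable C : qcoloring (quandle_of_biquandle X) D.

Lemma semiarc_coloringP :
  @is_coloring R D (QX X) (fun s => C (arc_of s)).
Proof.
move=> p q si sj sk sl pq bi bj ak al.
have nq : ~ under_pt q by move=> [_]; rewrite (crosses_under_over pq).
have qp := double_sym pq.1.
have jq : sval (arc_of sj) q.
  by apply: germ_arc_mem bj nq; rewrite normrN sg_normal.
have lq : sval (arc_of sl) q by apply: germ_arc_mem al nq; rewrite sg_normal.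
split.
- exact: (@qcolorP _ _ _ C p q (arc_of si) (arc_of sj) (arc_of sk) pq
    (germ_arc_of bi) jq (germ_arc_of ak)).
- by rewrite (piece_eq (@same_under _ _) jq lq).
Qed.

Definition semiarc_coloring : coloring (QX X) D := Coloring semiarc_coloringP.

End QColoringAsColoring.

Section Regions.
Variables (R : realType) (D : diagram R).

Definition is_region (A : set (plane R)) : Prop :=
  exists2 z, ~ image D z & A = connected_component (~` image D) z.
Definition region := {A : set (plane R) | is_region A}.

(* The normal of s points from the region A to the region B.                  *)
Definition points_to (s : semiarc D) (A B : region) : Prop :=
  exists2 p, sval s p & \forall e \near 0^'+,
    sval A (pos p - e *: normal p) /\ sval B (pos p + e *: normal p).

Variable X : biquandle.
Variable C : semiarc D -> X.

Definition is_region_coloring (CR : region -> As X) : Prop :=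
  (forall A, ~ bounded_set (sval A) -> CR A = 1%g) /\
  (forall s A B, points_to s A B -> (CR A * as_gen (C s))%g = CR B).

(* C^R: the unique region coloring (the default value is never used).         *)
Definition region_coloring : region -> As X :=
  xget (fun=> 1%g) is_region_coloring.

(* The color of the specified region of s, i.e. of the region from which the  *)
(* normal of s points to the other side.                                      *)
Definition specified_color (s : semiarc D) : As X :=
  xget 1%g [set g | exists A B, points_to s A B /\ g = region_coloring A].

Definition shadow_coloring (s : semiarc D) : As X * X :=
  (specified_color s, C s).

End Regions.

Definition Psi (R : realType) (X : biquandle) (D : diagram R)
    (C : qcoloring (quandle_of_biquandle X) D) (s : semiarc D) : X :=
  let: (g, a) := shadow_coloring (semiarc_coloring C) s in psi g a.

Section Bicollars.
Variables (R : realType) (D : diagram R).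
Local Notation I := (unit_interval R).

(* The parameters of the strand through p reached from p inside A.            *)
Definition core (A : set (plane R)) (p : strand D) : set (strand D) :=
  [set q | q.1 = p.1 /\ forall s, (p.2 <= s <= q.2) || (q.2 <= s <= p.2) ->
    A (pos (p.1, s))].

Definition inside (t : I) : Prop := 0 < set_val t < 1.

(* Thin bicollars of the strands.  [strip s] is the part of the closed        *)
(* bicollar of the semi-arc s away from the crossings: its interior           *)
(* [0 < height s z < 1] is homeomorphic to (a part of s) x ]0,1[ by the foot  *)
(* point and the normal coordinate [height]; closed strips may touch (at      *)
(* corners of the boxes).  At a crossing c the bicollars of the two strands   *)
(* intersect in [box c], which is homeomorphic to [0,1]^2 by the normal       *)
(* coordinates [uheight] of the under-strand and [oheight] of the             *)
(* over-strand.  The strands have normal coordinate 1/2.                      *)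
Record bicollar := Bicollar {
  strip : semiarc D -> set (plane R);
  foot : semiarc D -> plane R -> plane R;
  height : semiarc D -> plane R -> I;
  box : crossing D -> set (plane R);
  uheight : crossing D -> plane R -> I;
  oheight : crossing D -> plane R -> I;
  support : set (plane R);
  supportE : support = (\bigcup_s strip s) `|` (\bigcup_c box c);

  strip_compact : forall s, compact (strip s);
  height_continuous : forall s, {within strip s, continuous (height s)};
  foot_continuous : forall s,
    {within strip s `&` [set z | inside (height s z)], continuous (foot s)};
  strip_bij : forall s, set_bij
    (strip s `&` [set z | inside (height s z)])
    ((strip s `&` trace s) `*` [set t | inside t])
    (fun z => (foot s z, height s z));
  strip_core : forall s z, strip s z -> trace s z ->
    foot s z = z /\ set_val (height s z) = 1 / 2;
  strip_image : forall s, strip s `&` image D `<=` trace s;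
  strip_normal : forall s p, sval s p -> strip s (pos p) ->
    \forall e \near 0^'+,
      (strip s (pos p + e *: normal p) ->
         1 / 2 < set_val (height s (pos p + e *: normal p))) /\
      (strip s (pos p - e *: normal p) ->
         set_val (height s (pos p - e *: normal p)) < 1 / 2);
  strip_disjoint : forall s s' z, strip s z -> strip s' z ->
    inside (height s z) -> s = s';

  box_compact : forall c, compact (box c);
  box_continuous : forall c,
    {within box c, continuous (fun z => (uheight c z, oheight c z))};
  box_bij : forall c,
    set_bij (box c) [set: I * I] (fun z => (uheight c z, oheight c z));
  box_under : forall c p q, crossing_at (sval c) p q -> forall z, box c z ->
    (set_val (uheight c z) = 1 / 2 <-> (@pos R D @` core (box c) p) z);
  box_over : forall c p q, crossing_at (sval c) p q -> forall z, box c z ->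
    (set_val (oheight c z) = 1 / 2 <-> (@pos R D @` core (box c) q) z);
  box_image : forall c p q, crossing_at (sval c) p q -> box c `&` image D `<=`
    (@pos R D @` core (box c) p) `|` (@pos R D @` core (box c) q);
  box_under_normal : forall c p q r, crossing_at (sval c) p q ->
    core (box c) p r -> \forall e \near 0^'+,
      (box c (pos r + e *: normal r) ->
         1 / 2 < set_val (uheight c (pos r + e *: normal r))) /\
      (box c (pos r - e *: normal r) ->
         set_val (uheight c (pos r - e *: normal r)) < 1 / 2);
  box_over_normal : forall c p q r, crossing_at (sval c) p q ->
    core (box c) q r -> \forall e \near 0^'+,
      (box c (pos r + e *: normal r) ->
         1 / 2 < set_val (oheight c (pos r + e *: normal r))) /\
      (box c (pos r - e *: normal r) ->
         set_val (oheight c (pos r - e *: normal r)) < 1 / 2);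
  box_disjoint : forall c c' z, box c z -> box c' z -> c = c';

  (* A strip meets a box only in the side of the box at which its semi-arc    *)
  (* enters, and there its normal coordinate is that of its strand.           *)
  strip_box : forall c p q s z, crossing_at (sval c) p q ->
    box c z -> strip s z ->
    [\/ [/\ behind p q s, set_val (oheight c z) = 0 & height s z = uheight c z],
        [/\ ahead p q s, set_val (oheight c z) = 1 & height s z = uheight c z],
        [/\ behind q p s, set_val (uheight c z) = 0 & height s z = oheight c z]
      | [/\ ahead q p s, set_val (uheight c z) = 1 & height s z = oheight c z]];

  support_image : image D `<=` support;
  strip_interior : forall s z, strip s z -> inside (height s z) ->
    nbhs z support;
  box_interior : forall c z, box c z ->
    inside (uheight c z) \/ inside (oheight c z) -> nbhs z support }.

Variable N : bicollar.
Variables (X : biquandle).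

(* The admissible images of a point z of the plane; [dual_rel_unique] shows   *)
(* that there is at most one when C is a coloring.                            *)
Definition dual_rel (C : semiarc D -> X) (z : plane R) : set (BQ R X) :=
  [set y |
   (exists2 s, strip N s z & y = bpt [:: (height N s z, C s)]) \/
   (exists c p q s1 s2,
     [/\ crossing_at (sval c) p q, box N c z, behind p q s1, behind q p s2 &
      y = bpt [:: (uheight N c z, C s1); (oheight N c z, C s2)]])].

Definition dual_map (C : semiarc D -> X) (z : sphere R) : BQ R X :=
  if z is Some w then xget (BQ0 R X) (dual_rel C w) else BQ0 R X.

End Bicollars.

Section DualMapTheory.
Variables (R : realType) (D : diagram R) (N : bicollar D).
Variables (X : biquandle) (C : coloring X D).
Local Notation I := (unit_interval R).

Lemma unit_interval_cases (t : I) :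
  [\/ inside t, set_val t = 0 | set_val t = 1].
Proof.
have : (0 : R) <= set_val t <= 1.
  by have /set_mem := svalP t; rewrite /= in_itv.
rewrite /inside; case: (ltgtP 0 (set_val t)) => //= [t0|t0] t1; last first.
  by constructor 2.
by case: (ltgtP (set_val t) 1) t1 => // t1 _; [constructor 1|constructor 3].
Qed.

Lemma bpt_end (t : I) (x : X) : ~ inside t -> bpt [:: (t, x)] = BQ0 R X.
Proof.
case: (unit_interval_cases t) => // [t0|t1] _; apply: cube_pt_rel.
- exact: (CubeFace0 _ _ [::] _ [::] t0).
- exact: (CubeFace1 _ _ [::] _ [::] t1).
Qed.

Lemma bpt_under (t u : I) (x y : X) :
  (set_val u = 0 -> bpt [:: (t, x); (u, y)] = bpt [:: (t, x)]) /\
  (set_val u = 1 -> bpt [:: (t, x); (u, y)] = bpt [:: (t, bun x y)]).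
Proof.
split=> h; apply: cube_pt_rel.
- exact: (CubeFace0 _ _ [:: (t, x)] _ [::] h).
- exact: (CubeFace1 _ _ [:: (t, x)] _ [::] h).
Qed.

Lemma bpt_over (t u : I) (x y : X) :
  (set_val t = 0 -> bpt [:: (t, x); (u, y)] = bpt [:: (u, y)]) /\
  (set_val t = 1 -> bpt [:: (t, x); (u, y)] = bpt [:: (u, bov y x)]).
Proof.
split=> h; apply: cube_pt_rel.
- exact: (CubeFace0 _ _ [::] _ [:: (u, y)] h).
- exact: (CubeFace1 _ _ [::] _ [:: (u, y)] h).
Qed.

Lemma crossing_at_unique c (p q p' q' : strand D) :
  crossing_at c p q -> crossing_at c p' q' -> same p p' /\ same q q'.
Proof.
move=> [pc pq] [pc' pq'].
have oq := crosses_under_over pq; have oq' := crosses_under_over pq'.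
case: pq pq' => [pq op] [pq' op']; split.
- have [//|npp] := pselect (same p p').
  have := over_under (conj npp (etrans pc (esym pc'))).
  by rewrite (negbTE op) (negbTE op').
- have [//|nqq] := pselect (same q q').
  have pqq : pos q = pos q' by rewrite -pq.2 -pq'.2 pc pc'.
  have := over_under (conj nqq pqq); by rewrite oq oq'.
Qed.

Lemma behind_unique (p q p' q' : strand D) (s s' : semiarc D) :
  same p p' -> same q q' -> behind p q s -> behind p' q' s' -> s = s'.
Proof.
move=> pp qq; rewrite /behind /normal (same_vel pp) (same_vel qq).
exact: (germ_eq (@same_crossing _ _)).
Qed.

Lemma strip_box_value c p q s s1 s2 z : crossing_at (sval c) p q ->
  box N c z -> strip N s z -> behind p q s1 -> behind q p s2 ->
  bpt [:: (height N s z, C s)] =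
  bpt [:: (uheight N c z, C s1); (oheight N c z, C s2)].
Proof.
move=> cpq bz sz b1 b2; have [_ pq] := cpq.
have [s3 a3] := ahead_ex pq.1; have [s4 a4] := ahead_ex (double_sym pq.1).
have [c3 c4] := colorP C pq b1 b2 a3 a4.
have un r (s' s'' : semiarc D) u : germ r u s' -> germ r u s'' -> s' = s''.
  exact: (germ_eq (@same_crossing _ _) (same_refl r)).
have [hu0 hu1] := bpt_under (uheight N c z) (oheight N c z) (C s1) (C s2).
have [ho0 ho1] := bpt_over (uheight N c z) (oheight N c z) (C s1) (C s2).
case: (strip_box cpq bz sz) => -[bs hh ->].
- by rewrite hu0 // (un _ _ _ _ bs b1).
- by rewrite hu1 // c3 (un _ _ _ _ bs a3).
- by rewrite ho0 // (un _ _ _ _ bs b2).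
- by rewrite ho1 // c4 (un _ _ _ _ bs a4).
Qed.

Lemma dual_rel_unique z y y' : dual_rel N C z y -> dual_rel N C z y' -> y = y'.
Proof.
case=> [[s sz ->]|[c [p [q [s1 [s2 [cpq bz b1 b2 ->]]]]]]];
  case=> [[s' sz' ->]|[c' [p' [q' [s1' [s2' [cpq' bz' b1' b2' ->]]]]]]].
- have [hs|hs] := pselect (inside (height N s z)).
    by rewrite (strip_disjoint sz sz' hs).
  have [hs'|hs'] := pselect (inside (height N s' z)).
    by rewrite (strip_disjoint sz' sz hs').
  by rewrite !bpt_end.
- exact: strip_box_value cpq' _ _ _ _.
- by symmetry; exact: strip_box_value cpq _ _ _ _.
- have cc := box_disjoint bz bz'; move: cpq' bz' b1' b2'; rewrite -cc.
  move=> cpq' _ b1' b2'; have [pp qq] := crossing_at_unique cpq cpq'.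
  by rewrite (behind_unique pp qq b1 b1') (behind_unique qq pp b2 b2').
Qed.

Lemma dual_mapE z y : dual_rel N C z y -> dual_map N C (Some z) = y.
Proof.
move=> zy; rewrite /dual_map; case: xgetP => [y' _ zy'|/(_ y) //].
exact: dual_rel_unique zy.
Qed.

Lemma dual_map_strip s z : strip N s z ->
  dual_map N C (Some z) = bpt [:: (height N s z, C s)].
Proof. by move=> sz; apply: dual_mapE; left; exists s. Qed.

Lemma dual_map_box c : exists s1 s2, forall z, box N c z ->
  dual_map N C (Some z) =
  bpt [:: (uheight N c z, C s1); (oheight N c z, C s2)].
Proof.
have [p [q cpq]] := svalP c.
have [s1 b1] := behind_ex cpq.2.1.
have [s2 b2] := behind_ex (double_sym cpq.2.1).
exists s1, s2 => z bz; apply: dual_mapE; right.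
by exists c, p, q, s1, s2.
Qed.

Lemma dual_map_out z : ~ support N z -> dual_map N C (Some z) = BQ0 R X.
Proof.
move=> nz; rewrite /dual_map; case: xgetP => // y _ zy.
case: nz; rewrite supportE.
case: zy => [[s sz _]|[c [_ [_ [_ [_ [_ bz _ _ _]]]]]]].
- by left; exists s.
- by right; exists c.
Qed.

Lemma dual_map_frontier z : ~ nbhs z (support N) ->
  dual_map N C (Some z) = BQ0 R X.
Proof.
move=> nz.
have [|/dual_map_out //] := pselect (support N z).
rewrite supportE => -[[s _ sz]|[c _ bz]].
  rewrite (dual_map_strip sz) bpt_end // => hs.
  by apply: nz; exact: strip_interior hs.
have [s1 [s2 ->//]] := dual_map_box c.
have nu : ~ inside (uheight N c z).
  by move=> h; apply: nz; apply: box_interior bz _; left.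
have no : ~ inside (oheight N c z).
  by move=> h; apply: nz; apply: box_interior bz _; right.
have [hu0 hu1] := bpt_under (uheight N c z) (oheight N c z) (C s1) (C s2).
case: (unit_interval_cases (oheight N c z)) => // h.
- by rewrite hu0 // bpt_end.
- by rewrite hu1 // bpt_end.
Qed.

Lemma crossing_set_finite : finite_set [set: crossing D].
Proof.
pose F0 : set (strand D) := [set p | 0 <= p.2 < 1 /\ crossing_pt p].
apply: (@sub_finite_set _ _
  (\bigcup_(p in F0) [set c : crossing D | sval c = pos p])); last first.
  apply: bigcup_finite => [|p _]; first exact: crossing_finite.
  apply: finite_subsingleton => -[c hc] [c' hc'] /= e e'.
  by apply: eq_exist; rewrite e e'.
move=> [c hc] _; have [p [q [pc [pq _]]]] := hc.
pose p0 : strand D := (p.1, p.2 - (Num.floor p.2)%:~R).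
have pp0 : same p p0.
  by split=> //; exists (- Num.floor p.2); rewrite mulrNz.
exists p0; last by rewrite /= -(same_pos pp0).
split; last by apply: same_crossing pp0 _; exists q.
by have := floor_itv p.2; rewrite intrD /=; lra.
Qed.

Lemma near_finite (T : Type) (J : choiceType) (F : set_system T)
    {FF : Filter F} (P : J -> set T) :
  finite_set [set: J] -> (forall j, F (P j)) -> F [set w | forall j, P j w].
Proof.
move=> /finite_seqP[r rE] hP.
suff : F [set w | forall j, j \in r -> P j w].
  apply: filterS => w h j; apply: h.
  by have := congr1 (fun A : set J => A j) rE => /= <-.
elim: r {rE} => [|a r IH]; first exact: filterS filterT.
apply: filterS2 (hP a) IH => w Pa h j.
by rewrite inE => /orP[/eqP ->//|]; exact: h.
Qed.

Lemma support_closed : closed (support N).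
Proof.
rewrite supportE; apply: closedU.
- apply: closed_bigcup => [|s _]; first exact: semiarc_finite.
  by apply: compact_closed; [exact: norm_hausdorff | exact: strip_compact].
- apply: closed_bigcup => [|c _]; first exact: crossing_set_finite.
  by apply: compact_closed; [exact: norm_hausdorff | exact: box_compact].
Qed.

Lemma support_compact : compact (support N).
Proof.
have fin (J : choiceType) (A : J -> set (plane R)) : finite_set [set: J] ->
    (forall j, compact (A j)) -> compact (\bigcup_j A j).
  move=> /finite_seqP[r ->] hA; elim: r => [|a r IH].
    by rewrite (_ : \bigcup_(_ in _) _ = set0); [exact: compact0|
      apply/seteqP; split=> // x []].
  rewrite (_ : \bigcup_(_ in _) _ = A a `|` \bigcup_(j in [set` r]) A j).
    by apply: compactU.
  apply/seteqP; split=> x.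
    move=> [j /=]; rewrite inE => /orP[/eqP -> Ax|jr Ax]; first by left.
    by right; exists j.
  move=> [Ax|[j /= jr Ax]]; first by exists a; rewrite //= mem_head.
  by exists j; rewrite //= inE jr orbT.
rewrite supportE; apply: compactU; apply: fin.
- exact: semiarc_finite.
- exact: strip_compact.
- exact: crossing_set_finite.
- exact: box_compact.
Qed.

Lemma dual_map_continuous : continuous (dual_map N C).
Proof.
case=> [z|]; last first.
  move=> U /nbhs_singleton /= U0.
  exists (support N); first by split; [exact: support_compact|exact: support_closed].
  move=> _ [[w nw <-]|-> //].
  by suff : U (dual_map N C (Some w)) by []; rewrite dual_map_out.
move=> U nU; change (\forall w \near z, U (dual_map N C (Some w))).
have hout : \forall w \near z, ~ support N w -> U (dual_map N C (Some w)).
  have [zi|/dual_map_frontier e] := pselect (nbhs z (support N)).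
    by apply: filterS zi.
  near=> w => nw; rewrite dual_map_out // -e; exact: nbhs_singleton nU.
have hstrip : \forall w \near z, forall s, strip N s w ->
    U (dual_map N C (Some w)).
  apply: near_finite => [|s]; first exact: semiarc_finite.
  have [sz|sz] := pselect (strip N s z); last first.
    apply: (@filterS _ _ _ (~` strip N s)); first by move=> w /= nw /nw.
    apply: open_nbhs_nbhs; split=> //; apply: closed_openC.
    by apply: compact_closed; [exact: norm_hausdorff|exact: strip_compact].
  have hc : height N s w @[w --> within (strip N s) (nbhs z)] --> height N s z.
    by have /subspace_continuousP := @height_continuous _ _ N s; apply.
  have hp : bpt [:: (height N s w, C s)] @[w --> within (strip N s) (nbhs z)]
      --> bpt [:: (height N s z, C s)].
    apply: (@cube_pt_cvg R X unit (fun _ _ => tt) _ _ _ tt z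
      [:: (height N s, C s)]) => i.
    by rewrite ord1.
  rewrite -(dual_map_strip sz) in hp.
  have hz : \forall w \near z, strip N s w ->
      U (bpt [:: (height N s w, C s)]) by exact: hp nU.
  apply: filterS hz => w h sw.
  by have := h sw; rewrite -(dual_map_strip sw).
have hbox : \forall w \near z, forall c, box N c w ->
    U (dual_map N C (Some w)).
  apply: near_finite => [|c]; first exact: crossing_set_finite.
  have [cz|cz] := pselect (box N c z); last first.
    apply: (@filterS _ _ _ (~` box N c)); first by move=> w /= nw /nw.
    apply: open_nbhs_nbhs; split=> //; apply: closed_openC.
    by apply: compact_closed; [exact: norm_hausdorff|exact: box_compact].
  have hc : (uheight N c w, oheight N c w) @[w --> within (box N c) (nbhs z)]
      --> (uheight N c z, oheight N c z).
    by have /subspace_continuousP := @box_continuous _ _ N c; apply.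
  have hu : uheight N c w @[w --> within (box N c) (nbhs z)] --> uheight N c z.
    exact: cvg_comp hc (@cvg_fst _ _ _ _ _).
  have ho : oheight N c w @[w --> within (box N c) (nbhs z)] --> oheight N c z.
    exact: cvg_comp hc (@cvg_snd _ _ _ _ _).
  have [s1 [s2 hE]] := dual_map_box c.
  have hp : bpt [:: (uheight N c w, C s1); (oheight N c w, C s2)]
      @[w --> within (box N c) (nbhs z)]
      --> bpt [:: (uheight N c z, C s1); (oheight N c z, C s2)].
    apply: (@cube_pt_cvg R X unit (fun _ _ => tt) _ _ _ tt z
      [:: (uheight N c, C s1); (oheight N c, C s2)]) => i.
    by case: i => [[|[|//]] ?].
  rewrite -(hE z cz) in hp.
  have hz : \forall w \near z, box N c w ->
      U (bpt [:: (uheight N c w, C s1); (oheight N c w, C s2)]) by exact: hp nU.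
  apply: filterS hz => w h cw.
  by have := h cw; rewrite -(hE w cw).
near=> w.
have [|sw] := pselect (support N w); last exact: (near hout w).
rewrite supportE => -[[s _ sw]|[c _ cw]].
- exact: (near hstrip w _ s).
- exact: (near hbox w _ c).
Unshelve. all: by end_near. Qed.

End DualMapTheory.

Section HomotopyInvariant.
Variables (R : realType) (D : diagram R) (N : bicollar D) (X : biquandle).

Definition Xi (C : coloring X D) : pi2 R (BQ0 R X) :=
  pi2_class (SphereMap (@dual_map_continuous R D N X C) erefl).

End HomotopyInvariant.

(* Only the additive group of Z[pi_2(Y)], the free abelian group on pi_2(Y).  *)
Notation group_ring R y := {freeg (pi2 R y)}.

Definition group_elt (R : realType) (Y : topologicalType) (y : Y)
  (a : pi2 R y) : group_ring R y := << (1 : int) *g a >>.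

Section GroupRing.
Variables (R : realType) (D : diagram R) (N : bicollar D) (X : biquandle).

Definition Xi_sum : group_ring R (BQ0 R X) :=
  \sum_(C \in [set: coloring X D]) group_elt (Xi N C).

(* For Q(X) the sum is over the quandle colorings.                            *)
Definition Xi_sum_Q : group_ring R (BQ0 R (QX X)) :=
  \sum_(C \in [set: qcoloring (quandle_of_biquandle X) D])
    group_elt (Xi N (semiarc_coloring C)).

Definition psi_star_ring (a : group_ring R (BQ0 R (QX X))) :
    group_ring R (BQ0 R X) :=
  fglift (fun b => group_elt (psi_star b)) a.

End GroupRing.

(* Main.v *)
(* The map defining Xi_Q(X)(C) lifts to a map F of the sphere into the        *)
(* universal covering, and psi_* of its class is represented by the image of  *)
(* psi^Q_B o F in B^Q X. Away from the collars F takes values in the 0-cells, *)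
(* and their labels form a region coloring: crossing the collar of a semi-arc *)
(* s along its normal multiplies the label by the color of s. (As the collars *)
(* may fill a whole region, the label is read off at the vertex of the cube   *)
(* nearest to F.) Region colorings being unique, F(z) = [t; g, C(s)] with     *)
(* g = C^R(rho_s) on the collar of s, and likewise at crossings, so           *)
(* psi^Q_B o F lies over [t; psi(g, C(s))] = [t; Psi(C)(s)], which is the map *)
(* defining Xi_X(Psi(C)). The sums agree because Psi is bijective: psi_As     *)
(* carries the region coloring of C to that of Psi(C) and has an explicit     *)
(* recursive inverse, and each psi(p, -) is bijective.                        *)

From HB Require Import structures.
From Stdlib Require Import Relation_Operators.
Require Import Defs.
From mathcomp Require Import all_boot all_order all_algebra.
From mathcomp Require Import all_classical all_reals all_analysis.
From mathcomp Require Import ring lra zify.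
From mathcomp.multinomials Require Import freeg.
Import Order.TTheory GRing.Theory Num.Theory numFieldNormedType.Exports.
Set Implicit Arguments.
Unset Strict Implicit.
Unset Printing Implicit Defensive.
Local Open Scope quotient_scope.
Local Open Scope classical_set_scope.
Local Open Scope ring_scope.

(** * The covering of the biquandle space *)

(** Both sides of the first claim are classes of explicit maps, and these maps turn out to coincide,
    so that no homotopy between them has to be built. Since psi_* is defined through the coverings,
    it is computed by lifting the map attached to C to a map F into the universal covering for Q(X),
    applying [psiB] and projecting ([psi_star_lift]). On the collar of a semi-arc s the lift is
    [t; g, C(s)] for a single label g, and [psiB] sends this point to one lying over
    [t; psi(g, C(s))]. The claim is therefore that g is the color of the specified region of s
    ([strip_color], [box_specified]), after which [psi_dual_map] is a pointwise equality of maps.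

    Three facts carry this. First, [covering] is a covering map ([covering_covering_map]): As(X)
    acts on the total space with the fibers as orbits, and a point is separated from its other
    translates by a continuous function [weight_at], obtained by averaging over a threshold the
    vertices to which the coordinates of the cube are rounded; such an average respects all three
    gluing relations. Second, covering maps have the homotopy lifting property ([homotopy_lift]).
    Contracting the plane to infinity along vertical rays turns it into existence and uniqueness of
    lifts of sphere maps, and it makes the chosen inverse in psi_* computable. Third, the labels of
    F form a region coloring ([region_gam_coloring]). The label is constant on regions, is 1 near
    infinity, and jumps by C(s) across s; the jump is read off on the strip of s where the strip
    meets s, and otherwise from the four corners of the box at the crossing where s starts. Region
    colorings are unique because the plane minus the crossings is connected for locally constant
    functions ([punctured_plane_constant]), so the labels are those of [region_coloring].

    For the sums, Psi is shown to be bijective. psi_As carries the region coloring of C to that of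
    Psi(C) and is inverted recursively by [psiAs_inv], while every psi(p, -) is a bijection
    ([psi_coloring_inj], [psi_coloring_surj]). Colorings of semi-arcs by Q(X) are the same as
    quandle colorings of arcs, because an over-strand keeps its color ([arc_color]). *)

Section Threshold.
Variables (R : realType) (X : biquandle).
Local Notation I := (unit_interval R).
Implicit Types (s : seq (I * X)) (g h : As X) (phi : As X -> R) (a b c : R).

Lemma unit_intervalP (t : I) : 0 <= set_val t <= 1.
Proof. by have /set_mem := svalP t; rewrite /= in_itv. Qed.

Definition recolor (f : X -> X) s : seq (I * X) := [seq (p.1, f p.2) | p <- s].

(* Systematic rounding: a threshold tau rounds the first coordinate t to 0    *)
(* (if t < tau) or to 1 and is carried over as tau - t, respectively          *)
(* tau - t + 1, so that two adjacent coordinates of the same color matter     *)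
(* only through their sum. [sweep] integrates phi over the label of the       *)
(* vertex reached, for tau in ]a, b]; n is the recursion fuel. This descends  *)
(* to the covering space and separates the sheets.                            *)
Fixpoint sweep phi n a b g s : R :=
  if n is n'.+1 then
    if s is (t, x) :: s' then
      sweep phi n' (Num.max a (set_val t) - set_val t)
                   (Num.max b (set_val t) - set_val t) g s' +
      sweep phi n' (Num.min a (set_val t) - set_val t + 1)
                   (Num.min b (set_val t) - set_val t + 1)
                   (g * as_gen x)%g (recolor (fun z => bov z x) s')
    else (b - a) * phi g
  else (b - a) * phi g.

Definition weight phi a b g s := sweep phi (size s) a b g s.

Lemma weight_nil phi a b g : weight phi a b g [::] = (b - a) * phi g.
Proof. by []. Qed.

Lemma weight_cons phi a b g t x s : weight phi a b g ((t, x) :: s) =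
  weight phi (Num.max a (set_val t) - set_val t)
             (Num.max b (set_val t) - set_val t) g s +
  weight phi (Num.min a (set_val t) - set_val t + 1)
             (Num.min b (set_val t) - set_val t + 1)
             (g * as_gen x)%g (recolor (fun z => bov z x) s).
Proof. by rewrite /weight /= size_map. Qed.

(** Structural induction is too weak, since the recursion passes to a recolored tail of the same
    length. *)
Lemma weight_ind (P : seq (I * X) -> Prop) : P [::] ->
  (forall t x s, (forall s', size s' = size s -> P s') -> P ((t, x) :: s)) ->
  forall s, P s.
Proof.
move=> P0 PS s; have [n] := ubnP (size s); elim: n s => // n IH [//|[t x] s] /= sn.
by apply: PS => s' es; apply: IH; rewrite es.
Qed.

Lemma weight_eq phi a g s : weight phi a a g s = 0.
Proof.
elim/weight_ind: s a g => [|t x s IH] a g; first by rewrite weight_nil subrr mul0r.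
by rewrite weight_cons !IH ?size_map // addr0.
Qed.

(** As for oriented integrals, no order of the bounds is assumed; hence a weight is a difference of
    values of a primitive in the bounds. *)
Lemma weight_chasles phi a b c g s :
  weight phi a b g s + weight phi b c g s = weight phi a c g s.
Proof.
elim/weight_ind: s a b c g => [|t x s IH] a b c g; first by rewrite !weight_nil; ring.
by rewrite !weight_cons addrACA !IH ?size_map.
Qed.

Lemma weightD phi psi a b g s :
  weight (fun h => phi h + psi h) a b g s = weight phi a b g s + weight psi a b g s.
Proof.
elim/weight_ind: s a b g => [|t x s IH] a b g; first by rewrite !weight_nil; ring.
by rewrite !weight_cons !IH ?size_map // addrACA.
Qed.

Lemma weight1 a b g s : weight (fun=> 1) a b g s = b - a.
Proof.
elim/weight_ind: s a b g => [|t x s IH] a b g; first by rewrite weight_nil mulr1.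
rewrite weight_cons !IH ?size_map //.
have := addr_max_min a (set_val t); have := addr_max_min b (set_val t); lra.
Qed.

Lemma weight_le phi psi a b g s : a <= b -> (forall h, phi h <= psi h) ->
  weight phi a b g s <= weight psi a b g s.
Proof.
move=> + hp; elim/weight_ind: s a b g => [|t x s IH] a b g ab.
  by rewrite !weight_nil ler_wpM2l // subr_ge0.
rewrite !weight_cons lerD //; apply: IH; rewrite ?size_map //.
  by rewrite lerD2r; case: (leP a (set_val t)); case: (leP b (set_val t)); lra.
by rewrite !lerD2r; case: (leP a (set_val t)); case: (leP b (set_val t)); lra.
Qed.

Lemma weightM phi a b g h s :
  weight phi a b (h * g)%g s = weight (fun k => phi (h * k)%g) a b g s.
Proof.
elim/weight_ind: s a b g => [//|t x s IH] a b g.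
by rewrite !weight_cons -!mulgA !IH ?size_map.
Qed.


Lemma weight_step a (t : I) : 0 <= a <= 1 ->
  (0 <= Num.max a (set_val t) - set_val t <= 1) /\
  (0 <= Num.min a (set_val t) - set_val t + 1 <= 1).
Proof.
have := unit_intervalP t; set u := set_val t => u01 a01.
by case: (leP a u) => h; split; lra.
Qed.

Lemma recolor_comp f f' s : recolor f (recolor f' s) = recolor (f \o f') s.
Proof. by rewrite /recolor -map_comp. Qed.

Lemma recolor_cat f s s' : recolor f (s ++ s') = recolor f s ++ recolor f s'.
Proof. exact: map_cat. Qed.

(** A coordinate 0 lies below every threshold in ]0, 1], so it is always rounded down and leaves the
    threshold unchanged. [weight_step] keeps the carried thresholds in [0, 1] for the coordinates
    before it. *)
Lemma weight_face0 phi a b g s1 (t : I) x s2 : 0 <= a <= 1 -> 0 <= b <= 1 ->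
  set_val t = 0 ->
  weight phi a b g (s1 ++ (t, x) :: s2) = weight phi a b g (s1 ++ s2).
Proof.
move=> + + t0; elim/weight_ind: s1 a b g x s2 => [|u y s1 IH] a b g x s2 a01 b01.
  rewrite /= weight_cons t0 !subr0.
  have -> : Num.min a 0 = 0 by apply/min_idPr; lra.
  have -> : Num.min b 0 = 0 by apply/min_idPr; lra.
  have -> : Num.max a 0 = a by apply/max_idPl; lra.
  have -> : Num.max b 0 = b by apply/max_idPl; lra.
  by rewrite !add0r weight_eq addr0.
have [a1 a2] := weight_step u a01; have [b1 b2] := weight_step u b01.
rewrite !cat_cons !weight_cons IH // !recolor_cat /= IH //.
by rewrite size_map.
Qed.

(** A coordinate 1 is rounded up at every threshold and leaves it unchanged. If an earlier letter y
    is rounded up as well, the relator of As(X) lets y and x change places, and (BQ3) makes the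
    recolorings of the remaining letters agree. *)
Lemma weight_face1 phi a b g s1 (t : I) x s2 : 0 <= a <= 1 -> 0 <= b <= 1 ->
  set_val t = 1 ->
  weight phi a b g (s1 ++ (t, x) :: s2) =
  weight phi a b (g * as_gen x)%g
    (recolor (fun z => bun z x) s1 ++ recolor (fun z => bov z x) s2).
Proof.
move=> + + t1; elim/weight_ind: s1 a b g x s2 => [|u y s1 IH] a b g x s2 a01 b01.
  rewrite /= weight_cons t1.
  have -> : Num.min a 1 = a by apply/min_idPl; lra.
  have -> : Num.min b 1 = b by apply/min_idPl; lra.
  have -> : Num.max a 1 = 1 by apply/max_idPr; lra.
  have -> : Num.max b 1 = 1 by apply/max_idPr; lra.
  by rewrite weight_eq add0r !subrK.
have [a1 a2] := weight_step u a01; have [b1 b2] := weight_step u b01.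
rewrite /= !weight_cons IH //; congr (_ + _).
rewrite recolor_cat [recolor _ (_ :: _)]/= IH ?size_map //.
rewrite -!mulgA as_relator; congr weight.
rewrite recolor_cat !recolor_comp.
by congr (_ ++ _); apply: eq_map => -[v z] /=; rewrite ?bq3 ?bq3ov.
Qed.

Lemma clamp_over c u v : 0 <= u -> 0 <= v ->
  Num.max (Num.max c u - u) v - v = Num.max (c - (u + v)) 0.
Proof.
move=> u0 v0; have [cu|cu] := leP c u.
  rewrite subrr; have -> : Num.max 0 v = v by apply/max_idPr.
  by rewrite subrr; symmetry; apply/max_idPr; lra.
by have [h|h] := leP (c - u) v; symmetry; rewrite ?subrr;
   [apply/max_idPr|rewrite opprD addrA; apply/max_idPl]; lra.
Qed.

Lemma clamp_below c u v : 0 <= c <= 1 -> 0 <= u <= 1 -> 0 <= v <= 1 ->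
  Num.min (Num.min c u - u + 1) v - v + 1 = Num.min (c - (u + v) + 2) 1.
Proof.
move=> c01 u01 v01; have [cu|cu] := leP c u; last first.
  rewrite subrr add0r; have -> : Num.min 1 v = v by apply/min_idPr; lra.
  by rewrite subrr add0r; symmetry; apply/min_idPr; lra.
have [h|h] := leP (c - u + 1) v.
  by transitivity (c - (u + v) + 2); [ring|symmetry; apply/min_idPl; lra].
by rewrite subrr add0r; symmetry; apply/min_idPr; lra.
Qed.

(* The two terms come from rounding up exactly one of u, v. Their sum depends *)
(* only on u + v, up to [F (1 - v)], which does not depend on c and cancels   *)
(* in differences.                                                            *)
Lemma clamp_split (F : R -> R) c u v : 0 <= c <= 1 -> 0 <= u <= 1 -> 0 <= v <= 1 ->
  F (Num.min (Num.max c u - u) v - v + 1) + F (Num.max (Num.min c u - u + 1) v - v) =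
  F (1 - v) + F (Num.max 0 (Num.min 1 (c - (u + v) + 1))).
Proof.
move=> c01 u01 v01; have [cu|cu] := leP c u.
- have -> : Num.min (u - u) v = 0 by rewrite subrr; apply/min_idPl; lra.
  have -> : Num.min 1 (c - (u + v) + 1) = c - (u + v) + 1 by apply/min_idPr; lra.
  have [h|h] := leP (c - u + 1) v.
    have -> : Num.max 0 (c - (u + v) + 1) = 0 by apply/max_idPl; lra.
    by congr (F _ + F _); ring.
  have -> : Num.max 0 (c - (u + v) + 1) = c - (u + v) + 1 by apply/max_idPr; lra.
  by congr (F _ + F _); ring.
- have -> : Num.max (u - u + 1) v = 1 by rewrite subrr add0r; apply/max_idPl; lra.
  rewrite addrC; congr (F _ + F _).
  have -> : Num.max 0 (Num.min 1 (c - (u + v) + 1)) = Num.min 1 (c - (u + v) + 1).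
    by apply/max_idPr; rewrite le_min; apply/andP; split; lra.
  have [h|h] := leP (c - u) v.
    have -> : Num.min 1 (c - (u + v) + 1) = c - (u + v) + 1 by apply/min_idPr; lra.
    ring.
  have -> : Num.min 1 (c - (u + v) + 1) = 1 by apply/min_idPl; lra.
  ring.
Qed.

(** Of the four ways to round the two coordinates, both down and both up yield thresholds depending
    only on the sum. The two mixed ways reach the same label with the same recolored tail, so their
    contributions may be added and compared by [clamp_split]. *)
Lemma weight_degenerate phi a b g s1 (t1 t2 u1 u2 : I) x s2 :
  0 <= a <= 1 -> 0 <= b <= 1 ->
  set_val t1 + set_val t2 = set_val u1 + set_val u2 ->
  weight phi a b g (s1 ++ (t1, x) :: (t2, x) :: s2) =
  weight phi a b g (s1 ++ (u1, x) :: (u2, x) :: s2).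
Proof.
move=> + + tu; elim/weight_ind: s1 a b g x s2 => [|u y s1 IH] a b g x s2 a01 b01;
    last first.
  have [a1 a2] := weight_step u a01; have [b1 b2] := weight_step u b01.
  rewrite !cat_cons !weight_cons IH // !recolor_cat /= IH //.
  by rewrite size_map.
have t01 := unit_intervalP t1; have t02 := unit_intervalP t2.
have u01 := unit_intervalP u1; have u02 := unit_intervalP u2.
rewrite /= !weight_cons.
move: (set_val t1) (set_val t2) (set_val u1) (set_val u2) tu t01 t02 u01 u02.
move=> p1 p2 q1 q2 pq p01 p02 q01 q02.
have [[p10 _] [p20 _]] := (andP p01, andP p02).
have [[q10 _] [q20 _]] := (andP q01, andP q02).
rewrite !clamp_over // !clamp_below // -!pq.
set s' := recolor _ s2; set k := (g * as_gen x)%g.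
(* A primitive of the mixed terms; [clamp_split] is then applied to it at both bounds and for both
   pairs of coordinates. *)
have [F FE] : exists F, forall c d, weight phi c d k s' = F d - F c.
  exists (fun c => weight phi 0 c k s') => c d.
  by rewrite -(weight_chasles _ 0 c d) addrAC subrr add0r.
rewrite !FE.
have := clamp_split F a01 p01 p02; have := clamp_split F b01 p01 p02.
have := clamp_split F a01 q01 q02; have := clamp_split F b01 q01 q02.
rewrite -!pq => h1 h2 h3 h4.
rewrite -!addrA; congr (_ + _); rewrite !addrA; congr (_ + _).
move: h1 h2 h3 h4; clear.
do 12!move: (F _); move=> *; lra.
Qed.

End Threshold.

(** * Points of the cubical spaces and continuity of the weights *)

Section CubePoints.
Variables (R : realType) (X : biquandle) (A : choiceType) (act : A -> X -> A).

Lemma cube_pt_reading (c : precube R X A) :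
  gen_class (precube_rel act) c = cube_pt act (reading c).1 (reading c).2.
Proof. by rewrite /cube_pt precube_ofK. Qed.

Lemma cube_pt_repr (c : cubical R act) : exists a s, c = cube_pt act a s.
Proof.
exists (reading (repr c)).1, (reading (repr c)).2.
by rewrite -cube_pt_reading gen_quotP.
Qed.

End CubePoints.

Section WeightTopology.
Variables (R : realType) (X : biquandle).
Local Notation I := (unit_interval R).
Local Notation E := (EQ R X).
Local Notation ept := (cube_pt (fun (g : As X) x => g * as_gen x)%g).
Implicit Types (g h : As X) (phi : As X -> R) (a b : R) (e : E).

Lemma cvg_maxr (T : Type) (F : set_system T) {FF : Filter F} (f g : T -> R) a b :
  f w @[w --> F] --> a -> g w @[w --> F] --> b ->
  Num.max (f w) (g w) @[w --> F] --> Num.max a b.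
Proof.
move=> fa gb.
exact: (@continuous2_cvg _ _ _ _ _ _ f g _ _ _ (@max_continuous _ R (a, b)) fa gb).
Qed.

Lemma cvg_minr (T : Type) (F : set_system T) {FF : Filter F} (f g : T -> R) a b :
  f w @[w --> F] --> a -> g w @[w --> F] --> b ->
  Num.min (f w) (g w) @[w --> F] --> Num.min a b.
Proof.
move=> fa gb.
exact: (@continuous2_cvg _ _ _ _ _ _ f g _ _ _ (@min_continuous _ R (a, b)) fa gb).
Qed.

Lemma weight_cvg (T : Type) (F : set_system T) {FF : Filter F} phi (z : T)
    (s : seq ((T -> I) * X)) (a b : T -> R) g :
  (forall p, List.In p s -> p.1 w @[w --> F] --> p.1 z) ->
  a w @[w --> F] --> a z -> b w @[w --> F] --> b z ->
  weight phi (a w) (b w) g [seq (p.1 w, p.2) | p <- s] @[w --> F] -->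
  weight phi (a z) (b z) g [seq (p.1 z, p.2) | p <- s].
Proof.
have [n] := ubnP (size s); elim: n s a b g => // n IH [|[t x] s] a b g sn hs ha hb.
  under eq_fun do rewrite /= weight_nil.
  by rewrite weight_nil; apply: cvgMl; apply: cvgB.
under eq_fun do rewrite /= weight_cons.
have ht : set_val (t w) @[w --> F] --> set_val (t z).
  apply: (cvg_comp t set_val (hs _ (or_introl erefl))).
  exact: initial_continuous.
have hs' p : List.In p s -> p.1 w @[w --> F] --> p.1 z by move=> ps; apply: hs; right.
rewrite /= weight_cons; apply: cvgD.
  by apply: IH => //; apply: cvgB => //; apply: cvg_maxr.
have rE w : recolor (fun u => bov u x) [seq (p.1 w, p.2) | p <- s] =
    [seq (p.1 w, p.2) | p <- [seq (p.1, bov p.2 x) | p <- s]].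
  by rewrite /recolor -!map_comp.
under eq_fun do rewrite rE.
rewrite rE; apply: (IH _ (fun w => _) (fun w => _)) => [|p||].
- by rewrite size_map.
- by move=> /List.in_map_iff[q [<- /= qs]]; exact: hs'.
- by apply: cvgD; [apply: cvgB => //; apply: cvg_minr|exact: cvg_cst].
- by apply: cvgD; [apply: cvgB => //; apply: cvg_minr|exact: cvg_cst].
Qed.

Definition weight_of phi a b (c : precube R X (As X)) : R :=
  weight phi a b (reading c).1 (reading c).2.

Lemma weight_of_continuous phi a b : continuous (weight_of phi a b).
Proof.
move=> [n [t [g x]]] U nU.
pose s : seq (('rV[I]_n -> I) * X) :=
  [seq (fun u : 'rV[I]_n => u ord0 i, tnth x i) | i <- enum 'I_n].
have sE u : (reading (existT _ n (u, (g, x)) : precube R X (As X))).2 =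
    [seq (p.1 u, p.2) | p <- s].
  by rewrite /s -[RHS]map_comp; exact: eq_map.
have hc : weight phi a b g [seq (p.1 u, p.2) | p <- s] @[u --> nbhs t] -->
    weight phi a b g [seq (p.1 t, p.2) | p <- s].
  apply: (weight_cvg (a := fun=> a) (b := fun=> b)); try exact: cvg_cst.
  move=> p /List.in_map_iff[i [<- _]] /=.
  move=> V nV; exists (fun _ j => [set v | j = i -> V v]).
    move=> k j /=; have [ji|ji] := pselect (j = i).
      by rewrite ji (ord1 k); apply: filterS nV => v Vv .
    by apply: filterE => v /ji.
  by move=> u hu; exact: (hu ord0 i).
rewrite /nbhs /= /sigT_nbhs /=.
exists ([set u | U (weight phi a b g [seq (p.1 u, p.2) | p <- s])], [set (g, x)]).
  split; last exact: discrete_set1.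
  by apply: hc; rewrite -sE.
by move=> -[u ax] /= [hu ->]; rewrite /weight_of /= /s -map_comp in hu *.
Qed.

Definition weight_at phi a b e : R := weight_of phi a b (repr e).

Lemma weight_of_rel phi a b : 0 <= a <= 1 -> 0 <= b <= 1 ->
  forall c c', precube_rel (fun (g : As X) x => g * as_gen x)%g c c' ->
  weight_of phi a b c = weight_of phi a b c'.
Proof.
move=> a01 b01 c c'; rewrite /precube_rel /weight_of.
case: (reading c) (reading c') => g s [g' s'] /=.
move E1 : (g, s) => r; move E2 : (g', s') => r' h.
case: h E1 E2 => {r r'} [k s1 t x s2 t0|k s1 t x s2 t1|k s1 t1 t2 u1 u2 x s2 tu];
  move=> [-> ->] [-> ->].
- exact: weight_face0.
- exact: weight_face1.
- exact: weight_degenerate.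
Qed.

Lemma weight_at_pt phi a b g s : 0 <= a <= 1 -> 0 <= b <= 1 ->
  weight_at phi a b (ept g s) = weight phi a b g s.
Proof.
move=> a01 b01; rewrite /weight_at /cube_pt.
rewrite (gen_class_lift (weight_of_rel phi a01 b01)).
by rewrite /weight_of reading_of.
Qed.

Lemma weight_at_continuous phi a b : 0 <= a <= 1 -> 0 <= b <= 1 ->
  continuous (weight_at phi a b).
Proof.
move=> a01 b01; apply: repr_comp_continuous; first exact: weight_of_continuous.
move=> c c' /eqP cc'; apply/eqP.
rewrite -(gen_class_lift (weight_of_rel phi a01 b01) c).
rewrite -(gen_class_lift (weight_of_rel phi a01 b01) c').
by congr weight_of; congr repr.
Qed.

Lemma ept_repr e : exists g s, e = ept g s.
Proof. exact: cube_pt_repr. Qed.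

(** The vertex reached is piecewise constant in the threshold, so some smaller window reaches a
    single vertex k. If t < b, keep the thresholds above t, which round down; otherwise all
    thresholds of the window round up. *)
Lemma weight_concentrated a b g s : 0 <= a -> a < b -> b <= 1 ->
  exists a' b' k, [/\ 0 <= a', a' < b', b' <= 1 &
    weight (fun h => (h == k)%:R) a' b' g s = b' - a' :> R] /\ (a <= a' /\ b' <= b).
Proof.
have [n] := ubnP (size s); elim: n s a b g => // n IH [|[t x] s] a b g sn a0 ab b1.
  by exists a, b, g; rewrite weight_nil eqxx mulr1.
have := unit_intervalP t; have [tb|bt] := ltP (set_val t) b => t01.
- have m0 : 0 <= Num.max a (set_val t) - set_val t by rewrite subr_ge0 le_max lexx orbT.
  have mb : Num.max a (set_val t) - set_val t < b - set_val t.
    by rewrite ltrD2r gt_max ab.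
  have i1 : b - set_val t <= 1 by lra.
  have [a' [b' [k [[a'0 ab' b'1 hw] [aa' bb']]]]] := IH s _ _ g sn m0 mb i1.
  exists (a' + set_val t), (b' + set_val t), k; split; last first.
    move: aa'; rewrite lerBlDr ge_max => /andP[aa' _].
    by split=> //; lra.
  split; try by lra.
  rewrite weight_cons.
  have -> : Num.max (a' + set_val t) (set_val t) = a' + set_val t by apply/max_idPl; lra.
  have -> : Num.max (b' + set_val t) (set_val t) = b' + set_val t by apply/max_idPl; lra.
  have -> : Num.min (a' + set_val t) (set_val t) = set_val t by apply/min_idPr; lra.
  have -> : Num.min (b' + set_val t) (set_val t) = set_val t by apply/min_idPr; lra.
  rewrite weight_eq !addrK hw; lra.
- have sn' : (size (recolor (fun z => bov z x) s) < n)%N by rewrite size_map.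
  have i0 : 0 <= a - set_val t + 1 by lra.
  have ib : a - set_val t + 1 < b - set_val t + 1 by lra.
  have i1 : b - set_val t + 1 <= 1 by lra.
  have [a' [b' [k [[a'0 ab' b'1 hw] [aa' bb']]]]] :=
    IH _ _ _ (g * as_gen x)%g sn' i0 ib i1.
  exists (a' + set_val t - 1), (b' + set_val t - 1), k; split; last by split; lra.
  split; try by lra.
  rewrite weight_cons.
  have -> : Num.min (a' + set_val t - 1) (set_val t) = a' + set_val t - 1 by apply/min_idPl; lra.
  have -> : Num.min (b' + set_val t - 1) (set_val t) = b' + set_val t - 1 by apply/min_idPl; lra.
  have -> : Num.max (a' + set_val t - 1) (set_val t) = set_val t by apply/max_idPr; lra.
  have -> : Num.max (b' + set_val t - 1) (set_val t) = set_val t by apply/max_idPr; lra.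
  rewrite weight_eq add0r.
  have -> : a' + set_val t - 1 - set_val t + 1 = a' by ring.
  have -> : b' + set_val t - 1 - set_val t + 1 = b' by ring.
  rewrite hw; lra.
Qed.

End WeightTopology.

(** * The covering map and its deck translations *)

Section EvenlyCovered.
Variables (E B : topologicalType) (p : E -> B).

(* T is the set of sheets over V, [q e] the sheet of e and [sec t] the        *)
(* section of the sheet t; all are total functions, constrained only over V.  *)
Definition evenly_covered (V : set B) : Prop :=
  exists (T : Type) (q : E -> T) (sec : T -> B -> E),
    (forall e, V (p e) -> sec (q e) (p e) = e /\ \forall e' \near e, q e' = q e) /\
    (forall t v, V v -> p (sec t v) = v /\ sec t w @[w --> v] --> sec t v).

Definition covering_map : Prop := continuous p /\
  forall b : B, exists2 V, nbhs b V & evenly_covered V.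

End EvenlyCovered.

Section Covering.
Variables (R : realType) (X : biquandle).
Local Notation I := (unit_interval R).
Local Notation E := (EQ R X).
Local Notation ept := (cube_pt (fun (g : As X) x => g * as_gen x)%g).
Implicit Types (g h k : As X) (a b : R) (e : E) (s : seq (I * X)).

Definition translate h : E -> E :=
  cube_map (fun (g : As X) x => g * as_gen x)%g (fun g => h * g)%g (fun _ => id).

Lemma translate_pt h g s : translate h (ept g s) = ept (h * g)%g s.
Proof.
rewrite /translate cube_map_pt //; last by move=> *; rewrite mulgA.
by congr cube_pt; rewrite -[RHS]map_id; apply: eq_map => -[].
Qed.

Lemma translate_continuous h : continuous (translate h).
Proof. by apply: cube_map_continuous => // *; rewrite mulgA. Qed.

Lemma translate1 e : translate 1%g e = e.
Proof. by have [g [s ->]] := ept_repr e; rewrite translate_pt mul1g. Qed.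

Lemma translateM h k e : translate h (translate k e) = translate (h * k)%g e.
Proof. by have [g [s ->]] := ept_repr e; rewrite !translate_pt mulgA. Qed.

Lemma covering_pt g s : covering (ept g s) = bpt s.
Proof.
rewrite /covering cube_map_pt //.
by congr cube_pt; rewrite -[RHS]map_id; apply: eq_map => -[].
Qed.

Lemma covering_translate h e : covering (translate h e) = covering e.
Proof. by have [g [s ->]] := ept_repr e; rewrite translate_pt !covering_pt. Qed.

Lemma weight_at_translate phi a b h e : 0 <= a <= 1 -> 0 <= b <= 1 ->
  weight_at phi a b (translate h e) = weight_at (fun k => phi (h * k)%g) a b e.
Proof.
move=> a01 b01; have [g [s ->]] := ept_repr e.
by rewrite translate_pt !weight_at_pt // weightM.
Qed.

(** Each gluing relation of B^Q X lifts once the label is adjusted. Both directions are proved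
    together, to pass through the symmetric steps of the generated equivalence. *)
Lemma covering_orbit_pt s s' : bpt s = bpt s' ->
  forall g, exists g', ept g s = ept g' s'.
Proof.
move=> /gen_classP h.
suff aux (c c' : precube R X unit) : clos_refl_sym_trans _ (precube_rel (fun _ _ => tt)) c c' ->
    (forall g, exists g', ept g (reading c).2 = ept g' (reading c').2) /\
    (forall g, exists g', ept g (reading c').2 = ept g' (reading c).2).
  by have [+ _] := aux _ _ h; rewrite !reading_of.
elim=> {c c' h s s'} [c c'|c|c c' _ [h1 h2]|c1 c2 c3 _ [h1 h1'] _ [h2 h2']].
- rewrite /precube_rel; case: (reading c) (reading c') => a s [a' s'] /=.
  move E1 : (a, s) => r; move E2 : (a', s') => r' h.
  case: h E1 E2 => {r r'} [k s1 t x s2 t0|k s1 t x s2 t1|k s1 t1 t2 u1 u2 x s2 tu];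
    move=> [_ ->] [_ ->]; split=> g.
  + by exists g; apply: cube_pt_rel; exact: CubeFace0.
  + by exists g; symmetry; apply: cube_pt_rel; exact: CubeFace0.
  + by exists (g * as_gen x)%g; apply: cube_pt_rel; exact: CubeFace1.
  + exists (g * (as_gen x)^-1)%g; rewrite -{1}(mulgVK (as_gen x) g).
    by symmetry; apply: cube_pt_rel; exact: CubeFace1.
  + by exists g; apply: cube_pt_rel; exact: CubeDegenerate.
  + by exists g; symmetry; apply: cube_pt_rel; exact: CubeDegenerate.
- by split=> g; exists g.
- by [].
- split=> g.
    by have [g1 ->] := h1 g; exact: h2.
  by have [g1 ->] := h2' g; exact: h1'.
Qed.

Lemma covering_fiber e s : covering e = bpt s -> exists g, e = ept g s.
Proof.
by have [g [s' ->]] := ept_repr e; rewrite covering_pt => /covering_orbit_pt.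
Qed.

Lemma covering_orbit e e' : covering e = covering e' -> exists h, e' = translate h e.
Proof.
have [g [s ->]] := ept_repr e; rewrite covering_pt => /esym/covering_fiber[g' ->].
by exists (g' * g^-1)%g; rewrite translate_pt mulgVK.
Qed.

Lemma covering_surj (y : BQ R X) : exists e, covering e = y.
Proof.
have [[] [s ->]] := cube_pt_repr y.
by exists (ept 1%g s); rewrite covering_pt.
Qed.

(** Before gluing, putting a fixed label g on every cube is continuous, and the preimage of the
    image of U is the union over g of the preimages of U under these maps. *)
Lemma covering_open (U : set E) : open U -> open (covering @` U).
Proof.
move=> oU; rewrite /open /= /quotient_open.
pose lift g (c : precube R X unit) : precube R X (As X) :=
  let: existT n (t, (_, x)) := c in existT _ n (t, (g, x)).
have liftE g c : gen_class (precube_rel (fun (g : As X) x => g * as_gen x)%g)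
    (lift g c) = ept g (reading c).2.
  by rewrite cube_pt_reading; case: c => n [t [[] x]].
have lift_cont g : continuous (lift g).
  move=> [n [t [[] x]]] W.
  rewrite /nbhs /= /sigT_nbhs /= => -[[V V'] /= [Vt Wx] VW].
  exists (V, [set (tt, x)]); first by split => //; exact: discrete_set1.
  move=> -[t' ax'] /= [Vt' ->] /=; apply: (VW (_, _)); split => //=.
  exact: nbhs_singleton Wx.
have -> : \pi_(cubical R (fun (_ : unit) (_ : X) => tt)) @^-1` (covering @` U) =
    \bigcup_g [set c | U (ept g (reading c).2)].
  have piE c : \pi_(cubical R (fun (_ : unit) (_ : X) => tt)) c = bpt (reading c).2.
    by rewrite [LHS]cube_pt_reading; case: (reading c).1.
  apply/seteqP; split=> c /=.
    rewrite piE => -[e Ue /covering_fiber[g eE]]; exists g => //=.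
    by rewrite -eE.
  by move=> [g _ /= Ug]; exists (ept g (reading c).2) => //; rewrite covering_pt piE.
apply: bigcup_open => g _.
have -> : [set c | U (ept g (reading c).2)] =
    (lift g) @^-1` (\pi_(cubical R (fun (g : As X) x => g * as_gen x)%g) @^-1` U).
  by apply/seteqP; split=> c /=; rewrite -liftE.
apply: open_comp => [c _|]; [exact: lift_cont|exact: oU].
Qed.

(* The weights of the labels in a window ]a, b] add up to b - a, so that of k *)
(* exceeds (b - a) / 2 on at most one translate of each point.                *)
Lemma covering_separated e : exists U : set E, [/\ open U, U e &
  forall h e', U e' -> U (translate h e') -> h = 1%g].
Proof.
have [g [s ->]] := ept_repr e.
have [a [b [k [[a0 ab b1 hw] _]]]] := weight_concentrated g s (lexx (0 : R)) ltr01 (lexx 1).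
have a01 : 0 <= a <= 1 by lra.
have b01 : 0 <= b <= 1 by lra.
pose d k' : As X -> R := fun h => (h == k')%:R.
exists [set e' | (b - a) / 2 < weight_at (d k) a b e']; split.
- apply: (@open_comp _ _ (weight_at (d k) a b) [set x | (b - a) / 2 < x]).
    by move=> x _; exact: weight_at_continuous.
  exact: open_gt.
- by rewrite /= weight_at_pt // hw; lra.
- move=> h e' /= Ue' Uhe'; apply: contrapT => h1.
  have [g' [s' eE]] := ept_repr e'.
  move: Ue' Uhe'; rewrite weight_at_translate // eE !weight_at_pt // => w1 w2.
  have : weight (d k) a b g' s' + weight (fun k' => d k (h * k')%g) a b g' s' <= b - a.
    rewrite -(weight1 a b g' s') -weightD; apply: weight_le; first exact: ltW.
    move=> k'; rewrite /d; have [kk|] := eqVneq k' k; last first.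
      by move=> _; rewrite add0r; case: (_ == _); rewrite ?lexx ?ler01.
    rewrite kk; have [hk|] := eqVneq (h * k)%g k; last by rewrite addr0.
    by case: h1; rewrite -(mulgK k h) hk mulgV.
  lra.
Qed.

(** With U from [covering_separated], the sheets over the image of U are the translates h U. The
    sheet of e is the only h with h^-1 e in U, and the sections are continuous because [covering] is
    open. *)
Lemma covering_covering_map : covering_map (@covering R X).
Proof.
split; first exact: covering_continuous.
move=> y; have [e0 e0y] := covering_surj y.
have [U [oU Ue0 Usep]] := covering_separated e0.
have oV := covering_open oU.
exists (covering @` U); first by apply: open_nbhs_nbhs; split=> //; exists e0.
exists (As X), (fun e => xget 1%g [set h | U (translate h^-1%g e)]),
  (fun h v => translate h (xget e0 [set u | U u /\ covering u = v])).
have qE h e : U (translate h^-1%g e) -> xget 1%g [set h | U (translate h^-1%g e)] = h.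
  move=> Uh; case: xgetP => [k _ /= Uk|/(_ h) //].
  have : (h^-1 * k)%g = 1%g.
    by apply: (Usep _ _ Uk); rewrite translateM mulgK.
  by move=> /(congr1 (fun z => h * z)%g); rewrite mulVKg mulg1.
have uE u : U u -> xget e0 [set u' | U u' /\ covering u' = covering u] = u.
  move=> Uu; case: xgetP => [u' _ /= [Uu' cu]|/(_ u) /=]; last by case.
  have [h hu] := covering_orbit cu; have h1 : h = 1%g by apply: (Usep _ _ Uu'); rewrite -hu.
  by rewrite hu h1 translate1.
split=> [e [u Uu ue]|h v [u Uu <-]].
  have [h eE] := covering_orbit ue.
  have Uh : U (translate h^-1%g e) by rewrite eE translateM mulVg translate1.
  rewrite (qE h) //; split; first by rewrite -ue uE // eE.
  have : nbhs e (translate h^-1%g @^-1` U).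
    by apply: translate_continuous; apply: open_nbhs_nbhs.
  by apply: filterS => e' Ue'; exact: qE.
rewrite uE // covering_translate; split=> // W nW.
have nu : nbhs u (translate h @^-1` W) by exact: translate_continuous.
have [Q [oQ Qu QW]] : exists Q, [/\ open Q, Q u & Q `<=` (translate h @^-1` W) `&` U].
  have : nbhs u ((translate h @^-1` W) `&` U).
    by apply: filterI => //; apply: open_nbhs_nbhs.
  by rewrite nbhsE => -[Q [oQ Qu] QW]; exists Q.
have : nbhs (covering u) (covering @` Q).
  by apply: open_nbhs_nbhs; split; [exact: covering_open|exists u].
apply: filterS => v' [u' Qu' <-] /=.
by have [Wu' Uu'] := QW _ Qu'; rewrite uE.
Qed.

End Covering.

(** * Lifting of homotopies *)

(** With [T := Prop] this propagates a property whose truth value is locally constant, which is its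
    most frequent use below. *)
Lemma connected_locally_constant (K : topologicalType) (T : Type) (A : set K)
    (f : K -> T) : connected A ->
  (forall x, A x -> \forall w \near x, A w -> f w = f x) ->
  forall x y, A x -> A y -> f x = f y.
Proof.
move=> cA hf x y Ax Ay; symmetry.
suff E : [set w | A w /\ f w = f x] = A.
  have : [set w | A w /\ f w = f x] y by rewrite E.
  by case.
apply: cA; first by exists x.
- exists (interior [set w | A w -> f w = f x]); first exact: open_interior.
  apply/seteqP; split=> w /= [Aw fw]; split=> //.
    by apply: filterS (hf w Aw) => v hv Av; rewrite hv.
  by apply: (nbhs_singleton fw).
- exists (~` (interior [set w | A w -> f w <> f x])).
    by apply: open_closedC; exact: open_interior.
  apply/seteqP; split=> w /= [Aw fw]; split=> //.
    by move=> h; exact: (nbhs_singleton h).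
  apply: contrapT => nfw; apply: fw.
  by apply: filterS (hf w Aw) => v hv Av; rewrite hv.
Qed.

Section Lifting.
Variables (R : realType) (E B : topologicalType) (p : E -> B).
Hypothesis pcov : covering_map p.

(** Along the filter both functions end up in the sheets of their limits, and two points of one
    fiber are equal exactly when their sheets are. An arbitrary filter is allowed so that the lemma
    applies within strips, boxes and complements. *)
Lemma lift_near (T : Type) (F : set_system T) {FF : Filter F} (f1 f2 : T -> E) (e1 e2 : E) :
  f1 w @[w --> F] --> e1 -> f2 w @[w --> F] --> e2 -> p e1 = p e2 ->
  (\forall w \near F, p (f1 w) = p (f2 w)) ->
  \forall w \near F, (f1 w = f2 w) = (e1 = e2).
Proof.
move=> h1 h2 e12 pf; have [V nV [J [q [sec [qP _]]]]] := pcov.2 (p e1).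
have Ve := nbhs_singleton nV.
have pc := pcov.1.
have [s1 n1] := qP e1 Ve.
have q1 : \forall w \near F, q (f1 w) = q e1 by exact: (h1 _ n1).
have Ve2 : V (p e2) by rewrite -e12.
have [s2 n2] := qP e2 Ve2.
have q2 : \forall w \near F, q (f2 w) = q e2 by exact: (h2 _ n2).
have v1 : \forall w \near F, V (p (f1 w)) by apply: (h1 (p @^-1` V)); exact: pc.
near=> w.
have pw : p (f1 w) = p (f2 w) by near: w.
have vw : V (p (f1 w)) by near: w.
have vw2 : V (p (f2 w)) by rewrite -pw.
have qw1 : q (f1 w) = q e1 by near: w.
have qw2 : q (f2 w) = q e2 by near: w.
apply/propext; split=> h.
  by rewrite -s1 -s2 -qw1 -qw2 h e12.
by rewrite -(qP _ vw).1 -(qP _ vw2).1 qw1 qw2 h pw.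
Unshelve. all: by end_near. Qed.

Lemma lift_unique (K : topologicalType) (A : set K) (f1 f2 : K -> E) x0 :
  connected A -> {within A, continuous f1} -> {within A, continuous f2} ->
  (forall x, A x -> p (f1 x) = p (f2 x)) -> A x0 -> f1 x0 = f2 x0 ->
  forall x, A x -> f1 x = f2 x.
Proof.
move=> cA c1 c2 pf Ax0 e0 x Ax.
suff -> : (f1 x = f2 x) = (f1 x0 = f2 x0) by [].
move: x x0 Ax Ax0 {e0}.
apply: (@connected_locally_constant K Prop A (fun x => f1 x = f2 x)) => // x Ax.
have c1x := (@subspace_continuousP _ _ _ _).1 c1 x Ax.
have c2x := (@subspace_continuousP _ _ _ _).1 c2 x Ax.
have := @lift_near _ _ _ _ _ _ _ c1x c2x (pf x Ax).
rewrite !near_withinE; apply.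
by near=> w; apply: pf.
Unshelve. all: by end_near. Qed.

Lemma path_lift_unique (f1 f2 : R -> E) t0 : continuous f1 -> continuous f2 ->
  (forall t, p (f1 t) = p (f2 t)) -> f1 t0 = f2 t0 -> forall t, f1 t = f2 t.
Proof.
move=> c1 c2 pf e0 t; apply: (@lift_unique _ setT f1 f2 t0) => //.
- by apply/connected_intervalP => x y _ _ z _.
- exact: continuous_subspaceT.
- exact: continuous_subspaceT.
Qed.

Section Homotopy.
Variables (Z : topologicalType) (H : Z * R -> B) (g0 : Z -> E).
Hypotheses (H_cont : continuous H) (g0_cont : continuous g0).
Hypothesis (H0 : forall z, p (g0 z) = H (z, 0)).

(** A lift near z up to time t. It is defined for all real times and lies over H at the time clamped
    to [0, t], which avoids subspaces of the time axis. *)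
Let lifts_upto (z : Z) (t : R) := exists (N : set Z) (G : Z * R -> E),
  [/\ nbhs z N, open N,
      forall z' t', N z' -> G u @[u --> (z', t')] --> G (z', t'),
      forall z' t', N z' -> p (G (z', t')) = H (z', Num.max 0 (Num.min t' t)) &
      forall z', N z' -> G (z', 0) = g0 z'].

Lemma cvg_glue (T : Type) (F : set_system T) {FF : Filter F} (P : T -> bool)
    (f1 f2 : T -> E) (e : E) :
  f1 w @[w --> F] --> e -> f2 w @[w --> F] --> e ->
  (if P w then f1 w else f2 w) @[w --> F] --> e.
Proof.
move=> h1 h2 U nU; have u1 : \forall w \near F, U (f1 w) by exact: h1.
have u2 : \forall w \near F, U (f2 w) by exact: h2.
suff : \forall w \near F, U (if P w then f1 w else f2 w) by [].
by near=> w; case: (P w); near: w.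
Unshelve. all: by end_near. Qed.

(** Near (z, s), H stays in an evenly covered set. A lift up to a time t close to s is continued by
    the section of the sheet containing it at time t. As d depends on s and not on t, the lemma can
    be used at a supremum. *)
Lemma lifts_upto_step z s : 0 <= s -> exists2 d, 0 < d & forall t t2,
  0 <= t -> s - d < t -> t <= s -> t <= t2 -> t2 < s + d -> lifts_upto z t -> lifts_upto z t2.
Proof.
move=> s0; have [V nV [J [q [sec [qP secP]]]]] := pcov.2 (H (z, s)).
have /= [[N' D] /= [nN' nD] hND] := H_cont nV.
have [d /= d0 hd] := (nbhs_ballP _ _).1 nD.
have HV z' t' : N' z' -> s - d < t' < s + d -> V (H (z', t')).
  move=> Nz' t'd; apply: (hND (z', t')); split=> //=; apply: hd.
  by rewrite /ball /= distrC ltr_norml; lra.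
exists d => // t t2 t0 st ts tt2 t2s [N [G [nN oN cG pG G0]]].
pose q0 := q (G (z, t)).
have Nz := nbhs_singleton nN; have N'z := nbhs_singleton nN'.
have cl : Num.max 0 (Num.min t t) = t by rewrite minxx; apply/max_idPr.
have VG z' : N z' -> N' z' -> V (p (G (z', t))).
  by move=> Nz' N'z'; rewrite pG // cl; apply: HV => //; lra.
have nq : \forall z' \near z, q (G (z', t)) = q0.
  have [_ hq] := qP _ (VG _ Nz N'z).
  have := cG z t Nz _ hq.
  move=> [[P Q] /= [nP nQ] hPQ]; apply: filterS nP => z' Pz'.
  by apply: (hPQ (z', t)); split=> //=; exact: nbhs_singleton nQ.
pose N2 := interior (N `&` N' `&` [set z' | q (G (z', t)) = q0]).
have N2P z' : N2 z' -> [/\ N z', N' z' & q (G (z', t)) = q0].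
  by move=> /nbhs_singleton[[]].
pose c t' := Num.max t (Num.min t' t2).
have cV z' t' : N' z' -> V (H (z', c t')).
  by move=> Nz'; apply: HV => //; rewrite /c; have [h|h] := leP t' t2; [have [k|k] := leP t t'|have [k|k] := leP t t2]; lra.
have cc : continuous c.
  move=> x; apply: cvg_maxr; first exact: cvg_cst.
  by apply: cvg_minr; [exact: cvg_id|exact: cvg_cst].
pose S (u : Z * R) := sec q0 (H (u.1, c u.2)).
have cS z' t' : N2 z' -> S u @[u --> (z', t')] --> S (z', t').
  move=> /N2P[_ Nz' _]; apply: (@cvg_comp _ _ _ (fun u : Z * R => H (u.1, c u.2)) (sec q0) _
    (nbhs (H (z', c t')))); last exact: (secP q0 _ (cV _ _ Nz')).2.
  apply: (@cvg_comp _ _ _ (fun u : Z * R => (u.1, c u.2)) H _ (nbhs (z', c t')));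
    last exact: H_cont.
  apply: (@cvg_pair _ _ _ (nbhs (z', t')) (nbhs z') (nbhs (c t'))); first exact: cvg_fst.
  by apply: (@cvg_comp _ _ _ snd c _ (nbhs t')); [exact: cvg_snd|exact: cc].
have GS z' : N2 z' -> G (z', t) = S (z', t).
  move=> /N2P[Nz' N'z' qz]; rewrite /S /= -qz /c.
  have -> : Num.max t (Num.min t t2) = t.
    by have -> : Num.min t t2 = t; [apply/min_idPl|rewrite maxxx].
  by rewrite -[LHS](qP _ (VG _ Nz' N'z')).1 pG // cl.
exists N2, (fun u => if u.2 <= t then G u else S u); split.
- by apply: nbhs_interior; apply: filterI => //; exact: filterI.
- exact: open_interior.
- move=> z' t' N2z'; have [Nz' N'z' _] := N2P _ N2z'; rewrite /=.
  have nsnd (P : R -> Prop) : (\forall x \near t', P x) ->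
      \forall u \near (z', t'), P u.2.
    by move=> nP; exact: (@cvg_snd _ _ (nbhs z') (nbhs t')).
  have [tt|tt|tt] := ltgtP t' t.
  + apply: cvg_trans (cG z' t' Nz'); apply: near_eq_cvg.
    have := nsnd _ (lt_nbhsl tt).
    by apply: filterS => u /ltW ->.
  + apply: cvg_trans (cS z' t' N2z'); apply: near_eq_cvg.
    have := nsnd _ (lt_nbhsr tt).
    by apply: filterS => u; rewrite ltNge => /negbTE ->.
  + rewrite tt; apply: cvg_glue; first exact: cG.
    by rewrite GS //; exact: cS.
- move=> z' t' /[dup] N2z' /N2P[Nz' N'z' _] /=; case: leP => tt.
    by rewrite pG //; congr (H (_, Num.max _ _)); apply/esym; rewrite (min_idPl tt); apply/min_idPl; lra.
  rewrite (secP _ _ (cV _ _ N'z')).1 /=; congr (H (_, _)); rewrite /c.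
  have m : t <= Num.min t' t2 by rewrite le_min (ltW tt).
  by rewrite (max_idPr m); apply/esym/max_idPr; lra.
- by move=> z' /N2P[Nz' _ _] /=; rewrite t0 G0.
Qed.

(** Let s be the supremum of the times in [0, 1] that a lift reaches. [lifts_upto_step] leads from a
    reached time just below s either to 1 or to s + d / 2, beyond the supremum. *)
Lemma lifts_upto_one z : lifts_upto z 1.
Proof.
pose A := [set t | 0 <= t <= 1 /\ lifts_upto z t].
have A0 : A 0.
  split; first by rewrite lexx ler01.
  exists setT, (g0 \o fst); split=> //; first exact: filterT.
  - exact: openT.
  - move=> z' t' _; apply: (@cvg_comp _ _ _ fst g0 _ (nbhs z')); [exact: cvg_fst|exact: g0_cont].
  - move=> z' t' _ /=; rewrite H0; congr (H (_, _)).
    by apply/esym/max_idPl; rewrite ge_min lexx orbT.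
have ubA : ubound A 1 by move=> t [/andP[]].
have sA : has_sup A by split; [exists 0|exists 1].
pose s := sup A.
have s0 : 0 <= s by exact: (ub_le_sup sA.2 A0).
have s1 : s <= 1 by apply: ge_sup => //; exists 0.
have [d d0 hd] := lifts_upto_step z s0.
have [t At st] := sup_adherent d0 sA.
have ts : t <= s by exact: (ub_le_sup sA.2 At).
have [/andP[t0 t1] Lt] := At.
have [s1d|s1d] := leP 1 (s + d / 2).
  by apply: (hd t 1) => //; lra.
have : A (s + d / 2).
  split; first lra.
  by apply: (hd t) => //; lra.
by move=> /(ub_le_sup sA.2); rewrite -/s; lra.
Qed.

Theorem homotopy_lift : exists G : Z * R -> E, [/\ continuous G,
  forall z t, p (G (z, t)) = H (z, Num.max 0 (Num.min t 1)) &
  forall z, G (z, 0) = g0 z].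
Proof.
have [G hG] : exists G : Z -> Z * R -> E, forall z : Z, exists N : set Z,
  [/\ nbhs z N, open N,
      forall z' t', N z' -> G z u @[u --> (z', t')] --> G z (z', t'),
      forall z' t', N z' -> p (G z (z', t')) = H (z', Num.max 0 (Num.min t' 1)) &
      forall z', N z' -> G z (z', 0) = g0 z'].
  have h (z : Z) : exists G : Z * R -> E, exists N : set Z, [/\ nbhs z N, open N,
      forall z' t', N z' -> G u @[u --> (z', t')] --> G (z', t'),
      forall z' t', N z' -> p (G (z', t')) = H (z', Num.max 0 (Num.min t' 1)) &
      forall z', N z' -> G (z', 0) = g0 z'].
    by have [N [G h]] := lifts_upto_one z; exists G, N.
  exists (fun z => projT1 (cid (h z))) => z; exact: projT2 (cid (h z)).
have slice z (N : set Z) z' : (forall z' t', N z' -> G z u @[u --> (z', t')] --> G z (z', t')) ->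
    N z' -> continuous (fun t => G z (z', t)).
  move=> cG Nz' t; apply: (@cvg_comp _ _ _ (fun t => (z', t)) (G z) _ (nbhs (z', t))); last exact: cG.
  by apply: (@cvg_pair _ _ _ (nbhs t) (nbhs z') (nbhs t)); [exact: cvg_cst|exact: cvg_id].
(* The local lifts agree on each time line where both are defined, by uniqueness of path lifting
   from time 0; hence evaluating the lift chosen at [u.1] is continuous. *)
have agree z (N : set Z) z' t : nbhs z N -> 
  (forall z' t', N z' -> G z u @[u --> (z', t')] --> G z (z', t')) ->
  (forall z' t', N z' -> p (G z (z', t')) = H (z', Num.max 0 (Num.min t' 1))) ->
  (forall z', N z' -> G z (z', 0) = g0 z') -> N z' -> G z' (z', t) = G z (z', t).
  move=> nN cG pG G0 Nz'.
  have [N' [nN' _ cG' pG' G0']] := hG z'; have N'z' := nbhs_singleton nN'.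
  apply: (@path_lift_unique (fun t => G z' (z', t)) (fun t => G z (z', t)) 0).
  - exact: slice cG' _.
  - exact: slice cG _.
  - by move=> u; rewrite pG' // pG.
  - by rewrite G0 // G0'.
exists (fun u => G u.1 u); split.
- move=> [z t]; have [N [nN oN cG pG G0]] := hG z; have Nz := nbhs_singleton nN.
  rewrite /=; apply: cvg_trans (cG z t Nz); apply: near_eq_cvg.
  have : \forall u \near (z, t), N u.1 by exact: (@cvg_fst _ _ (nbhs z) (nbhs t)).
  by apply: filterS => -[z' t'] /= Nz'; rewrite (agree z N).
- by move=> z t /=; have [N [nN oN cG pG G0]] := hG z; rewrite pG //; exact: nbhs_singleton nN.
- by move=> z /=; have [N [nN oN cG pG G0]] := hG z; rewrite G0 //; exact: nbhs_singleton nN.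
Qed.

End Homotopy.
End Lifting.

Lemma cvg_pairT (U V : topologicalType) (S : Type) (F : set_system S) {FF : Filter F}
    (f : S -> U) (g : S -> V) (a : U) (b : V) :
  f w @[w --> F] --> a -> g w @[w --> F] --> b -> (f w, g w) @[w --> F] --> (a, b).
Proof. exact: cvg_pair. Qed.

(** * Lifting maps and homotopies of the sphere *)

Section SphereRays.
Variable R : realType.
Local Notation I := (unit_interval R).

Lemma clampI_proof (t : R) : Num.max 0 (Num.min t 1) \in `[0, 1]%classic.
Proof.
apply/mem_set; rewrite /= in_itv /=; apply/andP; split.
  by rewrite le_max lexx.
by rewrite ge_max ler01 ge_min lexx orbT.
Qed.

Definition clampI (t : R) : I :=
  @exist R (fun x => x \in `[0, 1]%classic) _ (clampI_proof t).

Lemma clampI_continuous : continuous clampI.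
Proof.
apply: continuous_comp_initial => t.
apply: cvg_maxr; first exact: cvg_cst.
by apply: cvg_minr; [exact: cvg_id|exact: cvg_cst].
Qed.

Lemma clampIE t : set_val (clampI t) = Num.max 0 (Num.min t 1).
Proof. by []. Qed.

(* Moves the points of the plane to infinity along vertical half-lines, as    *)
(* u.2 decreases from 1 to 0.                                                 *)
Definition ray (u : plane R * R) : sphere R :=
  if u.2 <= 0 then None else Some (u.1.1, u.1.2 + (u.2^-1 - 1)).

Lemma ray_continuous : continuous ray.
Proof.
move=> [z t].
have nsnd (P : R -> Prop) : (\forall x \near t, P x) ->
    \forall u \near (z, t), P u.2.
  by move=> nP; exact: (@cvg_snd _ _ (nbhs z) (nbhs t)).
have nfst (P : plane R -> Prop) : (\forall x \near z, P x) ->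
    \forall u \near (z, t), P u.1.
  by move=> nP; exact: (@cvg_fst _ _ (nbhs z) (nbhs t)).
rewrite /continuous_at; have [t0|t0|t0] := ltgtP t 0.
- have -> : ray (z, t) = None by rewrite /ray /= (ltW t0).
  apply: (@cvg_trans _ ((fun=> None : sphere R) @ nbhs (z, t)));
    last exact: (@cvg_cst (sphere R) None).
  apply: near_eq_cvg; have := nsnd _ (lt_nbhsl t0).
  by apply: filterS => u /ltW u0; rewrite /ray u0.
- have -> : ray (z, t) = Some (z.1, z.2 + (t^-1 - 1)) by rewrite /ray leNgt t0.
  apply: (@cvg_trans _ ((fun u : plane R * R => Some (u.1.1, u.1.2 + (u.2^-1 - 1)) : sphere R) @ nbhs (z, t))).
    apply: near_eq_cvg; have := nsnd _ (lt_nbhsr t0).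
    by apply: filterS => u u0; rewrite /ray leNgt u0.
  apply: (@cvg_comp _ _ _ (fun u : plane R * R => (u.1.1, u.1.2 + (u.2^-1 - 1))) Some _
    (nbhs ((z.1, z.2 + (t^-1 - 1)) : plane R))); last first.
    exact: one_point_compactification_some_continuous.
  have f1 : u.1 @[u --> (z, t)] --> z by exact: cvg_fst.
  have f2 : u.2 @[u --> (z, t)] --> t by exact: cvg_snd.
  have f11 : u.1.1 @[u --> (z, t)] --> z.1.
    apply: (@cvg_comp _ _ _ fst fst _ (nbhs z)) => //; exact: cvg_fst.
  have f12 : u.1.2 @[u --> (z, t)] --> z.2.
    apply: (@cvg_comp _ _ _ fst snd _ (nbhs z)) => //; exact: cvg_snd.
  apply: cvg_pairT => //; apply: cvgD => //; apply: cvgB; last exact: cvg_cst.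
  by apply: cvgV => //; rewrite gt_eqF.
(* Continuity at time 0: as [u.2] decreases to 0 the second coordinate exceeds every bound [M1] of a
   compact set, uniformly for points near z. *)
- rewrite t0 in nsnd nfst *.
  have -> : ray (z, 0) = None by rewrite /ray /= lexx.
  move=> U [K [cK _] hU].
  have [M [Mr hM]] := compact_bounded cK.
  pose M1 := Num.max 0 M + 1.
  have {}hM z' : K z' -> z'.2 <= M1.
    move=> Kz'; apply: (le_trans (ler_norm _)).
    apply: (@le_trans _ _ `|z'|); last first.
      by apply: (hM M1) => //; rewrite /M1; have [h|h] := leP 0 M; lra.
    by rewrite prod_normE /= le_max lexx orbT.
  have M10 : 0 < M1 by rewrite /M1; have := le_max 0 0 M; rewrite lexx; lra.
  have n1 : \forall u \near (z, 0 : R), z.2 - 1 < u.1.2.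
    apply: (nfst (fun x => z.2 - 1 < x.2)).
    have : z.2 - 1 < z.2 by lra.
    move=> /lt_nbhsr; exact: (@cvg_snd _ _ (nbhs z.1) (nbhs z.2)).
  have d0 : 0 < (M1 + `|z.2| + 3)^-1 by rewrite invr_gt0; have := normr_ge0 z.2; lra.
  have n2 := nsnd _ (lt_nbhsl d0).
  suff : \forall u \near (z, 0 : R), U (ray u) by [].
  near=> u; apply: hU; rewrite /ray; case: leP => u0; first by right.
  left; exists (u.1.1, u.1.2 + (u.2^-1 - 1)) => // /hM /=; apply/negP; rewrite -ltNge.
  have h1 : z.2 - 1 < u.1.2 by near: u.
  have h2 : u.2 < (M1 + `|z.2| + 3)^-1 by near: u.
  have h3 : M1 + `|z.2| + 3 < u.2^-1.
    by rewrite -[ltLHS]invrK ltf_pV2 // posrE.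
  by have := ler_norm (- z.2); rewrite normrN; lra.
Unshelve. all: by end_near. Qed.

End SphereRays.

Section SphereLift.
Variables (R : realType) (E B : topologicalType) (p : E -> B).
Hypothesis pcov : covering_map p.
Variables (e0 : E) (b0 : B).
Hypothesis p0 : p e0 = b0.
Local Notation I := (unit_interval R).
Implicit Types (f g : sphere_map R e0).

Lemma sphere_map_ext (Y : topologicalType) (y : Y) (f g : sphere_map R y) :
  (forall z, f z = g z) -> f = g.
Proof.
case: f g => f cf bf [g cg bg] /= fg; have fg' : f = g by apply/funext.
by subst g; congr SphereMap; exact: Prop_irrelevance.
Qed.

Lemma ray_path_continuous (z : plane R) (Y : topologicalType) (f : sphere R -> Y) :
  continuous f -> continuous (fun t : R => f (ray (z, t))).
Proof.
move=> cf t; apply: (@cvg_comp _ _ _ (fun t => ray (z, t)) f _ (nbhs (ray (z, t)))); last exact: cf.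
apply: (@cvg_comp _ _ _ (fun t => (z, t)) (@ray R) _ (nbhs (z, t))); last exact: ray_continuous.
by apply: cvg_pairT; [exact: cvg_cst|exact: cvg_id].
Qed.

Lemma ray1 (z : plane R) : ray (z, 1) = Some z.
Proof. by rewrite /ray /= ler10 invr1 subrr addr0 -surjective_pairing. Qed.

(** A ray joins every point of the plane to infinity, where both maps take the base point; path
    lifting is unique along it. *)
Lemma sphere_lift_unique f g : (forall z, p (f z) = p (g z)) -> f = g.
Proof.
move=> pfg; apply: sphere_map_ext => -[z|]; last by rewrite !smap_base.
rewrite -ray1.
apply: (path_lift_unique pcov (f1 := fun t => f (ray (z, t))) (f2 := fun t => g (ray (z, t))) (t0 := 0)).
- exact/ray_path_continuous/smap_continuous.
- exact/ray_path_continuous/smap_continuous.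
- by move=> t; exact: pfg.
- by rewrite /ray /= lexx !smap_base.
Qed.

Lemma sphere_homotopy_lift (H : sphere R * I -> B) f : continuous H ->
  (forall z (t : I), set_val t = 0 -> H (z, t) = p (f z)) ->
  (forall t, H (None, t) = b0) ->
  exists g, based_homotopic f g /\ forall z, p (g z) = H (z, clampI 1).
Proof.
move=> cH H0 Hb.
pose H' (u : sphere R * R) := H (u.1, clampI u.2).
have cH' : continuous H'.
  move=> [z t]; apply: (@cvg_comp _ _ _ (fun u : sphere R * R => (u.1, clampI u.2)) H _ (nbhs (z, clampI t)));
    last exact: cH.
  apply: cvg_pairT; first exact: cvg_fst.
  by apply: (@cvg_comp _ _ _ snd (@clampI R) _ (nbhs t)); [exact: cvg_snd|exact: clampI_continuous].
have H'0 z : p (f z) = H' (z, 0).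
  by rewrite /H' /= H0 // clampIE min_l ?ler01 // maxxx.
have [G [cG pG G0]] := homotopy_lift pcov cH' (@smap_continuous _ _ _ f) H'0.
have sl z : continuous (fun t => G (z, t)).
  move=> t; apply: (@cvg_comp _ _ _ (fun t => (z, t)) G _ (nbhs (z, t))); last exact: cG.
  by apply: cvg_pairT; [exact: cvg_cst|exact: cvg_id].
have Gb t : G (None, t) = e0.
  apply: (path_lift_unique pcov (f1 := fun t => G (None, t)) (f2 := fun=> e0) (t0 := 0)).
  - exact: sl.
  - exact: cst_continuous.
  - by move=> u; rewrite pG /H' /= Hb p0.
  - by rewrite G0 smap_base.
have cG1 : continuous (fun z => G (z, 1)).
  move=> z; apply: (@cvg_comp _ _ _ (fun z => (z, 1 : R)) G _ (nbhs (z, 1 : R))); last exact: cG.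
  by apply: (@cvg_pairT (sphere R) R _ (nbhs z) _ id (fun=> 1)); [exact: cvg_id|exact: cvg_cst].
exists (SphereMap cG1 (Gb 1)); split; last first.
  by move=> z /=; rewrite pG /H' minxx max_r ?ler01.
exists (fun u => G (u.1, set_val u.2)); split=> [[z t]|z t t0|z t t1|t] /=.
- apply: (@cvg_comp _ _ _ (fun u : sphere R * I => (u.1, set_val u.2)) G _ (nbhs (z, set_val t))); last exact: cG.
  apply: cvg_pairT; first exact: cvg_fst.
  by apply: (@cvg_comp _ _ _ snd set_val _ (nbhs t)); [exact: cvg_snd|exact: initial_continuous].
- by rewrite t0 G0.
- by rewrite t1.
- exact: Gb.
Qed.

(** Equality in [pi2] only provides a chain of homotopies in either direction, so lifts are
    transported along chains, both ways at once. *)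
Lemma chain_lift (F F' : sphere_map R b0) :
  clos_refl_sym_trans _ (@based_homotopic R B b0) F F' ->
  (forall f, (forall z, p (f z) = F z) ->
    exists g, (forall z, p (g z) = F' z) /\ pi2_class f = pi2_class g) /\
  (forall f, (forall z, p (f z) = F' z) ->
    exists g, (forall z, p (g z) = F z) /\ pi2_class f = pi2_class g).
Proof.
have c0 : set_val (clampI (0 : R)) = 0 by rewrite clampIE min_l ?ler01 // maxxx.
have c1 : set_val (clampI (1 : R)) = 1 by rewrite clampIE minxx max_r ?ler01.
elim=> {F F'} [F F' [H [cH H0 H1 Hb]]|F|F F' _ [h1 h2]|F1 F2 F3 _ [h1 h1'] _ [h2 h2']].
- split=> f pf.
    have [|g [fg pg]] := @sphere_homotopy_lift H f cH _ Hb.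
      by move=> z t t0; rewrite H0.
    exists g; split; last exact: gen_class_step.
    by move=> z; rewrite pg H1.
  (* A step used backwards is lifted after reversing the time of its homotopy. *)
  pose rv (t : I) : I := clampI (1 - set_val t).
  have rvE t : set_val (rv t) = 1 - set_val t.
    have := unit_intervalP t; rewrite clampIE => h.
    by rewrite min_l ?max_r //; lra.
  have crv : continuous rv.
    move=> t; apply: (@cvg_comp _ _ _ (fun t : I => 1 - set_val t) (@clampI R) _ (nbhs (1 - set_val t)));
      last exact: clampI_continuous.
    have cs : set_val u @[u --> t] --> set_val t by exact: initial_continuous.
    have c1' : (fun _ : I => 1 : R) u @[u --> t] --> (1 : R).
      by apply: cvg_cst; exact: nbhs_filter.
    exact: (cvgB c1' cs).
  have cH' : continuous (fun u : sphere R * I => H (u.1, rv u.2)).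
    move=> [z t]; apply: (@cvg_comp _ _ _ (fun u : sphere R * I => (u.1, rv u.2)) H _ (nbhs (z, rv t)));
      last exact: cH.
    apply: cvg_pairT; first exact: cvg_fst.
    by apply: (@cvg_comp _ _ _ snd rv _ (nbhs t)); [exact: cvg_snd|exact: crv].
  have [||g [fg pg]] := @sphere_homotopy_lift _ f cH' _ _.
    by move=> z t t0; rewrite /= H1 ?rvE ?t0 ?subr0.
    by move=> t /=.
  exists g; split; last exact: gen_class_step.
  by move=> z; rewrite pg /= H0 // rvE c1 subrr.
- by split=> f pf; exists f.
- by [].
- split=> f pf.
    have [g [pg ->]] := h1 f pf; have [k [pk ->]] := h2 g pg; by exists k.
  have [g [pg ->]] := h2' f pf; have [k [pk ->]] := h1' g pg; by exists k.
Qed.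

(** Composition with [ray] is a homotopy from a constant to F on the plane. Its lift starting at the
    constant [e0] ends in a lift of F; what remains is that this lift is [e0] outside a square,
    hence continuous at infinity. *)
Lemma sphere_lift_ex (F : sphere_map R b0) (M : R) :
  (forall z : plane R, M < `|z.1| \/ M < `|z.2| -> F (Some z) = b0) ->
  exists f, forall z, p (f z) = F z.
Proof.
move=> FM.
have cFr : continuous (F \o @ray R).
  move=> u; apply: (@cvg_comp _ _ _ (@ray R) F _ (nbhs (ray u))).
    exact: ray_continuous.
  exact: smap_continuous.
have g00 (z : plane R) : p e0 = (F \o @ray R) (z, 0) by rewrite p0 /= /ray /= lexx smap_base.
have [G [cG pG G0]] := homotopy_lift pcov cFr (@cst_continuous _ _ e0) g00.
pose g (z : plane R) := G (z, 1).
have pg z : p (g z) = F (Some z) by rewrite /g pG /= minxx max_r ?ler01 // ray1.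
have cg : continuous g.
  move=> z; apply: (@cvg_comp _ _ _ (fun z => (z, 1 : R)) G _ (nbhs (z, 1 : R))); last exact: cG.
  by apply: cvg_pairT; [exact: cvg_id|exact: cvg_cst].
(* From such points the upward ray avoids the square, so its lift lies over [b0] throughout and is
   constant. *)
have vert (z : plane R) : M < `|z.1| \/ M < z.2 -> g z = e0.
  move=> Mz; apply: (path_lift_unique pcov (f1 := fun t => G (z, t)) (f2 := fun=> e0) (t0 := 0)).
  - move=> t; apply: (@cvg_comp _ _ _ (fun t => (z, t)) G _ (nbhs (z, t))); last exact: cG.
    by apply: cvg_pairT; [exact: cvg_cst|exact: cvg_id].
  - exact: cst_continuous.
  - move=> t; rewrite p0 pG /=; set t' := Num.max _ _.
    have [t'0 t'1] : 0 <= t' /\ t' <= 1.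
      have := mem_set (set_mem (clampI_proof t)) => /set_mem /=; rewrite in_itv /= -/t'.
      by move=> /andP[].
    rewrite /ray /=; case: leP => [_|t'p]; first by rewrite smap_base.
    apply: FM => /=; case: Mz => Mz; [by left|right].
    apply: (lt_le_trans Mz); apply: le_trans (ler_norm _).
    by rewrite lerDl subr_ge0 -invr1 lef_pV2 ?posrE.
  - by rewrite G0.
have out (z : plane R) : M < `|z.1| \/ M < `|z.2| -> g z = e0.
  move=> [Mz|Mz]; first by apply: vert; left.
  have [z2|z2] := leP 0 z.2; first by apply: vert; right; rewrite ger0_norm in Mz.
  (* Below the square the upward ray may cross it. The horizontal line does not, and it leads to the
     abscissa [|M| + 1], where [vert] applies. *)
  pose h t : plane R := (z.1 + t, z.2).
  have ch : continuous h.
    move=> t; apply: cvg_pairT; last exact: cvg_cst.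
    by apply: cvgD; [exact: cvg_cst|exact: cvg_id].
  have -> : g z = (fun t => g (h t)) 0 by rewrite /h addr0 -surjective_pairing.
  apply: (path_lift_unique pcov (f1 := fun t => g (h t)) (f2 := fun=> e0) (t0 := `|M| + 1 - z.1)).
  - by move=> t; apply: (@cvg_comp _ _ _ h g _ (nbhs (h t))); [exact: ch|exact: cg].
  - exact: cst_continuous.
  - by move=> t; rewrite pg FM ?p0 //; right.
  - apply: vert; left; rewrite /h /= addrC subrK ger0_norm; last by have := normr_ge0 M; lra.
    by have := ler_norm M; lra.
pose f (z : sphere R) := if z is Some w then g w else e0.
have cf : continuous f.
  case=> [z|]; first exact: cg.
  move=> U nU; exists (`[- M, M]%classic `*` `[- M, M]%classic); last first.
    move=> _ [[w nw <-]|->] /=; last exact: nbhs_singleton nU.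
    rewrite out; first exact: nbhs_singleton nU.
    apply: contrapT => /not_orP[/negP h1 /negP h2]; apply: nw.
    by move: h1 h2; rewrite -!leNgt !ler_norml; split; rewrite /= in_itv.
  have cK : compact (`[- M, M]%classic `*` `[- M, M]%classic : set (plane R)).
    by apply: compact_setX; exact: segment_compact.
  by split=> //; apply: compact_closed => //; exact: norm_hausdorff.
exists (SphereMap cf erefl) => -[z|] /=; first exact: pg.
by rewrite p0 smap_base.
Qed.

End SphereLift.

(** * Computing psi_* from a lift *)

Section PsiStarLift.
Variables (R : realType) (X : biquandle).

(** [covering_star_inv] returns some preimage b. A representative of b is homotopic to a lift of the
    same map as f, by [chain_lift], and that lift is f by uniqueness. *)
Lemma psi_star_lift (f : sphere_map R (EQ0 R (QX X))) :
  psi_star (pi2_class (sphere_comp (@covering_continuous R (QX X)) (covering_base _ _) f)) =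
  pi2_class (sphere_comp (@covering_continuous R X) (covering_base _ _)
    (sphere_comp (@psiB_continuous R X) (psiB_base _ _) f)).
Proof.
have pc := covering_covering_map R (QX X).
set a := pi2_class (sphere_comp _ _ f).
have aE : a = covering_star (pi2_class f) by rewrite /covering_star pi2_mapE.
suff E : covering_star_inv a = pi2_class f.
  by rewrite /psi_star E /psiB_star /covering_star !pi2_mapE.
rewrite /covering_star_inv; case: xgetP => [b _ /=|/(_ (pi2_class f)) /=]; last first.
  by rewrite aE.
rewrite -(gen_quotP b) /a /covering_star [LHS]pi2_mapE => /gen_classP h.
have [h1 _] := chain_lift pc (covering_base R (QX X)) h.
have [//|g [pg]] := h1 (repr b).
rewrite /pi2_class gen_quotP => ->.
by congr gen_class; apply: (sphere_lift_unique pc) => z; rewrite pg.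
Qed.

End PsiStarLift.

(** * Regions of a diagram *)

Lemma cvg_fstT (S : Type) (F : set_system S) (FF : Filter F) (U V : topologicalType)
  (f : S -> U * V) (z : U * V) : f w @[w --> F] --> z -> (f w).1 @[w --> F] --> z.1.
Proof.
by move=> fz; apply: (@cvg_comp _ _ _ f fst _ (nbhs z)) => //; exact: cvg_fst.
Qed.

Lemma cvg_sndT (S : Type) (F : set_system S) (FF : Filter F) (U V : topologicalType)
  (f : S -> U * V) (z : U * V) : f w @[w --> F] --> z -> (f w).2 @[w --> F] --> z.2.
Proof.
by move=> fz; apply: (@cvg_comp _ _ _ f snd _ (nbhs z)) => //; exact: cvg_snd.
Qed.

(** * Regular plane curves and their normal segments *)

Section PlaneCalculus.
Variable R : realType.
Implicit Types (u v w : plane R).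

Lemma dotDl u v w : dot (u + v) w = dot u w + dot v w.
Proof. by rewrite /dot /=; ring. Qed.

Lemma dotBl u v w : dot (u - v) w = dot u w - dot v w.
Proof. by rewrite /dot /=; ring. Qed.

Lemma dotZl (a : R) u v : dot (a *: u) v = a * dot u v.
Proof. by rewrite /dot /= /GRing.scale /=; ring. Qed.

Lemma dot_gt0 u : u != 0 -> 0 < dot u u.
Proof.
case: u => [x y] h; rewrite /dot /= -!expr2.
have [x0|x0] := eqVneq x 0; last by rewrite ltr_pwDl // ?exprn_even_gt0 ?sqr_ge0.
have [y0|y0] := eqVneq y 0; last by rewrite ltr_wpDl // ?exprn_even_gt0 ?sqr_ge0.
by case/eqP: h; rewrite x0 y0.
Qed.

Lemma cvg_dot (T : Type) (F : set_system T) {FF : Filter F} (f g : T -> plane R) u v :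
  f w @[w --> F] --> u -> g w @[w --> F] --> v ->
  dot (f w) (g w) @[w --> F] --> dot u v.
Proof.
move=> fu gv.
have f1 := cvg_fstT FF fu; have f2 := cvg_sndT FF fu.
have g1 := cvg_fstT FF gv; have g2 := cvg_sndT FF gv.
exact: (cvgD (cvgM f1 g1) (cvgM f2 g2)).
Qed.

Definition rot90 u : plane R := (- u.2, u.1).

Lemma dot_rot_rot u v : dot (rot90 u) (rot90 v) = dot u v.
Proof. by rewrite /dot /rot90 /=; ring. Qed.

Lemma dot_rotl u v : dot (rot90 u) v = - dot u (rot90 v).
Proof. by rewrite /dot /rot90 /=; ring. Qed.

Lemma dot_rot u : dot u (rot90 u) = 0.
Proof. by rewrite /dot /rot90 /=; ring. Qed.

Lemma orthogonal_rot u v : v != 0 -> dot u v = 0 -> u = (dot u (rot90 v) / dot v v) *: rot90 v.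
Proof.
move=> /dot_gt0 v0 uv; case: u v v0 uv => u1 u2 [v1 v2]; rewrite /dot /rot90 /= => v0 uv.
have v0' : v1 * v1 + v2 * v2 != 0 by rewrite gt_eqF.
congr pair; rewrite /= /GRing.scale /=.
- apply: (mulIf v0'); rewrite mulrAC mulfVK //.
  have -> : u1 * (v1 * v1 + v2 * v2) = v1 * (u1 * v1 + u2 * v2) - (u1 * - v2 + u2 * v1) * v2 by ring.
  by rewrite uv; ring.
- apply: (mulIf v0'); rewrite mulrAC mulfVK //.
  have -> : u2 * (v1 * v1 + v2 * v2) = v2 * (u1 * v1 + u2 * v2) + (u1 * - v2 + u2 * v1) * v1 by ring.
  by rewrite uv; ring.
Qed.

Lemma dot_frame u v w : dot u v * dot w w = dot u w * dot v w + dot u (rot90 w) * dot v (rot90 w).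
Proof. by rewrite /dot /rot90 /=; ring. Qed.

Lemma rot_continuous : continuous rot90.
Proof.
by move=> u; apply: cvg_pairT; [apply: cvgN; exact: cvg_snd|exact: cvg_fst].
Qed.

Section Curve.
Variables (c dc : R -> plane R).
Hypothesis c_derivable : forall s, derivable c s 1.
Hypothesis dcE : derive1 c = dc.
Hypothesis dc_cont : continuous dc.
Hypothesis dc_neq0 : forall s, dc s != 0.

Lemma is_derive_dot (v : plane R) (s : R) :
  is_derive s 1 (fun t => dot (c t) v) (dot (dc s) v).
Proof.
have h : dot (h^-1 *: (c (h *: 1 + s) - c s)) v @[h --> 0^'] --> dot (dc s) v.
  apply: cvg_dot; last exact: cvg_cst.
  by rewrite -dcE derive1E; exact: c_derivable.
have e : (fun h => h^-1 *: (((fun t => dot (c t) v) \o shift s) (h *: 1) - dot (c s) v)) =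
    (fun h => dot (h^-1 *: (c (h *: 1 + s) - c s)) v).
  by apply/funext => h1; rewrite dotZl dotBl.
apply: DeriveDef.
  by rewrite /derivable e; apply/cvg_ex; exists (dot (dc s) v).
by rewrite /derive e; apply: cvg_lim h; exact: norm_hausdorff.
Qed.

Lemma curve_continuous : continuous c.
Proof.
by move=> s; apply: differentiable_continuous; apply/derivable1_diffP; exact: c_derivable.
Qed.

Lemma dot_curve_continuous (v : plane R) : continuous (fun t => dot (c t) v).
Proof. by move=> s; apply: cvg_dot; [exact: curve_continuous|exact: cvg_cst]. Qed.

Lemma mvt_dot (v : plane R) (a b : R) : exists2 t, (a <= t <= b) || (b <= t <= a) &
  dot (c b - c a) v = dot (dc t) v * (b - a).
Proof.
have aux x y : x <= y -> exists2 t, x <= t <= y &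
    dot (c y - c x) v = dot (dc t) v * (y - x).
  move=> xy; have [||t txy e] := @MVT_segment R (fun t => dot (c t) v)
    (fun t => dot (dc t) v) x y xy.
  - by move=> t _; exact: is_derive_dot.
  - by apply: continuous_subspaceT; exact: dot_curve_continuous.
  by exists t; [move: txy; rewrite in_itv|rewrite dotBl].
have [ab|ba] := leP a b; first by have [t tab e] := aux _ _ ab; exists t; rewrite ?tab.
have [t tab e] := aux _ _ (ltW ba); exists t; first by rewrite tab orbT.
by rewrite -opprB -scaleN1r dotZl e; ring.
Qed.

Lemma frame_near s0 (eta : R) : 0 < eta -> exists2 d, 0 < d & forall s, `|s - s0| < d ->
  (1 - eta) * dot (dc s0) (dc s0) < dot (dc s) (dc s0) /\
  `|dot (dc s) (rot90 (dc s0))| < eta * dot (dc s0) (dc s0).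
Proof.
move=> eta0; have Q0 := dot_gt0 (dc_neq0 s0); set Q := dot _ _ in Q0 *.
have cv : dc s @[s --> s0] --> dc s0 by exact: dc_cont.
have h1 : dot (dc s) (dc s0) @[s --> s0] --> Q by apply: cvg_dot cv _; exact: cvg_cst.
have h2 : dot (dc s) (rot90 (dc s0)) @[s --> s0] --> 0.
  by rewrite -(dot_rot (dc s0)); apply: cvg_dot cv _; exact: cvg_cst.
have n1 : \forall s \near s0, (1 - eta) * Q < dot (dc s) (dc s0).
  have hQ : (1 - eta) * Q < Q by nra.
  exact: h1 (lt_nbhsr hQ).
have n2 : \forall s \near s0, `|dot (dc s) (rot90 (dc s0))| < eta * Q.
  have hQ : `|0 : R| < eta * Q by rewrite normr0 mulr_gt0.
  have h2n := cvg_norm h2; exact: h2n (lt_nbhsl hQ).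
have /nbhs_ballP[d /= d0 hd] : \forall s \near s0, (1 - eta) * Q < dot (dc s) (dc s0) /\
  `|dot (dc s) (rot90 (dc s0))| < eta * Q by exact: filterI n1 n2.
exists d => // s sd.
have sb : ball s0 d s by rewrite -ball_normE /= distrC.
exact: hd s sb.
Qed.

(** In the frame of [dc s0] a short chord is mainly tangential while a normal vector at a nearby
    parameter is mainly normal. With the tolerance 1/4 a nonzero vector cannot be both. *)
Lemma tube_local s0 : exists2 d, 0 < d & forall a b e, `|a - s0| < d -> `|b - s0| < d ->
  e != 0 -> c a + e *: rot90 (dc a) <> c b.
Proof.
have e4 : (0 : R) < 4^-1 by lra.
have [d d0 hd] := frame_near s0 e4; exists d => // a b e ad bd e0 E.
have Q0 := dot_gt0 (dc_neq0 s0).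
have Ed : c b - c a = e *: rot90 (dc a) by rewrite -E addrAC subrr add0r.
have btw t : (a <= t <= b) || (b <= t <= a) -> `|t - s0| < d.
  by move: ad bd; rewrite !ltr_norml => /andP[? ?] /andP[? ?] /orP[|] /andP[? ?]; lra.
have [t1 /btw t1d] := mvt_dot (dc s0) a b.
have [t2 /btw t2d] := mvt_dot (rot90 (dc s0)) a b.
have [h1 h2] := hd a ad.
have [h3 _] := hd t1 t1d; have [_ h4] := hd t2 t2d.
rewrite !Ed !dotZl dot_rot_rot dot_rotl.
move: (dot (dc s0) (dc s0)) Q0 h1 h2 h3 h4 => Q Q0.
move: (dot (dc a) (dc s0)) (dot (dc a) (rot90 (dc s0))) (dot (dc t1) (dc s0)) (dot (dc t2) (rot90 (dc s0))) (b - a).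
move=> al be ga ka x hal hbe hga hka m2 m1.
have n1 : `|e| * (3 / 4 * Q) <= `|x| * (Q / 4).
  have -> : `|x| * (Q / 4) = `|x| * `|Q / 4| by rewrite [`|Q / 4|]ger0_norm //; lra.
  apply: (@le_trans _ _ (`|e| * `|al|)).
    by apply: ler_wpM2l => //; apply: le_trans _ (ler_norm _); lra.
  rewrite -normrM m2 mulrC normrM; apply: ler_wpM2l => //.
  by rewrite [leRHS]ger0_norm; lra.
have n2 : `|x| * (3 / 4 * Q) <= `|e| * (Q / 4).
  have -> : `|e| * (Q / 4) = `|e| * `|Q / 4| by rewrite [`|Q / 4|]ger0_norm //; lra.
  apply: (@le_trans _ _ (`|x| * `|ga|)).
    by apply: ler_wpM2l => //; apply: le_trans _ (ler_norm _); lra.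
  rewrite -normrM mulrC -m1 normrM normrN; apply: ler_wpM2l => //.
  by rewrite [leRHS]ger0_norm; lra.
have e1 : 0 < `|e| by rewrite normr_gt0.
have x0 := normr_ge0 x; nra.
Qed.

(** The foot of z is a parameter s at which z - c(s) is orthogonal to the velocity. It exists
    because the tangential component of z - c(s) changes sign between s0 - h and s0 + h; its
    smallness is measured along the normal at s0. *)
Lemma tube_cover s0 (d eps : R) : 0 < d -> 0 < eps -> \forall z \near c s0,
  exists s l, [/\ `|s - s0| < d, `|l| < eps & z = c s + l *: rot90 (dc s)].
Proof.
move=> d0 eps0; have e4 : (0 : R) < 4^-1 by lra.
have [d1 d10 hd] := frame_near s0 e4.
have Q0 := dot_gt0 (dc_neq0 s0); set Q := dot (dc s0) (dc s0) in hd Q0.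
pose h := Num.min (Num.min d d1) eps / 2.
have h0 : 0 < h by rewrite divr_gt0 // !lt_min d0 d10 eps0.
have hm : h * 2 = Num.min (Num.min d d1) eps by rewrite /h; field.
have hd1 : h * 2 <= d by rewrite hm !ge_min lexx.
have hd2 : h * 2 <= d1 by rewrite hm !ge_min lexx orbT.
have he : h * 2 <= eps by rewrite hm ge_min lexx orbT.
have inner t : `|t - s0| <= h -> `|t - s0| < d1 by move=> ?; lra.
have side (e : R) : `|e| = h -> 0 < e * dot (c (s0 + e) - c s0) (dc (s0 + e)).
  move=> eh; have [t1 ht1 m1] := mvt_dot (dc s0) s0 (s0 + e).
  have [t2 ht2 m2] := mvt_dot (rot90 (dc s0)) s0 (s0 + e).
  have near_t t : (s0 <= t <= s0 + e) || (s0 + e <= t <= s0) -> `|t - s0| < d1.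
    move=> ht; apply: inner; rewrite ler_norml -eh.
    by have := ler_norm e; have := ler_norm (- e); rewrite normrN; lra.
  have ed1 : `|s0 + e - s0| < d1 by apply: inner; rewrite addrAC subrr add0r eh.
  have [f1 _] := hd t1 (near_t _ ht1); have [_ f2] := hd t2 (near_t _ ht2).
  have [f3 f4] := hd _ ed1.
  have := dot_frame (c (s0 + e) - c s0) (dc (s0 + e)) (dc s0).
  rewrite m1 m2 addrAC subrr add0r -/Q.
  move: f1 f2 f3 f4.
  move: (dot (c (s0 + e) - c s0) (dc (s0 + e))) (dot (dc t1) (dc s0)) (dot (dc t2) (rot90 (dc s0)))
    (dot (dc (s0 + e)) (dc s0)) (dot (dc (s0 + e)) (rot90 (dc s0))).
  move=> x a b a' b' f1 f2 f3 f4 E.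
  rewrite -(pmulr_lgt0 _ Q0) -mulrA E.
  have -> : e * (a * e * a' + b * e * b') = e ^+ 2 * (a * a' + b * b') by ring.
  have e2 : 0 < e ^+ 2.
    by rewrite exprn_even_gt0 //=; apply/eqP => e00; rewrite e00 normr0 in eh; lra.
  apply: mulr_gt0 => //.
  have bb : `|b * b'| <= (Q / 4) * (Q / 4).
    by rewrite normrM; apply: ler_pM => //; lra.
  have := ler_norm (- (b * b')); rewrite normrN => bb2.
  nra.
have aux (f : plane R -> R) : continuous f -> 0 < f (c s0) -> \forall z \near c s0, 0 < f z.
  by move=> cf f0; exact: cf (c s0) _ (lt_nbhsr f0).
have cdot u v : continuous (fun z : plane R => dot (z - u) v).
  by move=> z; apply: cvg_dot; [apply: cvgB; [exact: cvg_id|exact: cvg_cst]|exact: cvg_cst].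
have n1 : \forall z \near c s0, 0 < dot (z - c (s0 - h)) (dc (s0 - h)).
  apply: aux (cdot _ _) _.
  have := side (- h); rewrite normrN gtr0_norm // => /(_ erefl).
  by rewrite -opprB -[- (c s0 - _)]scaleN1r dotZl mulN1r mulrNN pmulr_rgt0.
have n2 : \forall z \near c s0, 0 < - dot (z - c (s0 + h)) (dc (s0 + h)).
  apply: (aux (fun z : plane R => - dot (z - c (s0 + h)) (dc (s0 + h)))).
    by move=> z; apply: cvgN; exact: cdot.
  have := side h; rewrite gtr0_norm // => /(_ erefl).
  by rewrite pmulr_rgt0 // -opprB -[- (c s0 - _)]scaleN1r dotZl mulN1r.
have n3 : \forall z \near c s0, `|dot (z - c s0) (rot90 (dc s0))| < Q * h / 4.
  have hh : `|dot (c s0 - c s0) (rot90 (dc s0))| < Q * h / 4.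
    by rewrite subrr /dot /= !mul0r addr0 normr0 divr_gt0 // mulr_gt0.
  have hn := cvg_norm (cdot (c s0) (rot90 (dc s0)) (c s0)); exact: hn _ (lt_nbhsl hh).
near=> z.
have z1 : 0 < dot (z - c (s0 - h)) (dc (s0 - h)) by near: z.
have z2 : 0 < - dot (z - c (s0 + h)) (dc (s0 + h)) by near: z.
have z3 : `|dot (z - c s0) (rot90 (dc s0))| < Q * h / 4 by near: z.
have sh : s0 - h <= s0 + h by lra.
have [||s] := @IVT R (fun s => dot (z - c s) (dc s)) (s0 - h) (s0 + h) 0 sh.
- apply: continuous_subspaceT => s; apply: cvg_dot; last exact: dc_cont.
  by apply: cvgB; [exact: cvg_cst|exact: curve_continuous].
- by rewrite ge_min le_max (ltW z1); apply/andP; split=> //; apply/orP; right; lra.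
rewrite in_itv /= => sI /(orthogonal_rot (dc_neq0 s)); set l := (_ / _) => El.
have sh' : `|s - s0| <= h by rewrite ler_norml; lra.
exists s, l; split; first by lra.
- have [t ht m] := mvt_dot (rot90 (dc s0)) s0 s.
  have near_t : `|t - s0| < d1.
    apply: inner; rewrite ler_norml.
    by move: sh'; rewrite ler_norml; lra.
  have [_ f2] := hd t near_t; have [f1 _] := hd s (inner _ sh').
  have : dot (z - c s) (rot90 (dc s0)) = l * dot (dc s) (dc s0).
    by rewrite [z - c s]El dotZl dot_rot_rot.
  have -> : z - c s = (z - c s0) - (c s - c s0) by rewrite opprB addrA subrK.
  rewrite dotBl m.
  move: z3 f2 f1.
  move: (dot (z - c s0) (rot90 (dc s0))) (dot (dc t) (rot90 (dc s0))) (dot (dc s) (dc s0)).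
  move=> x y w hx hy hw E.
  have lw : `|l| * (3 / 4 * Q) <= Q * h / 4 + Q / 4 * h.
    apply: (@le_trans _ _ (`|l| * `|w|)).
      by apply: ler_wpM2l => //; apply: le_trans _ (ler_norm _); lra.
    rewrite -normrM -E; apply: (le_trans (ler_normB _ _)); apply: lerD; first exact: ltW.
    by rewrite normrM; apply: ler_pM => //; lra.
  have : `|l| * (3 / 4) <= h / 2.
    rewrite -(ler_pM2r Q0); lra.
  by lra.
- by rewrite -El addrC subrK.
Unshelve. all: by end_near. Qed.

End Curve.
End PlaneCalculus.

(** * Strands, regions and the two sides of a strand *)

Section Strands.
Variables (R : realType) (D : diagram R).
Implicit Types (p q r : strand D) (z : plane R) (i : 'I_(ncomp D)).

Definition pos_of i (s : R) : plane R := pos ((i, s) : strand D).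
Definition vel_of i (s : R) : plane R := vel ((i, s) : strand D).

Lemma pos_derivable i s : derivable (pos_of i) s 1.
Proof. exact: curve_derivable. Qed.

Lemma derive1_pos i : derive1 (pos_of i) = vel_of i.
Proof. by []. Qed.

Lemma vel_continuous i : continuous (vel_of i).
Proof. exact: curve_C1. Qed.

Lemma vel_neq0 i s : vel_of i s != 0.
Proof. exact: curve_regular. Qed.

Lemma pos_continuous i : continuous (pos_of i).
Proof. exact: (curve_continuous (@pos_derivable i)). Qed.

Lemma normal_rot90 p : normal p = rot90 (vel p).
Proof. by []. Qed.

Lemma same_normal p q : same p q -> normal p = normal q.
Proof. by move=> pq; rewrite !normal_rot90 (same_vel pq). Qed.

Lemma pos_periodicz i s (k : int) : pos_of i (s + k%:~R) = pos_of i s.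
Proof. exact: curve_periodicz. Qed.

(** The parameters of [0, 1] at distance at least d from every parameter of z form a compact set,
    whose image is closed and misses z; periodicity reduces all parameters to [0, 1]. *)
Lemma near_param z (d : R) : 0 < d -> \forall z' \near z, forall r, pos r = z' ->
  exists r0, [/\ pos r0 = z, r0.1 = r.1 & `|r0.2 - r.2| < d].
Proof.
move=> d0.
pose A i := [set s | exists2 s1, pos_of i s1 = z & `|s1 - s| < d].
have oA i : open (A i).
  have -> : A i = \bigcup_(s1 in [set s1 | pos_of i s1 = z]) ball s1 d.
    by apply/seteqP; split=> s [s1 h1 h2]; exists s1.
  by apply: bigcup_open => s1 _; exact: ball_open.
pose K i := pos_of i @` (`[0, 1]%classic `&` ~` A i).
have : \forall z' \near z, forall i, (~` K i) z'.
  apply: (@filter_forall (plane R) 'I_(ncomp D) (fun i => ~` K i) (nbhs z)) => i.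
  suff h : open_nbhs z (~` K i) by exact: open_nbhs_nbhs h.
  split.
    apply: closed_openC; apply: compact_closed; first exact: norm_hausdorff.
    apply: continuous_compact.
      by apply: continuous_subspaceT; exact: pos_continuous.
    by apply: compact_closedI; [exact: segment_compact|exact: open_closedC].
  by move=> [s [_ nA] sz]; apply: nA; exists s; rewrite ?subrr ?normr0.
apply: filterS => z' hz' [i s] rz.
have := hz' i; pose k := Num.floor s; have fk : k%:~R <= s < k%:~R + 1.
  by have := floor_itv s; rewrite intrD.
have ks : pos_of i (s - k%:~R) = z' by rewrite -mulrNz pos_periodicz.
move=> h; have : A i (s - k%:~R).
  apply: contrapT => nA; apply: h; exists (s - k%:~R) => //; split=> //=.
  by rewrite in_itv /=; lra.
move=> [s1 s1z ss]; exists (i, s1 + k%:~R); split=> //=.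
  by rewrite -s1z; exact: pos_periodicz.
by move: ss; rewrite opprB addrA [s1 + _ - _]addrAC.
Qed.

Lemma simple_same p q : ~ crossing_pt p -> pos q = pos p -> same p q.
Proof. by move=> np pq; apply: contrapT => n; apply: np; exists q; split. Qed.

Lemma near_param_simple p (d : R) : ~ crossing_pt p -> 0 < d ->
  \forall z' \near pos p, forall r, pos r = z' ->
  exists2 s, same ((p.1, s) : strand D) r & `|s - p.2| < d.
Proof.
move=> np d0; apply: filterS (near_param (pos p) d0) => z' h r /h[r0 [r0p r01 rd]].
have [e [k ek]] := simple_same np r0p.
exists (r.2 - k%:~R); last first.
  rewrite -normrN; move: rd; rewrite ek; congr (`|_| < _); ring.
split=> /=; first by rewrite e.
by exists k; rewrite subrK.
Qed.

(** A point of D on a short normal segment near p has a parameter near that of p, by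
    [near_param_simple], and this contradicts [tube_local]. *)
Lemma tube p : ~ crossing_pt p -> exists2 d, 0 < d & exists2 eps, 0 < eps &
  forall s e, `|s - p.2| < d -> 0 < `|e| < eps ->
    ~ Defs.image D (pos_of p.1 s + e *: rot90 (vel_of p.1 s)).
Proof.
move=> np.
have [d d0 hd] := tube_local (@pos_derivable p.1) (derive1_pos p.1)
  (@vel_continuous p.1) (@vel_neq0 p.1) p.2.
have cT : (pos_of p.1 u.1 + u.2 *: rot90 (vel_of p.1 u.1))
    @[u --> ((p.2, 0) : R * R)] --> pos p.
  have e0 : pos p = pos_of p.1 p.2 + 0 *: rot90 (vel_of p.1 p.2).
    by rewrite scale0r addr0 {1}(surjective_pairing p).
  rewrite e0; have f1 : u.1 @[u --> ((p.2, 0) : R * R)] --> p.2 by exact: cvg_fst.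
  have f2 : u.2 @[u --> ((p.2, 0) : R * R)] --> (0 : R) by exact: cvg_snd.
  have g1 := cvg_comp _ _ f1 (@pos_continuous p.1 p.2).
  have g2 := cvg_comp _ _ f1 (@vel_continuous p.1 p.2).
  have g3 := cvg_comp _ _ g2 (@rot_continuous R _).
  exact: cvgD g1 (cvgZ f2 g3).
have [[P Q] /= [nP nQ] hPQ] := cT _ (near_param_simple np d0).
have /nbhs_ballP[d1 /= d10 hP] := nP; have /nbhs_ballP[eps /= eps0 hQ] := nQ.
exists (Num.min d d1); first by rewrite lt_min d0.
exists eps => // s e; rewrite lt_min => /andP[sd sd1] /andP[e0 ee] [r _ rE].
have [|s' sr s'd] := hPQ (s, e) _ r rE.
  split=> /=; first by apply: hP; rewrite -ball_normE /= distrC.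
  by apply: hQ; rewrite -ball_normE /= sub0r normrN.
apply: (hd s s' e sd s'd); first by rewrite -normr_gt0.
by rewrite -[LHS]rE; symmetry; exact: (same_pos sr).
Qed.

Lemma image_closed_near z : ~ Defs.image D z -> \forall z' \near z, ~ Defs.image D z'.
Proof.
move=> nz; apply: filterS (near_param z ltr01) => z' h [r _ /h[r0 [r0z _ _]]].
by apply: nz; exists r0.
Qed.

Lemma path_component (A : set (plane R)) (g : R -> plane R) (a b : R) :
  continuous g -> (forall t, (a <= t <= b) || (b <= t <= a) -> A (g t)) ->
  connected_component A (g a) (g b).
Proof.
move=> cg hA; pose m := Num.min a b; pose M := Num.max a b.
exists (g @` `[m, M]%classic); last first.
  by exists b => //=; rewrite in_itv /= ge_min le_max !lexx !orbT.
split.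
- by exists a => //=; rewrite in_itv /= ge_min le_max !lexx.
- move=> _ [t /= + <-]; rewrite in_itv /= /m /M => tm; apply: hA.
  by move: tm; have [ab|ab] := leP a b => ->; rewrite ?orbT.
- apply: connected_continuous_connected; first exact: segment_connected.
  exact: continuous_subspaceT.
Qed.

Lemma nbhs_star z (P : set (plane R)) : nbhs z P ->
  \forall z' \near z, forall t, 0 <= t <= 1 -> P (z + t *: (z' - z)).
Proof.
move=> /nbhs_ballP[e /= e0 he].
have : nbhs z (ball z e) by exact: nbhsx_ballx.
apply: filterS => z' zz' t t01; apply: he; move: zz'; rewrite -!ball_normE /=.
rewrite opprD addrA subrr add0r normrN normrZ distrC => zz'.
apply: le_lt_trans zz'; rewrite ger0_norm; last by lra.
by rewrite -[leRHS]mul1r; apply: ler_wpM2r => //; lra.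
Qed.

Lemma line_continuous (z v : plane R) : continuous (fun t : R => z + t *: v).
Proof.
move=> t; apply: cvgD; first exact: cvg_cst.
by apply: cvgZr_tmp; exact: cvg_id.
Qed.

Lemma region_at z : ~ Defs.image D z -> exists A : region D, sval A z.
Proof.
move=> nz; have h : is_region D (connected_component (~` Defs.image D) z) by exists z.
by exists (exist _ _ h) => /=; exact: connected_component_refl.
Qed.

Lemma region_notin (A : region D) z : sval A z -> ~ Defs.image D z.
Proof. by have [w nw ->] := svalP A; move=> /connected_component_sub. Qed.

Lemma region_component (A : region D) z : sval A z ->
  sval A = connected_component (~` Defs.image D) z.
Proof. by have [w nw ->] := svalP A; exact: same_connected_component. Qed.

Lemma region_eq (A B : region D) z : sval A z -> sval B z -> A = B.
Proof.
move=> Az Bz; apply: eq_sig_hprop; first by move=> *; exact: Prop_irrelevance.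
by rewrite (region_component Az) (region_component Bz).
Qed.

Lemma region_path (A : region D) (g : R -> plane R) (a b : R) :
  continuous g -> (forall t, (a <= t <= b) || (b <= t <= a) -> ~ Defs.image D (g t)) ->
  sval A (g a) -> sval A (g b).
Proof. by move=> cg hg Aa; rewrite (region_component Aa); exact: path_component. Qed.

Lemma region_connected (A : region D) : connected (sval A).
Proof. by have [w nw ->] := svalP A; exact: component_connected. Qed.

Lemma region_near (A : region D) z : sval A z -> \forall z' \near z, sval A z'.
Proof.
move=> Az; have := nbhs_star (image_closed_near (region_notin Az)).
apply: filterS => z' h.
have -> : z' = z + 1 *: (z' - z) by rewrite scale1r addrC subrK.
apply: (@region_path A (fun t => z + t *: (z' - z)) 0 1); first exact: line_continuous.
- by move=> t ht; apply: h; lra.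
- by rewrite scale0r addr0.
Qed.

Definition sides (p : strand D) (A B : region D) : Prop :=
  \forall e \near 0^'+, sval A (pos p - e *: normal p) /\ sval B (pos p + e *: normal p).

Lemma sides_same p q A B : same p q -> sides p A B -> sides q A B.
Proof. by move=> pq; rewrite /sides (same_pos pq) (same_normal pq). Qed.

Lemma sides_unique p A B A' B' : sides p A B -> sides p A' B' -> A = A' /\ B = B'.
Proof.
move=> h h'; have /filter_ex[e [[h1 h2] [h1' h2']]] : \forall e \near (0 : R)^'+,
    (sval A (pos p - e *: normal p) /\ sval B (pos p + e *: normal p)) /\
    (sval A' (pos p - e *: normal p) /\ sval B' (pos p + e *: normal p)).
  by near=> e; split; near: e.
by split; [exact: region_eq h1 h1'|exact: region_eq h2 h2'].
Unshelve. all: by end_near. Qed.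

(** Each open half of the tube around p is path connected and avoids D, so it lies in one region; by
    [tube_cover] the tube fills a neighborhood. *)
Lemma tubular p : ~ crossing_pt p -> exists A B : region D,
  (\forall s \near p.2, sides (p.1, s) A B) /\
  (\forall z \near pos p, [\/ sval A z, sval B z | Defs.image D z]).
Proof.
move=> np; have [d d0 [eps eps0 hT]] := tube np.
pose T (s e : R) := pos_of p.1 s + e *: rot90 (vel_of p.1 s).
have cTs e : continuous (fun s => T s e).
  move=> s; apply: cvgD; first exact: pos_continuous.
  apply: cvgZr; apply: (@cvg_comp _ _ _ (vel_of p.1) (@rot90 R) _ (nbhs (vel_of p.1 s))).
    exact: vel_continuous.
  exact: rot_continuous.
have half (u : R) : `|u| = 1 -> exists A : region D, forall s e,
    `|s - p.2| < d -> 0 < e < eps -> sval A (T s (u * e)).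
  move=> u1; have ne : 0 < `|u * (eps / 2)| < eps.
    by rewrite normrM u1 mul1r gtr0_norm; lra.
  have nd : `|p.2 - p.2| < d by rewrite subrr normr0.
  have [A hA] := region_at (hT p.2 _ nd ne); exists A => s e sd e0.
  have step : sval A (T s (u * (eps / 2))).
    apply: (region_path (g := fun s => T s (u * (eps / 2))) (cTs _) _ hA).
    move=> t ht; apply: hT => //.
    move: sd; rewrite !ltr_norml => sd; lra.
  apply: (region_path (g := fun x => T s (u * x)) _ _ step).
    move=> x; rewrite /T; apply: cvgD; first exact: cvg_cst.
    apply: cvgZl; apply: cvgMr; exact: cvg_id.
  by move=> t ht; apply: hT => //; rewrite normrM u1 mul1r gtr0_norm; lra.
have [A hA] := half (-1) (normrN1 _); have [B hB] := half 1 (normr1 _).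
exists A, B; split.
  have : \forall s \near p.2, `|s - p.2| < d.
    have := nbhsx_ballx p.2 d d0; apply: filterS => s; by rewrite -ball_normE /= distrC.
  apply: filterS => s sd; near=> e.
  have e0 : 0 < e < eps by apply/andP; split; near: e; [exact: nbhs_right_gt|exact: nbhs_right_lt].
  by have := hA s e sd e0; have := hB s e sd e0; rewrite /T mul1r mulN1r scaleNr.
have := tube_cover (@pos_derivable p.1) (derive1_pos p.1)
  (@vel_continuous p.1) (@vel_neq0 p.1) p.2 d0 eps0.
rewrite /pos_of -surjective_pairing; apply: filterS => z [s [l [sd le zE]]].
have [l0|l0|l0] := ltgtP l 0.
- constructor 1; rewrite zE; have := hA s (- l) sd; rewrite mulN1r opprK; apply.
  by move: le; rewrite ltr_norml; lra.
- constructor 2; rewrite zE; have := hB s l sd; rewrite mul1r; apply.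
  by move: le; rewrite ltr_norml; lra.
- by constructor 3; rewrite zE l0 scale0r addr0; exists (p.1, s).
Unshelve. all: by end_near. Qed.

End Strands.

(** * Sides of semi-arcs and uniqueness of region colorings *)

Section Sides.
Variables (R : realType) (D : diagram R).
Implicit Types (p q r : strand D) (z : plane R) (A B : region D) (s : semiarc D).

Lemma semiarc_sides s : exists A B, forall p, sval s p -> sides p A B.
Proof.
have [p0 np0 ->] := svalP s; have [A [B [hAB _]]] := tubular np0.
exists A, B => q [e [k hk]].
have s0 : sides ((p0.1, p0.2) : strand D) A B by exact: nbhs_singleton hAB.
have same_q : same ((p0.1, q.2 + k%:~R) : strand D) q.
  by split=> //=; exists (- k); rewrite mulrNz addrK.
apply: (sides_same same_q).
pose f (t : R) : Prop := sides ((p0.1, t) : strand D) A B.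
pose m := Num.min p0.2 (q.2 + k%:~R); pose M := Num.max p0.2 (q.2 + k%:~R).
suff : f p0.2 = f (q.2 + k%:~R) by rewrite /f => <-.
apply: (@connected_locally_constant _ Prop `[m, M]%classic f); first exact: segment_connected.
- move=> t /=; rewrite in_itv /= /m /M => tm.
  have nt : ~ crossing_pt ((p0.1, t) : strand D).
    by apply: hk; move: tm; have [ab|ab] := leP p0.2 (q.2 + k%:~R) => ->; rewrite ?orbT.
  have [A' [B' [hAB' _]]] := tubular nt.
  have fE u : sides ((p0.1, u) : strand D) A' B' -> f u = (A = A' /\ B = B').
    move=> hu; rewrite /f; apply/propext; split=> [h|[-> ->]//]; exact: sides_unique h hu.
  have ht : sides ((p0.1, t) : strand D) A' B' by exact: nbhs_singleton hAB'.
  by have := hAB'; apply: filterS => u hu _; rewrite (fE _ hu) (fE _ ht).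
- by rewrite /= in_itv /= ge_min le_max !lexx.
- by rewrite /= in_itv /= ge_min le_max !lexx !orbT.
Qed.

Lemma semiarc_of p : ~ crossing_pt p -> exists s, sval s p.
Proof.
move=> np; exists (exist _ (@Defs.cut R D (@crossing_pt R D) p) (ex_intro2 _ _ p np erefl)).
exact: cut_refl.
Qed.

Lemma semiarc_ex s : exists2 p, ~ crossing_pt p & sval s p.
Proof. by have [p np sE] := svalP s; exists p; rewrite // sE; exact: cut_refl. Qed.

Lemma points_to_ex s : exists A B, points_to s A B /\
  (forall p, sval s p -> sides p A B) /\
  forall A' B', points_to s A' B' -> A' = A /\ B' = B.
Proof.
have [A [B h]] := semiarc_sides s; have [p np sp] := semiarc_ex s.
exists A, B; split; [by exists p => //; exact: h|split=> //].
by move=> A' B' [q sq hq]; exact: sides_unique hq (h q sq).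
Qed.

Lemma crossing_of p : crossing_pt p -> exists c : crossing D, sval c = pos p.
Proof.
move=> [q pq]; have ou := over_under pq.
case op : (overp p) ou => ou.
  have qc : exists p' q', crossing_at (pos p) p' q'.
    exists q, p; split; first by rewrite -pq.2.
    by split; [exact: double_sym|move: ou => /= <-].
  by exists (exist _ (pos p) qc).
have pc : exists p' q', crossing_at (pos p) p' q'.
  by exists p, q; split=> //; split; rewrite ?op.
by exists (exist _ (pos p) pc).
Qed.

Lemma vline_continuous (x : R) : continuous (fun t : R => (x, t) : plane R).
Proof. by move=> t; apply: cvg_pairT; [exact: cvg_cst|exact: cvg_id]. Qed.

Lemma hline_continuous (y : R) : continuous (fun t : R => (t, y) : plane R).
Proof. by move=> t; apply: cvg_pairT; [exact: cvg_id|exact: cvg_cst]. Qed.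

(** A horizontal and a vertical line whose coordinates are those of no crossing join any two generic
    points, and every point other than a crossing has generic points nearby with the same value of
    f. *)
Lemma punctured_plane_constant (T : Type) (f : plane R -> T) :
  let F z := exists c : crossing D, sval c = z in
  (forall z, ~ F z -> \forall z' \near z, f z' = f z) ->
  forall z z', ~ F z -> ~ F z' -> f z = f z'.
Proof.
move=> F hf.
pose generic (x : R) := forall c : crossing D, (sval c).1 <> x /\ (sval c).2 <> x.
have near_generic (x : R) : \forall y \near x^'+, generic y.
  apply: near_finite => [|c]; first exact: crossing_set_finite.
  have aux (a : R) : \forall y \near x^'+, a <> y.
    have [ax|xa] := leP a x.
      near=> y => ay; have : x < y by near: y; exact: nbhs_right_gt.
      by rewrite -ay ltNge ax.
    near=> y => ay; have : y < a by near: y; exact: nbhs_right_lt.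
    by rewrite ay ltxx.
  by apply: filterI; exact: aux.
have generic_ex z : ~ F z -> exists z', [/\ generic z'.1, generic z'.2 & f z' = f z].
  move=> nz; have /nbhs_ballP[e /= e0 he] := hf z nz.
  have pick (x : R) : exists2 y, generic y & `|y - x| < e.
    have h : \forall y \near x^'+, generic y /\ (x < y /\ y < x + e).
      near=> y; split; first by near: y; exact: near_generic.
      by split; near: y; [exact: nbhs_right_gt|apply: nbhs_right_lt; rewrite ltrDl].
    have [y [gy [xy ye]]] := @filter_ex _ _ (at_right_proper_filter x) _ h.
    by exists y => //; rewrite ltr_norml; lra.
  have [x gx xe] := pick z.1; have [y gy ye] := pick z.2.
  exists (x, y); split=> //; apply: he; rewrite -ball_normE /= prod_normE /=.
  by rewrite gt_max !(distrC _ x) !(distrC _ y) xe ye.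
have line (g : R -> plane R) : continuous g -> (forall t, ~ F (g t)) ->
    forall a b, f (g a) = f (g b).
  move=> cg hg a b; apply: (@connected_locally_constant _ _ setT (f \o g)) => //.
    by apply/connected_intervalP => x y _ _ t _.
  move=> t _; have hc := cg t.
  have h : \forall u \near t, f (g u) = f (g t) by exact: (hc _ (hf _ (hg t))).
  by apply: filterS h => u.
move=> z z' nz nz'.
have [w [w1 w2 <-]] := generic_ex z nz; have [w' [w1' w2' <-]] := generic_ex z' nz'.
transitivity (f (w'.1, w.2)).
  rewrite {1}(surjective_pairing w).
  apply: (line (fun t => (t, w.2))); first exact: hline_continuous.
  by move=> t [c cE]; have [_] := w2 c; apply; rewrite cE.
rewrite [in RHS](surjective_pairing w').
apply: (line (fun t => (w'.1, t))); first exact: vline_continuous.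
by move=> t [c cE]; have [+ _] := w1' c; apply; rewrite cE.
Unshelve. all: by end_near. Qed.

Variable N : bicollar D.

Lemma support_bounded : exists M : R, forall z, Defs.support N z -> `|z| <= M.
Proof.
have [M [Mr hM]] := compact_bounded (@support_compact R D N).
by exists (M + 1) => z; apply: hM; lra.
Qed.

Lemma unbounded_region_ex : exists A, ~ bounded_set (sval A).
Proof.
have [M hM] := support_bounded.
have out (t : R) : M < t -> ~ Defs.image D (t, 0).
  move=> Mt /(@support_image R D N) /hM; rewrite prod_normE /= ge_max => /andP[h _].
  by have := ler_norm t; lra.
pose t0 := M + 1; have Mt0 : M < t0 by rewrite /t0; lra.
have [A At0] := region_at (out t0 Mt0); exists A => -[K [Kr hK]].
pose t1 := Num.max t0 (K + 2).
have : sval A (t1, 0).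
  apply: (@region_path R D A (fun t => (t, 0)) t0 t1) => //; first exact: hline_continuous.
  by move=> t ht; apply: out; have : t0 <= t1 by [rewrite le_max lexx]; lra.
have KK : K < K + 1 by lra.
move=> At1; have /= := hK (K + 1) KK (t1, 0) At1.
rewrite prod_normE /= ge_max => /andP[h _].
have : K + 2 <= t1 by rewrite le_max lexx orbT.
by have := ler_norm t1; lra.
Qed.

Variable X : biquandle.

Lemma region_coloring_unique (C : semiarc D -> X) (CR CR' : region D -> As X) :
  is_region_coloring C CR -> is_region_coloring C CR' -> CR =1 CR'.
Proof.
move=> [h1 h2] [h1' h2'].
(* Agreement at z: on the region containing z, or, if z lies on a strand, on the region behind it.
   Away from crossings this is locally constant, since agreement behind a semi-arc and ahead of it
   are equivalent by cancelling its color. *)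
pose f (z : plane R) : Prop := (forall A, sval A z -> CR A = CR' A) /\
  (forall p A B, pos p = z -> sides p A B -> CR A = CR' A).
have f_in A z : sval A z -> f z = (CR A = CR' A).
  move=> Az; apply/propext; split=> [[h _]|h]; first exact: h.
  split=> [A' A'z|p A1 B1 pz h1s]; first by rewrite -(region_eq Az A'z).
  by case: (region_notin Az); exists p.
have f_loc z : ~ (exists c : crossing D, sval c = z) -> \forall z' \near z, f z' = f z.
  move=> nz; have [[p _ pz]|nI] := pselect (Defs.image D z); last first.
    have [A Az] := region_at nI.
    by apply: filterS (region_near Az) => z' Az'; rewrite (f_in A z') // (f_in A z).
  have np : ~ crossing_pt p by move=> /crossing_of[c cp]; apply: nz; exists c; rewrite cp.
  have [A [B [hs hz]]] := tubular np; have [s sp] := semiarc_of np.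
  have sAB : points_to s A B.
    exists p => //; have : sides ((p.1, p.2) : strand D) A B by exact: nbhs_singleton hs.
    by rewrite -surjective_pairing.
  have AB : (CR B = CR' B) = (CR A = CR' A).
    rewrite -(h2 _ _ _ sAB) -(h2' _ _ _ sAB).
    by apply/propext; split=> [/mulIg|->].
  have /nbhs_ballP[d /= d0 hd] := hs.
  have hp := near_param_simple np d0.
  have f_near : \forall z' \near z, f z' = (CR A = CR' A).
    rewrite -pz; apply: filterS2 hz hp => z' [Az'|Bz'|[r _ rz']] hp.
    - exact: f_in.
    - by rewrite (f_in B).
    - have sr r' : pos r' = z' -> sides r' A B.
        move=> /hp[t tr td]; apply: (sides_same tr); apply: hd.
        by rewrite -ball_normE /= distrC.
      apply/propext; split=> [[_ h]|h]; first exact: h rz' (sr _ rz').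
      split=> [A' Az'|r' A' B' r'z' h']; first by case: (region_notin Az'); exists r.
      by have [-> _] := sides_unique h' (sr _ r'z').
  have fz : f z = (CR A = CR' A) by exact: nbhs_singleton f_near.
  by rewrite fz.
have f_const := punctured_plane_constant f_loc.
have [A0 uA0] := unbounded_region_ex.
have region_pt A : exists2 z, sval A z & ~ (exists c : crossing D, sval c = z).
  have [w nw AE] := svalP A; exists w; first by rewrite AE; exact: connected_component_refl.
  move=> [c cw]; apply: nw; have [p [q [pc _]]] := svalP c.
  by exists p; rewrite // pc.
have [z0 A0z0 nz0] := region_pt A0.
have f0 : f z0 by rewrite (f_in A0) // h1 // h1'.
move=> A; have [z Az nz] := region_pt A.
by rewrite -(f_in A z) // (f_const z z0).
Qed.

End Sides.

(** * Signs of level functions on cones *)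

Section Cone.
Variables (R : realType) (c dc : R -> plane R).
Hypothesis c_derivable : forall s, derivable c s 1.
Hypothesis dcE : derive1 c = dc.
Hypothesis dc_cont : continuous dc.
Hypothesis dc_neq0 : forall s, dc s != 0.

(* A cone at [c s0] around the normal meets the curve near [c s0] only in its *)
(* apex, hence a level function of the curve has constant sign on the cone.   *)
Lemma cone_side s0 (h : plane R -> R) (u kap K : R) (g : R -> plane R) :
  `|u| = 1 -> 0 < kap -> 0 < K ->
  (\forall z \near c s0, h w @[w --> z] --> h z) ->
  (forall d, 0 < d -> \forall z \near c s0, h z = 0 -> exists2 s, `|s - s0| < d & z = c s) ->
  (\forall e \near 0^'+, 0 < u * h (c s0 + (u * e) *: rot90 (dc s0))) ->
  g e @[e --> 0^'+] --> c s0 ->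
  (\forall e \near 0^'+, kap * e <= u * dot (g e - c s0) (rot90 (dc s0)) /\
     `|dot (g e - c s0) (dc s0)| <= K * e) ->
  \forall e \near 0^'+, 0 < u * h (g e).
Proof.
move=> u1 kap0 K0 hcont hzero hnorm gcont gcone.
have Q0 := dot_gt0 (dc_neq0 s0); set Q := dot (dc s0) (dc s0) in Q0.
have uu : u * u = 1.
  by rewrite -expr2 -[RHS](expr1n _ 2) -u1 real_normK // num_real.
pose m := Num.min Q kap; have m0 : 0 < m by rewrite lt_min Q0.
have mQ : m <= Q by rewrite ge_min lexx.
have mk : m <= kap by rewrite ge_min lexx orbT.
(* Chosen so that [eta * (K + m) = m / 2 < m], which contradicts the inequality
   [(1 - eta) * m <= eta * K] that a point of the curve in the cone would give. *)
pose eta := m / (2 * (K + m)).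
have Km : 0 < 2 * (K + m) by lra.
have eta0 : 0 < eta by rewrite divr_gt0.
have etaE : eta * (2 * (K + m)) = m by rewrite /eta divfK // gt_eqF.
have eta1 : eta < 1 by nra.
have [d d0 hd] := frame_near dc_cont dc_neq0 s0 eta0.
have /nbhs_ballP[r /= r0 hr] : \forall z \near c s0, h w @[w --> z] --> h z /\
    (h z = 0 -> exists2 s, `|s - s0| < d & z = c s).
  by apply: filterI => //; exact: hzero.
have nn : \forall e \near 0^'+, `|e *: rot90 (dc s0)| < r.
  have e0 : e *: rot90 (dc s0) @[e --> 0^'+] --> (0 : plane R).
    rewrite -(scale0r (rot90 (dc s0))); apply: cvgZr_tmp.
    by apply: cvg_at_right_filter; exact: cvg_id.
  exact: (cvgr0_norm_lt _ e0 _ r0).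
have ng : \forall e \near 0^'+, `|g e - c s0| < r.
  have e0 : g e - c s0 @[e --> 0^'+] --> (0 : plane R).
    by rewrite -(subrr (c s0)); apply: cvgB => //; exact: cvg_cst.
  exact: (cvgr0_norm_lt _ e0 _ r0).
near=> e.
have e0 : 0 < e by near: e; exact: nbhs_right_gt.
have he : 0 < u * h (c s0 + (u * e) *: rot90 (dc s0)) by near: e.
have [hk hK] : kap * e <= u * dot (g e - c s0) (rot90 (dc s0)) /\
     `|dot (g e - c s0) (dc s0)| <= K * e by near: e.
have ne : `|e *: rot90 (dc s0)| < r by near: e.
have ge : `|g e - c s0| < r by near: e.
(* The segment from a point of the normal, where the sign of h is known, to [g e]. It stays in the
   cone and off the curve, so h has no zero on it. *)
pose w t := (1 - t) *: ((u * e) *: rot90 (dc s0)) + t *: (g e - c s0).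
pose y t := c s0 + w t.
have y0 : y 0 = c s0 + (u * e) *: rot90 (dc s0).
  by rewrite /y /w subr0 scale1r scale0r addr0.
have y1 : y 1 = g e by rewrite /y /w subrr scale0r add0r scale1r addrC subrK.
have wr t : 0 <= t <= 1 -> `|w t| < r.
  move=> t01; apply: (le_lt_trans (ler_normD _ _)).
  have E : `|(u * e) *: rot90 (dc s0)| = `|e *: rot90 (dc s0)|.
    by rewrite -scalerA [LHS]normrZ u1 mul1r.
  rewrite [`|t *: _|]normrZ [`|(1 - t) *: _|]normrZ E.
  have /andP[t0 t1] := t01; have t1' : 0 <= 1 - t by rewrite subr_ge0.
  rewrite (ger0_norm t0) (ger0_norm t1').
  move: (`|e *: _|) (`|g e - _|) ne ge => x x' xr xr'.
  apply: (@le_lt_trans _ _ (Num.max x x')); last by rewrite gt_max xr.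
  have h1 : x <= Num.max x x' by rewrite le_max lexx.
  have h2 : x' <= Num.max x x' by rewrite le_max lexx orbT.
  by move: (Num.max x x') h1 h2 => M h1 h2; nra.
have yr t : 0 <= t <= 1 -> ball (c s0) r (y t).
  by move=> t01; rewrite -ball_normE /= /y opprD addrA subrr add0r normrN wr.
have hy t : 0 <= t <= 1 -> h (y t) != 0.
  move=> t01; apply/eqP => /(hr _ (yr t t01)).2[s sd ys].
  have w1 : m * e <= u * dot (w t) (rot90 (dc s0)).
    rewrite /w dotDl !dotZl dot_rot_rot -/Q.
    have -> : u * ((1 - t) * (u * e * Q) + t * dot (g e - c s0) (rot90 (dc s0))) =
      (1 - t) * (e * Q) * (u * u) + t * (u * dot (g e - c s0) (rot90 (dc s0))) by ring.
    rewrite uu mulr1.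
    move: (u * dot _ _) hk => x hk.
    have : e * m <= e * Q by rewrite ler_pM2l.
    have : m * e <= kap * e by rewrite ler_pM2r.
    nra.
  have w2 : `|dot (w t) (dc s0)| <= K * e.
    rewrite /w dotDl !dotZl [dot (rot90 _) _]dot_rotl dot_rot oppr0 !mulr0 add0r normrM.
    rewrite ger0_norm; last lra.
    have := normr_ge0 (dot (g e - c s0) (dc s0)).
    by move: (`|dot _ _|) hK => x hx x0; nra.
  have wE : w t = c s - c s0 by rewrite -ys /y addrAC subrr add0r.
  have btw x : (s0 <= x <= s) || (s <= x <= s0) -> `|x - s0| < d.
    by move: sd; rewrite !ltr_norml => /andP[? ?] /orP[|] /andP[? ?]; lra.
  have [t1 /btw t1d m1] := mvt_dot c_derivable dcE (dc s0) s0 s.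
  have [t2 /btw t2d m2] := mvt_dot c_derivable dcE (rot90 (dc s0)) s0 s.
  have [f1 _] := hd t1 t1d; have [_ f2] := hd t2 t2d.
  rewrite wE m2 in w1; rewrite wE m1 in w2; move: w1 w2 f1 f2.
  rewrite -/Q.
  move: (dot (dc t1) (dc s0)) (dot (dc t2) (rot90 (dc s0))) (s - s0) => a b x w1 w2 f1 f2.
  have w3 : m * e <= eta * Q * `|x|.
    apply: (le_trans w1); apply: (le_trans (ler_norm _)).
    by rewrite !normrM u1 mul1r ler_wpM2r // ltW.
  have w4 : (1 - eta) * Q * `|x| <= K * e.
    apply: le_trans w2; rewrite normrM ler_wpM2r //.
    by apply: le_trans (ler_norm _); exact: ltW.
  have x0 := normr_ge0 x.
  have w5 : (1 - eta) * (m * e) <= eta * (K * e).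
    apply: (@le_trans _ _ ((1 - eta) * (eta * Q * `|x|))).
      by apply: ler_wpM2l => //; lra.
    have -> : (1 - eta) * (eta * Q * `|x|) = eta * ((1 - eta) * Q * `|x|) by ring.
    by apply: ler_wpM2l => //; exact: ltW.
  have w6 : (1 - eta) * m <= eta * K.
    by rewrite -(ler_pM2r e0); move: w5; rewrite !mulrA.
  lra.
have cy : {within `[0, 1]%classic, continuous (h \o y)}.
  apply: continuous_in_subspaceT => t; rewrite inE /= in_itv /= => t01.
  apply: (@cvg_comp _ _ _ y h _ (nbhs (y t))); last by have [] := hr _ (yr t t01).
  apply: cvgD; first exact: cvg_cst.
  apply: cvgD; first by apply: cvgZr_tmp; apply: cvgB; [exact: cvg_cst|exact: cvg_id].
  by apply: cvgZr_tmp; exact: cvg_id.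
rewrite -y1 ltNge; apply/negP => hn1; rewrite -y0 in he.
have [t] : exists2 t, t \in `[0, 1] & (h \o y) t = 0.
  apply: IVT => //.
  rewrite ge_min le_max /=.
  have [u0|u0] := ltP 0 u.
    have p1 : h (y 1) <= 0 by rewrite -(pmulr_rle0 _ u0).
    have p2 : 0 < h (y 0) by rewrite -(pmulr_rgt0 _ u0).
    by rewrite p1 (ltW p2) orbT.
  have {}u0 : u < 0 by rewrite lt_neqAle u0 andbT; apply/eqP => uz; move: u1; rewrite uz normr0; lra.
  have p1 : 0 <= h (y 1) by rewrite -(nmulr_rle0 _ u0).
  have p2 : h (y 0) < 0 by rewrite -(nmulr_rgt0 _ u0).
  by rewrite p1 (ltW p2) orbT.
by rewrite in_itv /= => t01 /eqP; apply/negP; exact: hy.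
Unshelve. all: by end_near. Qed.

End Cone.

(** * The region coloring of a lift *)

Section Vertex.
Variables (R : realType) (X : biquandle).
Local Notation I := (unit_interval R).
Local Notation ept := (cube_pt (fun (g : As X) x => g * as_gen x)%g).
Implicit Types (g h k : As X) (L : seq (I * X)) (t : I) (x y : X).

Lemma translate_free h (e : EQ R X) : translate h e = e -> h = 1%g.
Proof.
by move=> he; have [U [_ Ue]] := covering_separated e; apply; [exact: Ue|rewrite he].
Qed.

Lemma ept_inj g g' L : ept g L = ept g' L -> g = g'.
Proof.
move=> e; have : translate (g' * g^-1)%g (ept g L) = ept g L by rewrite translate_pt mulgVK.
by move=> /translate_free /(congr1 (fun z => z * g)%g); rewrite mulgVK mul1g.
Qed.

(* The label at the vertex of the cube nearest to L; n is the recursion fuel. *)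
Fixpoint vertex_rec n g L : As X :=
  if n is n'.+1 then
    if L is (t, x) :: L' then
      if set_val t < 1 / 2 then vertex_rec n' g L'
      else vertex_rec n' (g * as_gen x)%g (recolor (fun z => bov z x) L')
    else g
  else g.

Definition vertex g L := vertex_rec (size L) g L.

Lemma vertex_cons g t x L : vertex g ((t, x) :: L) =
  if set_val t < 1 / 2 then vertex g L
  else vertex (g * as_gen x)%g (recolor (fun z => bov z x) L).
Proof. by rewrite /vertex /= size_map. Qed.

Definition at_end t := set_val t = 0 \/ set_val t = 1.

Lemma insideN t : ~ inside t -> at_end t.
Proof. by case: (unit_interval_cases t) => // h; [left|right]. Qed.

Lemma vertex_corner g L : (forall p, List.In p L -> at_end p.1) ->
  ept g L = ept (vertex g L) [::].
Proof.
elim/weight_ind: L g => [//|t x L IH] g hL; rewrite vertex_cons.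
have h0 : (0 : R) < 1 / 2 by lra.
have h1 : ((1 : R) < 1 / 2) = false by apply/negbTE; rewrite -leNgt; lra.
have [t0|t1] := hL (t, x) (or_introl erefl); rewrite /= in t0 || rewrite /= in t1.
- rewrite t0 h0 -IH //; last by move=> p pL; apply: hL; right.
  by apply: cube_pt_rel; exact: (CubeFace0 _ _ [::]).
- rewrite t1 h1 -IH ?size_map //; last first.
    by move=> p /List.in_map_iff[q [<- qL]]; apply: (hL q); right.
  by apply: cube_pt_rel; exact: (CubeFace1 _ _ [::]).
Qed.

(** Where the over-coordinate is 0 or 1 the square collapses to the cell of its under-strand. The
    label [g0] precedes t, so one label serves the whole edge, and [vertex] is compatible with the
    collapse. *)
Lemma under_end g t x o y : at_end o -> exists g0, forall t,
  let x0 := if set_val o == 0 then x else bun x y in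
  ept g [:: (t, x); (o, y)] = ept g0 [:: (t, x0)] /\
  vertex g [:: (t, x); (o, y)] = vertex g0 [:: (t, x0)].
Proof.
have h0 : (0 : R) < 1 / 2 by lra.
have h1 : ((1 : R) < 1 / 2) = false by apply/negbTE; rewrite -leNgt; lra.
case=> o0.
- exists g => t'; rewrite o0 eqxx; split.
    by apply: cube_pt_rel; exact: (CubeFace0 _ _ [:: (t', x)] _ [::]).
  by rewrite !vertex_cons /= ?vertex_cons o0 h0.
- exists (g * as_gen y)%g => t'; rewrite o0 oner_eq0; split.
    by apply: cube_pt_rel; exact: (CubeFace1 _ _ [:: (t', x)] _ [::]).
  rewrite !vertex_cons /= ?vertex_cons o0 h1.
  by rewrite -!mulgA as_relator.
Qed.

Lemma over_end g u x t y : at_end u -> exists g0, forall t,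
  let y0 := if set_val u == 0 then y else bov y x in
  ept g [:: (u, x); (t, y)] = ept g0 [:: (t, y0)] /\
  vertex g [:: (u, x); (t, y)] = vertex g0 [:: (t, y0)].
Proof.
have h0 : (0 : R) < 1 / 2 by lra.
have h1 : ((1 : R) < 1 / 2) = false by apply/negbTE; rewrite -leNgt; lra.
case=> u0.
- exists g => t'; rewrite u0 eqxx; split.
    by apply: cube_pt_rel; exact: (CubeFace0 _ _ [::]).
  by rewrite vertex_cons u0 h0.
- exists (g * as_gen x)%g => t'; rewrite u0 oner_eq0; split.
    by apply: cube_pt_rel; exact: (CubeFace1 _ _ [::]).
  by rewrite vertex_cons u0 h1.
Qed.

End Vertex.

(** * Labels of a lift on the regions *)

Section Lift.
Variables (R : realType) (D : diagram R) (N : bicollar D).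
Variables (X : biquandle) (C : coloring X D).
Local Notation I := (unit_interval R).
Local Notation ept := (cube_pt (fun (g : As X) x => g * as_gen x)%g).
Implicit Types (g h k : As X) (L : seq (I * X)) (z w : plane R) (s : semiarc D)
  (c : crossing D) (p q r : strand D).

Lemma dual_lift_ex : exists f : sphere_map R (EQ0 R X),
  forall v, covering (f v) = dual_map N C v.
Proof.
have [M hM] := support_bounded N.
pose F := SphereMap (@dual_map_continuous R D N X C) erefl.
apply: (sphere_lift_ex (covering_covering_map R X) (covering_base R X) (F := F) (M := M)).
move=> z hz; apply: dual_map_out => /hM; rewrite prod_normE /= ge_max => /andP[h1 h2].
by case: hz => h; lra.
Qed.

Variable f : sphere_map R (EQ0 R X).
Hypothesis fE : forall v, covering (f v) = dual_map N C v.
Let F z : EQ R X := f (Some z).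

Lemma F_continuous : continuous F.
Proof.
move=> z; apply: (@cvg_comp _ _ _ (Some : plane R -> sphere R) f _ (nbhs (Some z : sphere R))).
  exact: one_point_compactification_some_continuous.
exact: smap_continuous.
Qed.

(** The possible coordinates and colors of the image of z. There may be several: strips may touch
    each other and the sides of boxes. *)
Inductive chart z : seq (I * X) -> Prop :=
| ChartStrip s : strip N s z -> chart z [:: (height N s z, C s)]
| ChartBox c p q s1 s2 : crossing_at (sval c) p q -> box N c z ->
    behind p q s1 -> behind q p s2 ->
    chart z [:: (uheight N c z, C s1); (oheight N c z, C s2)]
| ChartOut : ~ Defs.support N z -> chart z [::].

Lemma chart_strip_or_box z : Defs.support N z ->
  (exists s, strip N s z) \/ (exists c, box N c z).
Proof. by rewrite Defs.supportE => -[[s _ sz]|[c _ cz]]; [left; exists s|right; exists c]. Qed.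

Lemma box_strands c : exists p q s1 s2, [/\ crossing_at (sval c) p q,
  behind p q s1 & behind q p s2].
Proof.
have [p [q cpq]] := svalP c.
have [s1 b1] := behind_ex cpq.2.1; have [s2 b2] := behind_ex (double_sym cpq.2.1).
by exists p, q, s1, s2.
Qed.

Lemma chart_ex z : exists L, chart z L.
Proof.
have [/chart_strip_or_box[[s sz]|[c cz]]|nz] := pselect (Defs.support N z).
- by exists [:: (height N s z, C s)]; constructor.
- have [p [q [s1 [s2 [cpq b1 b2]]]]] := box_strands c.
  exists [:: (uheight N c z, C s1); (oheight N c z, C s2)].
  exact: (ChartBox cpq).
- by exists [::]; constructor.
Qed.

Lemma chart_dual z L : chart z L -> dual_map N C (Some z) = bpt L.
Proof.
case=> [s sz|c p q s1 s2 cpq bz b1 b2|nz].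
- exact: dual_map_strip.
- by apply: dual_mapE; right; exists c, p, q, s1, s2.
- exact: dual_map_out.
Qed.

Lemma chart_lift z L : chart z L -> exists g, F z = ept g L.
Proof. by move=> /chart_dual zL; apply: covering_fiber; rewrite /F fE zL. Qed.

Lemma strip_box_chart z s c p q s1 s2 : crossing_at (sval c) p q -> box N c z ->
  behind p q s1 -> behind q p s2 -> strip N s z ->
  let x1 := C s1 in let x2 := C s2 in
  (at_end (oheight N c z) /\ (behind p q s \/ ahead p q s) /\
   height N s z = uheight N c z /\
   forall g, exists g0, forall t : I,
     ept g [:: (t, x1); (oheight N c z, x2)] = ept g0 [:: (t, C s)] /\
     vertex g [:: (t, x1); (oheight N c z, x2)] = vertex g0 [:: (t, C s)]) \/
  (at_end (uheight N c z) /\ (behind q p s \/ ahead q p s) /\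
   height N s z = oheight N c z /\
   forall g, exists g0, forall t : I,
     ept g [:: (uheight N c z, x1); (t, x2)] = ept g0 [:: (t, C s)] /\
     vertex g [:: (uheight N c z, x1); (t, x2)] = vertex g0 [:: (t, C s)]).
Proof.
move=> cpq bz b1 b2 sz /=; have [_ pq] := cpq.
have [s3 a3] := ahead_ex pq.1; have [s4 a4] := ahead_ex (double_sym pq.1).
have [c3 c4] := colorP C pq b1 b2 a3 a4.
have un r (s' s'' : semiarc D) u : germ r u s' -> germ r u s'' -> s' = s''.
  exact: (germ_eq (@same_crossing _ _) (same_refl r)).
case: (strip_box cpq bz sz) => -[bs hh hE].
- left; split; first by left.
  split; first by left.
  split=> // g; have [g0 hg0] := under_end g (oheight N c z) (C s1) (C s2) (or_introl hh).
  by exists g0 => t; have := hg0 t; rewrite hh eqxx (un _ _ _ _ bs b1).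
- left; split; first by right.
  split; first by right.
  split=> // g; have [g0 hg0] := under_end g (oheight N c z) (C s1) (C s2) (or_intror hh).
  by exists g0 => t; have := hg0 t; rewrite hh oner_eq0 c3 (un _ _ _ _ bs a3).
- right; split; first by left.
  split; first by left.
  split=> // g; have [g0 hg0] := over_end g (C s1) (oheight N c z) (C s2) (or_introl hh).
  by exists g0 => t; have := hg0 t; rewrite hh eqxx (un _ _ _ _ bs b2).
- right; split; first by right.
  split; first by right.
  split=> // g; have [g0 hg0] := over_end g (C s1) (oheight N c z) (C s2) (or_intror hh).
  by exists g0 => t; have := hg0 t; rewrite hh oner_eq0 c4 (un _ _ _ _ bs a4).
Qed.

Lemma strip_box_vertex z s c p q s1 s2 g g' : crossing_at (sval c) p q -> box N c z ->
  behind p q s1 -> behind q p s2 -> strip N s z ->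
  let L := [:: (uheight N c z, C s1); (oheight N c z, C s2)] in
  let L' := [:: (height N s z, C s)] in
  ept g L = ept g' L' -> vertex g L = vertex g' L'.
Proof.
move=> cpq bz b1 b2 sz /= e.
have [[_ [_ [hE /(_ g)[g0 hg]]]]|[_ [_ [hE /(_ g)[g0 hg]]]]] :=
  strip_box_chart cpq bz b1 b2 sz.
- have [e1 ->] := hg (uheight N c z); rewrite hE in e *.
  by rewrite -(ept_inj (etrans (esym e) e1)).
- have [e1 ->] := hg (oheight N c z); rewrite hE in e *.
  by rewrite -(ept_inj (etrans (esym e) e1)).
Qed.

(** Different charts at a point overlap only where some coordinate is 0 or 1; there the larger cube
    collapses to the smaller one, or both collapse to a vertex. *)
Lemma chart_vertex z L L' g g' : chart z L -> chart z L' -> ept g L = ept g' L' ->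
  vertex g L = vertex g' L'.
Proof.
case=> [s sz|c p q s1 s2 cpq bz b1 b2|nz];
  case=> [s' sz'|c' p' q' s1' s2' cpq' bz' b1' b2'|nz'] e.
- have corner (s0 : semiarc D) g0 : ~ inside (height N s0 z) ->
      ept g0 [:: (height N s0 z, C s0)] = ept (vertex g0 [:: (height N s0 z, C s0)]) [::].
    by move=> n; apply: vertex_corner => p [<-|//]; exact: insideN.
  have [hs|hs] := pselect (inside (height N s z)).
    by have ss := strip_disjoint sz sz' hs; subst s'; rewrite (ept_inj e).
  have [hs'|hs'] := pselect (inside (height N s' z)).
    by have ss := strip_disjoint sz' sz hs'; subst s'; rewrite (ept_inj e).
  by apply: (@ept_inj R X _ _ [::]); rewrite -!corner.
- by symmetry; exact: (strip_box_vertex cpq' bz' b1' b2' sz (esym e)).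
- by case: nz'; rewrite Defs.supportE; left; exists s.
- exact: (strip_box_vertex cpq bz b1 b2 sz' e).
- have cc := box_disjoint bz bz'; subst c'.
  have [pp qq] := crossing_at_unique cpq cpq'.
  rewrite -(behind_unique pp qq b1 b1') -(behind_unique qq pp b2 b2') in e *.
  by rewrite (ept_inj e).
- by case: nz'; rewrite Defs.supportE; right; exists c.
- by case: nz; rewrite Defs.supportE; left; exists s'.
- by case: nz; rewrite Defs.supportE; right; exists c'.
- by rewrite (ept_inj e).
Qed.

(** Within K the points [ept g (P w)] form a second lift of the same map, so [lift_near] applies. *)
Lemma near_sheet (K : set (plane R)) z (P : plane R -> seq (I * X)) g :
  ept g (P w) @[w --> within K (nbhs z)] --> ept g (P z) ->
  (forall w, K w -> chart w (P w)) -> F z = ept g (P z) ->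
  \forall w \near z, K w -> F w = ept g (P w).
Proof.
move=> hP hK Fz.
have hF : F w @[w --> within K (nbhs z)] --> F z.
  exact: cvg_within_filter (@F_continuous z).
have := @lift_near _ _ _ (covering_covering_map R X) _ _ (within_filter K (nbhs_filter z)) _ _ _ _ hF hP.
rewrite !near_withinE Fz => h.
have {}h := h erefl; apply: filterS (h _).
  by move=> w hw Kw; rewrite hw.
by apply: filterE => w Kw; rewrite /F fE (chart_dual (hK w Kw)) covering_pt.
Qed.

Lemma strip_closed s : closed (strip N s).
Proof. by apply: compact_closed; [exact: norm_hausdorff|exact: strip_compact]. Qed.

Lemma box_closed c : closed (box N c).
Proof. by apply: compact_closed; [exact: norm_hausdorff|exact: box_compact]. Qed.

Lemma closed_near (K : set (plane R)) z : closed K -> ~ K z -> \forall w \near z, ~ K w.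
Proof.
move=> cK nKz; have h : open_nbhs z (~` K) by split=> //; exact: closed_openC.
exact: open_nbhs_nbhs h.
Qed.

Lemma strip_height_cvg s z : strip N s z ->
  height N s w @[w --> within (strip N s) (nbhs z)] --> height N s z.
Proof. by move=> sz; have /subspace_continuousP := @height_continuous _ _ N s; apply. Qed.

Lemma box_height_cvg c z : box N c z ->
  uheight N c w @[w --> within (box N c) (nbhs z)] --> uheight N c z /\
  oheight N c w @[w --> within (box N c) (nbhs z)] --> oheight N c z.
Proof.
move=> cz; have hc : (uheight N c w, oheight N c w) @[w --> within (box N c) (nbhs z)]
      --> (uheight N c z, oheight N c z).
  by have /subspace_continuousP := @box_continuous _ _ N c; apply.
by split; [exact: cvg_comp hc (@cvg_fst _ _ _ _ _)|exact: cvg_comp hc (@cvg_snd _ _ _ _ _)].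
Qed.

Lemma near_strip s z g : strip N s z -> F z = ept g [:: (height N s z, C s)] ->
  \forall w \near z, strip N s w -> F w = ept g [:: (height N s w, C s)].
Proof.
move=> sz; apply: (near_sheet (P := fun w => [:: (height N s w, C s)])) => [|w sw].
  apply: (@cube_pt_cvg R X (As X) _ _ _ _ g z [:: (height N s, C s)]) => i.
  by rewrite ord1; exact: strip_height_cvg.
exact: ChartStrip.
Qed.

Lemma near_box c p q s1 s2 z g : crossing_at (sval c) p q -> box N c z ->
  behind p q s1 -> behind q p s2 ->
  F z = ept g [:: (uheight N c z, C s1); (oheight N c z, C s2)] ->
  \forall w \near z, box N c w ->
    F w = ept g [:: (uheight N c w, C s1); (oheight N c w, C s2)].
Proof.
move=> cpq cz b1 b2.
apply: (near_sheet (P := fun w => [:: (uheight N c w, C s1); (oheight N c w, C s2)])) => [|w cw].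
  have [hu ho] := box_height_cvg cz.
  apply: (@cube_pt_cvg R X (As X) _ _ _ _ g z
    [:: (uheight N c, C s1); (oheight N c, C s2)]) => i.
  by case: i => [[|[|//]] ?].
exact: (ChartBox cpq).
Qed.

Lemma near_out z g : F z = ept g [::] ->
  \forall w \near z, ~ Defs.support N w -> F w = ept g [::].
Proof.
move=> Fz; apply: (near_sheet (K := ~` Defs.support N) (P := fun=> [::])) => //.
  exact: cvg_cst.
by move=> w nw; exact: ChartOut.
Qed.

(* Off the image of D, [gam z] holds of exactly one label, which is locally   *)
(* constant in z.                                                             *)
Definition gam z k := exists L g, [/\ chart z L, F z = ept g L & k = vertex g L].

Lemma gam_ex z : exists k, gam z k.
Proof.
by have [L zL] := chart_ex z; have [g gz] := chart_lift zL; exists (vertex g L), L, g.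
Qed.

Lemma gam_unique z k k' : gam z k -> gam z k' -> k = k'.
Proof.
move=> [L [g [zL Fz ->]]] [L' [g' [zL' Fz' ->]]].
by apply: (chart_vertex zL zL'); rewrite -Fz.
Qed.

Lemma gam_chart z k L g : gam z k -> chart z L -> F z = ept g L -> k = vertex g L.
Proof. by move=> zk zL Fz; apply: (gam_unique zk); exists L, g. Qed.

Lemma lt_half_near (K : set (plane R)) z (h : plane R -> I) :
  h w @[w --> within K (nbhs z)] --> h z -> set_val (h z) <> 1 / 2 ->
  \forall w \near z, K w -> (set_val (h w) < 1 / 2) = (set_val (h z) < 1 / 2).
Proof.
move=> hc hz.
have hc' : set_val (h w) @[w --> within K (nbhs z)] --> set_val (h z).
  by apply: (@cvg_comp _ _ _ h set_val _ (nbhs (h z))) => //; exact: initial_continuous.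
have [lt|gt|//] := ltgtP (set_val (h z)) (1 / 2).
  exact: hc' (lt_nbhsl lt).
have : within K (nbhs z) [set w | 1 / 2 < set_val (h w)] by exact: hc' (lt_nbhsr gt).
by rewrite /within /=; apply: filterS => w hw Kw; apply/negbTE; rewrite -leNgt ltW // hw.
Qed.

Lemma strip_half s z : strip N s z -> set_val (height N s z) = 1 / 2 ->
  Defs.trace s z.
Proof.
move=> sz hz; have ins : inside (height N s z) by rewrite /inside hz; lra.
have [hfun hinj hsurj] := strip_bij N s.
have [/= [sf tf] _] := hfun z (conj sz ins).
have [ff hf] := strip_core sf tf.
suff -> : z = foot N s z by [].
have insf : inside (height N s (foot N s z)) by rewrite /inside hf; lra.
apply: (hinj z (foot N s z) (mem_set (conj sz ins)) (mem_set (conj sf insf))).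
by rewrite ff; congr pair; apply: val_inj; rewrite [LHS]hz [RHS]hf.
Qed.

Lemma trace_image s z : Defs.trace s z -> Defs.image D z.
Proof. by move=> [p _ <-]; exists p. Qed.

(** Off the diagram no coordinate of a chart equals 1/2, the value at which [vertex] changes, so
    nearby points round to the same vertex. *)
Lemma gam_near z k : ~ Defs.image D z -> gam z k -> \forall w \near z, gam w k.
Proof.
move=> nz zk.
have hstrip : \forall w \near z, forall s, strip N s w -> gam w k.
  apply: near_finite => [|s]; first exact: semiarc_finite.
  have [sz|sz] := pselect (strip N s z); last first.
    by apply: filterS (closed_near (@strip_closed s) sz) => w nw /nw.
  have [g Fz] := chart_lift (ChartStrip sz).
  have kE := gam_chart zk (ChartStrip sz) Fz.
  have h2 : set_val (height N s z) <> 1 / 2.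
    by move=> /(strip_half sz)/trace_image.
  apply: filterS2 (near_strip sz Fz) (lt_half_near (strip_height_cvg sz) h2) => w h1 h3 sw.
  exists [:: (height N s w, C s)], g; split; [exact: ChartStrip|exact: h1|].
  by rewrite kE !vertex_cons h3.
have hbox : \forall w \near z, forall c, box N c w -> gam w k.
  apply: near_finite => [|c]; first exact: crossing_set_finite.
  have [cz|cz] := pselect (box N c z); last first.
    by apply: filterS (closed_near (@box_closed c) cz) => w nw /nw.
  have [p [q [s1 [s2 [cpq b1 b2]]]]] := box_strands c.
  have zL := ChartBox cpq cz b1 b2; have [g Fz] := chart_lift zL.
  have kE := gam_chart zk zL Fz; have [cu co] := box_height_cvg cz.
  have hu : set_val (uheight N c z) <> 1 / 2.
    by move=> /(box_under cpq cz)[r _ rz]; apply: nz; exists r.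
  have ho : set_val (oheight N c z) <> 1 / 2.
    by move=> /(box_over cpq cz)[r _ rz]; apply: nz; exists r.
  apply: filterS3 (near_box cpq cz b1 b2 Fz) (lt_half_near cu hu) (lt_half_near co ho).
  move=> w h1 h3 h4 cw.
  exists [:: (uheight N c w, C s1); (oheight N c w, C s2)], g.
  split; [exact: (ChartBox cpq)|exact: h1|].
  by rewrite kE !vertex_cons /= ?vertex_cons h3 // h4.
have hout : \forall w \near z, ~ Defs.support N w -> gam w k.
  have [zi|zi] := pselect (nbhs z (Defs.support N)); first by apply: filterS zi.
  (* On the frontier of the support, as outside it, no coordinate is strictly between 0 and 1, so
     the lift is already at a vertex. *)
  have Fz : F z = ept k [::].
    have [Sz|nSz] := pselect (Defs.support N z); last first.
      have [g Fz] := chart_lift (ChartOut nSz).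
      by rewrite (gam_chart zk (ChartOut nSz) Fz).
    have [[s sz]|[c cz]] := chart_strip_or_box Sz.
      have [g Fz] := chart_lift (ChartStrip sz).
      rewrite (gam_chart zk (ChartStrip sz) Fz) Fz; apply: vertex_corner => p [<-|//] /=.
      by apply: insideN => ins; apply: zi; exact: strip_interior ins.
    have [p [q [s1 [s2 [cpq b1 b2]]]]] := box_strands c.
    have zL := ChartBox cpq cz b1 b2; have [g Fz] := chart_lift zL.
    rewrite (gam_chart zk zL Fz) Fz; apply: vertex_corner => r [<-|[<-|//]] /=.
      by apply: insideN => ins; apply: zi; apply: box_interior cz _; left.
    by apply: insideN => ins; apply: zi; apply: box_interior cz _; right.
  apply: filterS (near_out Fz) => w h nw; exists [::], k.
  by split; [exact: ChartOut|exact: h|].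
near=> w.
have [/chart_strip_or_box[[s sw]|[c cw]]|nw] := pselect (Defs.support N w).
- exact: (near hstrip w _ s).
- exact: (near hbox w _ c).
- exact: (near hout w).
Unshelve. all: by end_near. Qed.

Definition region_gam (A : region D) : As X := xget 1%g [set k | exists2 z, sval A z & gam z k].

Lemma region_gamE (A : region D) z k : sval A z -> gam z k -> region_gam A = k.
Proof.
move=> Az zk; pose gm w := xget 1%g (gam w).
have gmE w k' : gam w k' -> gm w = k'.
  by move=> wk'; rewrite /gm; case: xgetP => [k0 _ wk0|/(_ k') //]; exact: gam_unique wk0 wk'.
rewrite /region_gam; case: xgetP => [k' _ [w Aw wk']|/(_ k)]; last by case; exists z.
rewrite -(gmE _ _ zk) -(gmE _ _ wk').
apply: (@connected_locally_constant _ _ (sval A) gm _ _ w z) => // [|v Av].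
  exact: region_connected.
have [k0 vk0] := gam_ex v.
apply: filterS (gam_near (region_notin Av) vk0) => u uk0 _.
by rewrite (gmE _ _ uk0) (gmE _ _ vk0).
Qed.

(** By continuity at infinity the lift is the base vertex far away and off the support, and A
    contains such points. *)
Lemma region_gam_unbounded (A : region D) : ~ bounded_set (sval A) -> region_gam A = 1%g.
Proof.
move=> uA.
have F0 : f None = ept 1%g [::] by exact: smap_base.
have hn : \forall v \near (None : sphere R), (forall w : plane R, v = Some w ->
    ~ Defs.support N w) -> f v = ept 1%g [::].
  have hP : (fun _ : sphere R => ept 1%g [::] : EQ R X) v
     @[v --> within [set v | forall w : plane R, v = Some w -> ~ Defs.support N w] (nbhs (None : sphere R))]
     --> (ept 1%g [::] : EQ R X) by apply: cvg_cst; exact: within_filter.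
  have hF : f v @[v --> within [set v | forall w : plane R, v = Some w -> ~ Defs.support N w]
      (nbhs (None : sphere R))] --> f None.
    exact: cvg_within_filter (@smap_continuous _ _ _ f None).
  have := @lift_near _ _ _ (covering_covering_map R X) _ _ (within_filter _ (nbhs_filter _)) _ _ _ _ hF hP.
  rewrite !near_withinE F0 => h.
  have {}h := h erefl; apply: filterS (h _).
    by move=> w hw Kw; rewrite hw.
  apply: filterE => -[w|] Kw; rewrite fE covering_pt //.
  by rewrite (chart_dual (ChartOut (Kw w erefl))).
have [K [cK _] hK] := hn.
have [M [Mr hM]] := compact_bounded cK.
have [M' hM'] := support_bounded N.
have [z Az zM] : exists2 z, sval A z & Num.max (M + 1) M' < `|z|.
  apply: contrapT => nA; apply: uA; exists (Num.max (M + 1) M'); split; first exact: num_real.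
  move=> x Mx z Az /=; apply: ltW; apply: le_lt_trans Mx; rewrite leNgt; apply/negP => zM.
  by apply: nA; exists z.
have nS : ~ Defs.support N z.
  by move=> /hM' zM'; move: zM; rewrite ltNge le_max zM' orbT.
have Fz : F z = ept 1%g [::].
  apply: (hK (Some z)); last by move=> w [<-].
  left; exists z => // Kz; have := hM (M + 1); have MM : M < M + 1 by lra.
  by move=> /(_ MM z Kz) /= zM'; move: zM; rewrite ltNge le_max zM'.
apply: (region_gamE Az); exists [::], 1%g.
by split; [exact: ChartOut|exact: Fz|].
Qed.

End Lift.

(** * The jump of the labels across a strip *)

Section LiftSides.
Variables (R : realType) (D : diagram R) (N : bicollar D).
Variables (X : biquandle) (C : coloring X D).
Local Notation I := (unit_interval R).
Local Notation ept := (cube_pt (fun (g : As X) x => g * as_gen x)%g).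
Variable f : sphere_map R (EQ0 R X).
Hypothesis fE : forall v, covering (f v) = dual_map N C v.
Let F (z : plane R) : EQ R X := f (Some z).
Local Notation gam := (gam N C f).
Local Notation region_gam := (region_gam N C f).
Implicit Types (g h k : As X) (L : seq (I * X)) (z w : plane R) (s : semiarc D)
  (c : crossing D) (p q r : strand D) (A B : region D).

Definition signed (b : bool) (e : R) : R := if b then e else - e.

Lemma sided_path_cvg p (b : bool) :
  pos p + signed b e *: normal p @[e --> 0^'+] --> pos p.
Proof.
have e0 : e @[e --> 0^'+] --> (0 : R) by apply: cvg_at_right_filter; exact: cvg_id.
have u0 : signed b e @[e --> 0^'+] --> (0 : R).
  by case: b => //=; rewrite -[X in _ --> X]oppr0; exact: cvgN.
have pE : pos p = pos p + 0 *: normal p by rewrite scale0r addr0.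
rewrite {2}pE; apply: cvgD; first exact: cvg_cst.
exact: cvgZr_tmp.
Qed.

Lemma sided_near p b (P : set (plane R)) : nbhs (pos p) P ->
  \forall e \near 0^'+, P (pos p + signed b e *: normal p).
Proof. by move=> nP; have h := @sided_path_cvg p b; exact: (h _ nP). Qed.

Lemma sided_normal (K : set (plane R)) (h : plane R -> I) p b :
  (\forall e \near 0^'+, (K (pos p + e *: normal p) -> 1 / 2 < set_val (h (pos p + e *: normal p))) /\
     (K (pos p - e *: normal p) -> set_val (h (pos p - e *: normal p)) < 1 / 2)) ->
  \forall e \near 0^'+, K (pos p + signed b e *: normal p) ->
    (set_val (h (pos p + signed b e *: normal p)) < 1 / 2) = ~~ b.
Proof.
apply: filterS => e [h1 h2]; rewrite /signed; case: b => Kw.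
  by apply/negbTE; rewrite -leNgt ltW // h1.
by rewrite scaleNr in Kw *; rewrite h2.
Qed.

Lemma gam_sides p A B (k : bool -> As X) : sides p A B ->
  (forall b, \forall e \near 0^'+, gam (pos p + signed b e *: normal p) (k b)) ->
  region_gam A = k false /\ region_gam B = k true.
Proof.
move=> hs hk; have h1 := hk false; have h2 := hk true.
have h : \forall e \near (0 : R)^'+, region_gam A = k false /\ region_gam B = k true.
  near=> e.
  have [Ae Be] : sval A (pos p - e *: normal p) /\ sval B (pos p + e *: normal p) by near: e.
  have g1 : gam (pos p + signed false e *: normal p) (k false) by near: e.
  have g2 : gam (pos p + signed true e *: normal p) (k true) by near: e.
  by split; [apply: (region_gamE fE Ae); rewrite -scaleNr|apply: (region_gamE fE Be); exact: g2].
by have [] := @filter_ex _ _ (at_right_proper_filter 0) _ h.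
Unshelve. all: by end_near. Qed.

Lemma strip_side p s g b : sval s p -> strip N s (pos p) ->
  F (pos p) = ept g [:: (height N s (pos p), C s)] ->
  \forall e \near 0^'+, gam (pos p + signed b e *: normal p)
    (if b then (g * as_gen (C s))%g else g).
Proof.
move=> sp szp Fp; have np := piece_notin (@same_crossing _ _) sp.
have tp : Defs.trace s (pos p) by exists p.
have [_ hp] := strip_core szp tp.
have ins : inside (height N s (pos p)) by rewrite /inside hp; lra.
have nS : \forall w \near pos p, Defs.support N w by exact: strip_interior ins.
have nstrip : \forall w \near pos p, forall s', strip N s' w -> strip N s' (pos p).
  apply: near_finite => [|s']; first exact: semiarc_finite.
  have [sz'|sz'] := pselect (strip N s' (pos p)); first by apply: filterE.
  by apply: filterS (closed_near (@strip_closed _ _ N s') sz') => w nw /nw.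
have hE (t : I) : vertex g [:: (t, C s)] = if ~~ (set_val t < 1 / 2) then (g * as_gen (C s))%g else g.
  by rewrite vertex_cons; case: ifP.
(* A side of a box may pass through [pos p]. There one coordinate of the box is 0 or 1 and keeps its
   rounding nearby, while the other is the height 1/2 and changes side exactly as the normal
   prescribes. *)
have nbox : \forall e \near 0^'+, forall c, box N c (pos p + signed b e *: normal p) ->
    gam (pos p + signed b e *: normal p) (if b then (g * as_gen (C s))%g else g).
  apply: near_finite => [|c]; first exact: crossing_set_finite.
  have [cz|cz] := pselect (box N c (pos p)); last first.
    have hn := @sided_near p b _ (closed_near (@box_closed _ _ N c) cz).
    by apply: filterS hn => e nw /nw.
  have [p' [q' [s1 [s2 [cpq b1 b2]]]]] := box_strands c.
  have zL := ChartBox C cpq cz b1 b2; have [g2 Fp2] := chart_lift fE zL.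
  have hb := @sided_near p b _ (near_box fE cpq cz b1 b2 Fp2).
  have [cu co] := box_height_cvg cz.
  have [[ho [_ [hh /(_ g2)[g0 hg0]]]]|[hu [_ [hh /(_ g2)[g0 hg0]]]]] :=
    strip_box_chart C cpq cz b1 b2 szp.
  - have g0g : g0 = g.
      have [e1 _] := hg0 (uheight N c (pos p)).
      by apply: (@ept_inj R X _ _ [:: (height N s (pos p), C s)]); rewrite -Fp (Fp2 : F (pos p) = _) e1 hh.
    have [r rcore rz] : (@pos R D @` core (box N c) p') (pos p).
      by apply/(box_under cpq cz); rewrite -hh.
    have pr := simple_same np rz.
    have := box_under_normal cpq rcore.
    rewrite -(same_normal pr) rz => hn.
    have ho2 : set_val (oheight N c (pos p)) <> 1 / 2 by case: ho => ->; lra.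
    have hn2 := @sided_near p b _ (lt_half_near co ho2).
    apply: filterS3 hb hn2 (sided_normal b hn) => e hb' hn2' hn' cw.
    exists [:: (uheight N c (pos p + signed b e *: normal p), C s1);
               (oheight N c (pos p + signed b e *: normal p), C s2)], g2.
    split; [exact: (ChartBox C cpq)|exact: hb'|].
    have [_] := hg0 (uheight N c (pos p + signed b e *: normal p)).
    rewrite g0g hE hn' // negbK => <-.
    by rewrite !vertex_cons /= ?vertex_cons hn2'.
  - have g0g : g0 = g.
      have [e1 _] := hg0 (oheight N c (pos p)).
      by apply: (@ept_inj R X _ _ [:: (height N s (pos p), C s)]); rewrite -Fp (Fp2 : F (pos p) = _) e1 hh.
    have [r rcore rz] : (@pos R D @` core (box N c) q') (pos p).
      by apply/(box_over cpq cz); rewrite -hh.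
    have pr := simple_same np rz.
    have := box_over_normal cpq rcore.
    rewrite -(same_normal pr) rz => hn.
    have hu2 : set_val (uheight N c (pos p)) <> 1 / 2 by case: hu => ->; lra.
    have hn2 := @sided_near p b _ (lt_half_near cu hu2).
    apply: filterS3 hb hn2 (sided_normal b hn) => e hb' hn2' hn' cw.
    exists [:: (uheight N c (pos p + signed b e *: normal p), C s1);
               (oheight N c (pos p + signed b e *: normal p), C s2)], g2.
    split; [exact: (ChartBox C cpq)|exact: hb'|].
    have [_] := hg0 (oheight N c (pos p + signed b e *: normal p)).
    rewrite g0g hE hn' // negbK => <-.
    by rewrite !vertex_cons /= ?vertex_cons hn2'.
have hsn := sided_normal b (strip_normal sp szp).
have hS := @sided_near p b _ nS; have hst := @sided_near p b _ nstrip.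
have hF := @sided_near p b _ (near_strip fE szp Fp).
near=> e.
have Sw : Defs.support N (pos p + signed b e *: normal p) by near: e.
have [[s' sw]|[c cw]] := chart_strip_or_box Sw; last exact: (near nbox e _ c).
have stw : forall s', strip N s' (pos p + signed b e *: normal p) -> strip N s' (pos p) by near: e.
have ss := strip_disjoint szp (stw _ sw) ins; subst s'.
exists [:: (height N s (pos p + signed b e *: normal p), C s)], g.
split; first exact: ChartStrip.
  have hFe : strip N s (pos p + signed b e *: normal p) ->
    f (Some (pos p + signed b e *: normal p)) = ept g [:: (height N s (pos p + signed b e *: normal p), C s)].
    by near: e.
  exact: hFe.
have hse : strip N s (pos p + signed b e *: normal p) ->
  (set_val (height N s (pos p + signed b e *: normal p)) < 1 / 2) = ~~ b by near: e.
by rewrite hE hse // negbK.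
Unshelve. all: by end_near. Qed.

Lemma strip_sides p s g A B : sval s p -> strip N s (pos p) ->
  F (pos p) = ept g [:: (height N s (pos p), C s)] -> sides p A B ->
  region_gam A = g /\ region_gam B = (g * as_gen (C s))%g.
Proof.
move=> sp szp Fp hs.
apply: (gam_sides (k := fun b => if b then (g * as_gen (C s))%g else g) hs) => b.
exact: strip_side.
Qed.

End LiftSides.

(** * Heights of a box near its crossing *)

Section BoxGeometry.
Variables (R : realType) (D : diagram R) (N : bicollar D).
Implicit Types (z w : plane R) (c : crossing D) (p q r : strand D).

Lemma transverse_sign p q (h : plane R -> R) (tau : R) :
  pos p = pos q -> dot (vel p) (normal q) != 0 -> `|tau| = 1 ->
  (\forall z \near pos q, h w @[w --> z] --> h z) ->
  (forall d, 0 < d -> \forall z \near pos q, h z = 0 ->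
    exists2 s, `|s - q.2| < d & z = pos_of q.1 s) ->
  (forall b, \forall e \near 0^'+, 0 < signed b 1 * h (pos q + signed b e *: normal q)) ->
  \forall e \near 0^'+,
    0 < tau * Num.sg (dot (vel p) (normal q)) * h (pos_of p.1 (p.2 + tau * e)).
Proof.
move=> pq tr tau1 hcont hzero hnorm.
set d0 := dot _ _ in tr *; pose u := tau * Num.sg d0.
have sg1 : `|Num.sg d0| = 1 by rewrite normr_sg tr.
have u1 : `|u| = 1 by rewrite normrM tau1 sg1 mulr1.
have sgu (x : R) : `|x| = 1 -> x = signed (0 < x) 1.
  move=> x1; rewrite /signed; case: ltP => x0; first by rewrite -x1 gtr0_norm.
  by rewrite -x1 ler0_norm // opprK.
have uu : u * u = 1 by rewrite (sgu u u1); case: (0 < u); rewrite /signed /=; ring.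
have qE : pos q = pos_of q.1 q.2 by rewrite /pos_of -surjective_pairing.
have pE : pos p = pos_of p.1 p.2 by rewrite /pos_of -surjective_pairing.
have nE : normal q = rot90 (vel_of q.1 q.2) by rewrite normal_rot90 /vel_of -surjective_pairing.
have vE : vel p = vel_of p.1 p.2 by rewrite /vel_of -surjective_pairing.
rewrite qE in hcont hzero hnorm; rewrite nE in hnorm.
pose K := `|dot (vel_of p.1 p.2) (vel_of q.1 q.2)| + 1.
have K0 : 0 < K by rewrite ltr_wpDl.
have d00 : 0 < `|d0| by rewrite normr_gt0.
have taue : (p.2 + tau * e) @[e --> 0^'+] --> p.2.
  have e0 : e @[e --> 0^'+] --> (0 : R) by apply: cvg_at_right_filter; exact: cvg_id.
  rewrite -[X in _ --> X]addr0 -[X in _ + X](mulr0 tau).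
  by apply: cvgD; [exact: cvg_cst|apply: cvgMr].
apply: (cone_side (@pos_derivable R D q.1) (derive1_pos q.1) (@vel_continuous R D q.1)
  (@vel_neq0 R D q.1) (s0 := q.2) (kap := `|d0| / 2) (K := K) u1 _ K0 hcont hzero).
- by rewrite divr_gt0.
- have [b ub] : exists b, u = signed b 1 by exists (0 < u); exact: sgu.
  have := hnorm b; apply: filterS => e; rewrite ub.
  by have -> : signed b 1 * e = signed b e by rewrite /signed; case: (b); ring.
- rewrite -qE -pq pE.
  by apply: (@cvg_comp _ _ _ (fun e => p.2 + tau * e) (pos_of p.1) _ (nbhs p.2)); [exact: taue|exact: pos_continuous].
have cv : vel_of p.1 t @[t --> p.2] --> vel_of p.1 p.2 by exact: vel_continuous.
have c1 : dot (vel_of p.1 t) (normal q) @[t --> p.2] --> d0.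
  by rewrite /d0 vE; exact: (cvg_dot cv (cvg_cst (normal q))).
have c2 : dot (vel_of p.1 t) (vel_of q.1 q.2) @[t --> p.2] --> dot (vel_of p.1 p.2) (vel_of q.1 q.2).
  exact: (cvg_dot cv (cvg_cst (vel_of q.1 q.2))).
have n1 : \forall t \near p.2, `|dot (vel_of p.1 t) (normal q) - d0| < `|d0| / 2.
  have d2 : 0 < `|d0| / 2 by rewrite divr_gt0.
  have c1' : (dot (vel_of p.1 t) (normal q) - d0) @[t --> p.2] --> 0.
    by rewrite -(subrr d0); exact: (cvgB c1 (cvg_cst d0)).
  exact: (cvgr0_norm_lt _ c1' _ d2).
have n2 : \forall t \near p.2, `|dot (vel_of p.1 t) (vel_of q.1 q.2)| < K.
  have K1 : `|dot (vel_of p.1 p.2) (vel_of q.1 q.2)| < K by rewrite /K ltrDl.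
  exact: (cvgr_norm_lt _ c2 _ K1).
have /nbhs_ballP[d /= d_gt0 hd] : \forall t \near p.2, `|dot (vel_of p.1 t) (normal q) - d0| < `|d0| / 2 /\
  `|dot (vel_of p.1 t) (vel_of q.1 q.2)| < K by exact: filterI n1 n2.
near=> e.
have e0 : 0 < e by near: e; exact: nbhs_right_gt.
have ed : e < d by near: e; exact: nbhs_right_lt.
have cE : pos_of q.1 q.2 = pos_of p.1 p.2 by rewrite -qE -pE.
rewrite cE -nE.
have in_d t : (p.2 <= t <= p.2 + tau * e) || (p.2 + tau * e <= t <= p.2) -> ball p.2 d t.
  move=> ht; rewrite -ball_normE /= ltr_norml.
  have := ler_norm tau; have := ler_norm (- tau); rewrite normrN tau1 => t1 t2.
  have : tau * e <= e by nra.
  have : - e <= tau * e by nra.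
  by lra.
have [t1 /in_d/hd[h1 _] m1] := mvt_dot (@pos_derivable R D p.1) (derive1_pos p.1) (normal q) p.2 (p.2 + tau * e).
have [t2 /in_d/hd[_ h2] m2] := mvt_dot (@pos_derivable R D p.1) (derive1_pos p.1) (vel_of q.1 q.2) p.2 (p.2 + tau * e).
rewrite m1 m2 addrAC subrr add0r; split; last first.
  by rewrite !normrM tau1 mul1r (ger0_norm (ltW e0)) ler_wpM2r // ltW.
move: (dot (vel_of p.1 t1) (normal q)) h1 => x hx.
have -> : u * (x * (tau * e)) = (tau * tau) * (Num.sg d0 * x) * e by rewrite /u; ring.
have tt : tau * tau = 1 by rewrite (sgu tau tau1); case: (0 < tau); rewrite /signed /=; ring.
rewrite tt mul1r ler_pM2r //.
have -> : Num.sg d0 * x = `|d0| + Num.sg d0 * (x - d0) by rewrite mulrBr -normrEsg addrC subrK.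
have : `|Num.sg d0 * (x - d0)| < `|d0| / 2 by rewrite normrM sg1 mul1r.
by rewrite ltr_norml => /andP[+ _]; lra.
Unshelve. all: by end_near. Qed.

Lemma crossing_params p q r : Defs.double p q -> pos r = pos p -> same p r \/ same q r.
Proof.
move=> pq rp; have [pr|pr] := pselect (same p r); first by left.
by right; apply: (no_triple_point pq); split.
Qed.

Section Box.
Variables (c : crossing D) (p q : strand D).
Hypothesis cpq : crossing_at (sval c) p q.

Lemma crossing_pos : pos p = sval c /\ pos q = sval c.
Proof. by have [pc [[_ pq] _]] := cpq; split=> //; rewrite -pq. Qed.

Let half : (1 : R) / 2 \in `[0, 1]%classic.
Proof. by apply/mem_set; rewrite /= in_itv /=; lra. Qed.

(** Some point of the box has both heights equal to 1/2. It lies on the core of p, and the stretch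
    of strand reaching it inside the box starts at the crossing itself. *)
Lemma box_center : [/\ box N c (sval c), core (box N c) p p, core (box N c) q q,
  set_val (uheight N c (sval c)) = 1 / 2 & set_val (oheight N c (sval c)) = 1 / 2].
Proof.
have [pc qc] := crossing_pos.
pose h2 : unit_interval R := @exist R (fun x => x \in `[0, 1]%classic) _ half.
have [_ _ hsurj] := box_bij N c.
have [z cz] := hsurj (h2, h2) I.
move=> [zu zo].
have [r [r1 hr] _] : (@pos R D @` core (box N c) p) z.
  by apply/(box_under cpq cz); rewrite zu.
have bc : box N c (sval c).
  rewrite -pc (surjective_pairing p); apply: hr; rewrite lexx /=.
  by case: leP => //= /ltW ->.
have core_self r' : pos r' = sval c -> core (box N c) r' r'.
  move=> r'c; split=> // s hs.
  have -> : (r'.1, s) = r' by rewrite [RHS]surjective_pairing; congr pair; lra.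
  by rewrite r'c.
split=> //; try exact: core_self.
- by apply/(box_under cpq bc); exists p => //; exact: core_self.
- by apply/(box_over cpq bc); exists q => //; exact: core_self.
Qed.

(** The center is interior to the support and lies in no strip, as its heights are not 0 or 1, nor
    in another box; these are finitely many closed sets. *)
Lemma box_nbhs : nbhs (sval c) (box N c).
Proof.
have [bc _ _ uc oc] := box_center.
have nS : \forall w \near sval c, Defs.support N w.
  by apply: box_interior bc _; left; rewrite /inside uc; lra.
have nstrip : \forall w \near sval c, forall s, ~ strip N s w.
  apply: near_finite => [|s]; first exact: semiarc_finite.
  apply: (closed_near (@strip_closed _ _ N s)) => sc.
  by case: (strip_box cpq bc sc) => -[_ h _]; move: h; rewrite ?uc ?oc; lra.
have nbox : \forall w \near sval c, forall c', box N c' w -> c' = c.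
  apply: near_finite => [|c']; first exact: crossing_set_finite.
  have [cc|cc] := pselect (box N c' (sval c)).
    by apply: filterE => w _; exact: box_disjoint cc bc.
  by apply: filterS (closed_near (@box_closed _ _ N c') cc) => w nw /nw.
apply: filterS3 nS nstrip nbox => w Sw ns nb.
by have [[s sw]|[c' cw]] := chart_strip_or_box Sw; [case: (ns s)|rewrite -(nb c')].
Qed.

Lemma box_interior_nbhs : \forall w \near sval c, nbhs w (box N c).
Proof. exact: nbhs_interior box_nbhs. Qed.

Lemma box_level_cvg w : nbhs w (box N c) ->
  set_val (uheight N c v) @[v --> w] --> set_val (uheight N c w) /\
  set_val (oheight N c v) @[v --> w] --> set_val (oheight N c w).
Proof.
move=> nw; have cw := nbhs_singleton nw; have [cu co] := box_height_cvg cw.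
have aux (h : plane R -> unit_interval R) :
    h v @[v --> within (box N c) (nbhs w)] --> h w -> set_val (h v) @[v --> w] --> set_val (h w).
  move=> hc; have hc' : h v @[v --> w] --> h w.
    move=> U /hc; rewrite /fmap /within /= => hU.
    by apply: filterS2 nw hU => v cv; apply.
  by apply: (@cvg_comp _ _ _ h set_val _ (nbhs (h w))) => //; exact: initial_continuous.
by split; exact: aux.
Qed.

Lemma param_window (r : strand D) : pos r = sval c -> exists2 d, 0 < d &
  forall s, `|s - r.2| < d -> nbhs (pos_of r.1 s) (box N c).
Proof.
move=> rc; have hc := @pos_continuous R D r.1 r.2.
have rE : pos_of r.1 r.2 = sval c by rewrite /pos_of -surjective_pairing.
have := box_interior_nbhs; rewrite -rE => /hc/nbhs_ballP[d /= d0 hd].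
by exists d => // s sd; apply: hd; rewrite -ball_normE /= distrC.
Qed.

Lemma window_core (r : strand D) d : (forall s, `|s - r.2| < d -> nbhs (pos_of r.1 s) (box N c)) ->
  forall s, `|s - r.2| < d -> core (box N c) r (r.1, s).
Proof.
move=> hd s sd; split=> //= t ht; apply: nbhs_singleton; apply: hd.
by move: sd; rewrite !ltr_norml => /andP[? ?]; case/orP: ht => /andP[? ?]; lra.
Qed.

Lemma shift_param r r0 t : same t r0 -> r0.1 = r.1 -> exists2 s,
  s - t.2 = r.2 - r0.2 & pos_of t.1 s = pos r.
Proof.
move=> [e1 [k e2]] e3; exists (r.2 - k%:~R); first by rewrite e2; ring.
rewrite e1 e3 -(pos_periodicz _ _ k) subrK /pos_of -surjective_pairing //.
Qed.

Lemma box_zero z : box N c z -> set_val (uheight N c z) = 1 / 2 ->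
  set_val (oheight N c z) = 1 / 2 -> z = sval c.
Proof.
have [bc _ _ uc oc] := box_center; have [_ hinj _] := box_bij N c => cz zu zo.
apply: (hinj z (sval c) (mem_set cz) (mem_set bc)).
by congr pair; apply: val_inj; [rewrite [LHS]zu [RHS]uc|rewrite [LHS]zo [RHS]oc].
Qed.

(** A nearby point at height 1/2 lies on the diagram, with a parameter close to that of p or of q.
    In the second case its other height is 1/2 too, so it is the crossing. *)
Lemma under_zero d : 0 < d -> \forall z \near sval c, set_val (uheight N c z) = 1 / 2 ->
  exists2 s, `|s - p.2| < d & z = pos_of p.1 s.
Proof.
move=> d0; have [pc qc] := crossing_pos.
have [d1 d10 hd1] := param_window qc.
have dm : 0 < Num.min d d1 by rewrite lt_min d0.
apply: filterS2 box_nbhs (@near_param R D (sval c) _ dm) => z cz hz zu.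
have [r _ rz] : (@pos R D @` core (box N c) p) z by apply/(box_under cpq cz).
have [r0 [r0c r01]] := hz r rz.
rewrite distrC lt_min => /andP[rd rd1].
have [pr|qr] := crossing_params cpq.2.1 (etrans r0c (esym pc)).
  have [s sE sr] := shift_param pr r01.
  by exists s; [rewrite sE|rewrite sr].
have [s sE sr] := shift_param qr r01.
have cs : core (box N c) q (q.1, s) by apply: (window_core hd1); rewrite sE.
have zo : set_val (oheight N c z) = 1 / 2.
  by apply/(box_over cpq cz); exists (q.1, s) => //; rewrite -rz -sr.
exists p.2; first by rewrite subrr normr0.
by rewrite /pos_of -surjective_pairing pc; exact: box_zero.
Qed.

Lemma over_zero d : 0 < d -> \forall z \near sval c, set_val (oheight N c z) = 1 / 2 ->
  exists2 s, `|s - q.2| < d & z = pos_of q.1 s.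
Proof.
move=> d0; have [pc qc] := crossing_pos.
have [d1 d10 hd1] := param_window pc.
have dm : 0 < Num.min d d1 by rewrite lt_min d0.
apply: filterS2 box_nbhs (@near_param R D (sval c) _ dm) => z cz hz zo.
have [r _ rz] : (@pos R D @` core (box N c) q) z by apply/(box_over cpq cz).
have [r0 [r0c r01]] := hz r rz.
rewrite distrC lt_min => /andP[rd rd1].
have [pr|qr] := crossing_params cpq.2.1 (etrans r0c (esym pc)); last first.
  have [s sE sr] := shift_param qr r01.
  by exists s; [rewrite sE|rewrite sr].
have [s sE sr] := shift_param pr r01.
have cs : core (box N c) p (p.1, s) by apply: (window_core hd1); rewrite sE.
have zu : set_val (uheight N c z) = 1 / 2.
  by apply/(box_under cpq cz); exists (p.1, s) => //; rewrite -rz -sr.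
exists q.2; first by rewrite subrr normr0.
by rewrite /pos_of -surjective_pairing qc; exact: box_zero.
Qed.

Lemma level_at_crossing (hgt : plane R -> unit_interval R) (r r' : strand D) (tau : R) :
  pos r = sval c -> pos r' = sval c -> dot (vel r) (normal r') != 0 -> `|tau| = 1 ->
  (forall w, nbhs w (box N c) -> set_val (hgt v) @[v --> w] --> set_val (hgt w)) ->
  (forall d, 0 < d -> \forall z \near sval c, set_val (hgt z) = 1 / 2 ->
    exists2 s, `|s - r'.2| < d & z = pos_of r'.1 s) ->
  (\forall e \near 0^'+, (box N c (pos r' + e *: normal r') ->
       1 / 2 < set_val (hgt (pos r' + e *: normal r'))) /\
     (box N c (pos r' - e *: normal r') -> set_val (hgt (pos r' - e *: normal r')) < 1 / 2)) ->
  \forall e \near 0^'+, 0 < tau * Num.sg (dot (vel r) (normal r')) *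
    (set_val (hgt (pos_of r.1 (r.2 + tau * e))) - 1 / 2).
Proof.
move=> rc r'c tr tau1 hcont hzero hnorm.
apply: (@transverse_sign r r' (fun z => set_val (hgt z) - 1 / 2) tau) => //.
- by rewrite rc.
- rewrite r'c; apply: filterS box_interior_nbhs => w nw.
  by apply: cvgB; [exact: hcont|exact: cvg_cst].
- move=> d d0; rewrite r'c; apply: filterS (hzero d d0) => z hz z0; apply: hz; lra.
- move=> b; have nb := box_nbhs; rewrite -r'c in nb.
  have := @sided_near R D r' b _ nb; apply: filterS2 hnorm => e [h1 h2].
  rewrite /signed; case: b => cw.
    by rewrite mul1r; have := h1 cw; lra.
  by rewrite scaleNr in cw *; have := h2 cw; lra.
Qed.

Lemma over_level_at_crossing tau : `|tau| = 1 ->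
  \forall e \near 0^'+, 0 < tau * Num.sg (dot (vel p) (normal q)) *
    (set_val (oheight N c (pos_of p.1 (p.2 + tau * e))) - 1 / 2).
Proof.
move=> tau1; have [pc qc] := crossing_pos; have [_ _ cq _ _] := box_center.
apply: level_at_crossing => //.
- exact: transverse cpq.2.1.
- by move=> w nw; have [] := box_level_cvg nw.
- exact: over_zero.
- exact: box_over_normal cpq cq.
Qed.

Lemma under_level_at_crossing tau : `|tau| = 1 ->
  \forall e \near 0^'+, 0 < tau * Num.sg (dot (vel q) (normal p)) *
    (set_val (uheight N c (pos_of q.1 (q.2 + tau * e))) - 1 / 2).
Proof.
move=> tau1; have [pc qc] := crossing_pos; have [_ cp _ _ _] := box_center.
apply: level_at_crossing => //.
- exact: transverse (double_sym cpq.2.1).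
- by move=> w nw; have [] := box_level_cvg nw.
- exact: under_zero.
- exact: box_under_normal cpq cp.
Qed.

End Box.
End BoxGeometry.

Lemma cvg_affine0 (R : realType) (a tau : R) : (a + tau * e) @[e --> 0^'+] --> a.
Proof.
have e0 : e @[e --> 0^'+] --> (0 : R) by apply: cvg_at_right_filter; exact: cvg_id.
rewrite -[X in _ --> X]addr0 -[X in _ + X](mulr0 tau).
by apply: cvgD; [exact: cvg_cst|apply: cvgMr].
Qed.

Section SemiarcGerm.
Variables (R : realType) (D : diagram R).

Lemma points_to_sides (s : semiarc D) A B r : points_to s A B -> sval s r -> sides r A B.
Proof.
have [A0 [B0 [_ [h1 h2]]]] := points_to_ex s.
by move=> /h2[-> ->] sr; exact: h1.
Qed.

(** On a component with a crossing, the semi-arc starts at the last crossing parameter before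
    [p0]. *)
Lemma semiarc_germ (s : semiarc D) (p0 : strand D) t : sval s p0 ->
  crossing_pt ((p0.1, t) : strand D) -> exists2 m, crossing_pt m & germ m 1 s.
Proof.
move=> sp0 ct; have np0 := piece_notin (@same_crossing _ _) sp0.
have [m [mp cm hm]] := cut_last (@same_crossing R D) (@crossing_finite R D) p0.2 ct.
have {}mp : m < p0.2.
  rewrite lt_neqAle mp andbT; apply/eqP => e; apply: np0.
  by rewrite (surjective_pairing p0) -e.
exists (p0.1, m) => //; near=> e.
have e0 : 0 < e by near: e; exact: nbhs_right_gt.
have es : e < p0.2 - m by near: e; apply: nbhs_right_lt; lra.
have [p1 np1 sE] := svalP s; rewrite sE in sp0 *.
apply: (cut_trans (@same_crossing _ _) sp0); split=> //=; exists 0 => y hy.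
by apply: hm; move: hy; rewrite mul1r addr0; lra.
Unshelve. all: by end_near. Qed.

End SemiarcGerm.

(** * Labels of a lift around a crossing *)

Section LiftCrossing.
Variables (R : realType) (D : diagram R) (N : bicollar D).
Variables (X : biquandle) (C : coloring X D).
Local Notation I := (unit_interval R).
Local Notation ept := (cube_pt (fun (g : As X) x => g * as_gen x)%g).
Variable f : sphere_map R (EQ0 R X).
Hypothesis fE : forall v, covering (f v) = dual_map N C v.
Let F (z : plane R) : EQ R X := f (Some z).
Local Notation gam := (gam N C f).
Local Notation region_gam := (region_gam N C f).
Implicit Types (g h k : As X) (L : seq (I * X)) (z w : plane R) (s : semiarc D)
  (p q r : strand D) (A B : region D).

Definition corner g (x1 x2 : X) (bu bo : bool) : As X :=
  (if bu then if bo then g * as_gen x1 * as_gen (bov x2 x1) else g * as_gen x1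
   else if bo then g * as_gen x2 else g)%g.

Lemma vertex_corner2 g x1 x2 (u o : I) : vertex g [:: (u, x1); (o, x2)] =
  corner g x1 x2 (~~ (set_val u < 1 / 2)) (~~ (set_val o < 1 / 2)).
Proof. by rewrite !vertex_cons /= ?vertex_cons /corner; do 2!case: ifP. Qed.

Lemma sign_half (x o : R) : 0 < x * (o - 1 / 2) -> (o < 1 / 2) = ~~ (0 < x) /\ o <> 1 / 2.
Proof.
have [x0|x0|<-] := ltgtP 0 x; last by rewrite mul0r ltxx.
  by rewrite pmulr_rgt0 // => h; split; [apply/negbTE; rewrite -leNgt|]; lra.
by rewrite nmulr_rgt0 // => h; split; lra.
Qed.

Section AtCrossing.
Variables (c : crossing D) (p q : strand D) (s1 s2 : semiarc D) (g : As X).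
Hypothesis cpq : crossing_at (sval c) p q.
Hypotheses (b1 : behind p q s1) (b2 : behind q p s2).
Let L z := [:: (uheight N c z, C s1); (oheight N c z, C s2)].
Hypothesis Fc : F (sval c) = ept g (L (sval c)).

Lemma box_sided_gam r b bu bo : nbhs (pos r) (box N c) -> F (pos r) = ept g (L (pos r)) ->
  (\forall e \near 0^'+, box N c (pos r + signed b e *: normal r) ->
    (set_val (uheight N c (pos r + signed b e *: normal r)) < 1 / 2) = ~~ bu) ->
  (\forall e \near 0^'+, box N c (pos r + signed b e *: normal r) ->
    (set_val (oheight N c (pos r + signed b e *: normal r)) < 1 / 2) = ~~ bo) ->
  \forall e \near 0^'+, gam (pos r + signed b e *: normal r) (corner g (C s1) (C s2) bu bo).
Proof.
move=> nr Fr hu ho; have cr := nbhs_singleton nr.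
have h1 := @sided_near R D r b _ nr.
have h2 := @sided_near R D r b _ (near_box fE cpq cr b1 b2 Fr).
near=> e.
have ce : box N c (pos r + signed b e *: normal r) by near: e.
have ue : box N c (pos r + signed b e *: normal r) ->
  (set_val (uheight N c (pos r + signed b e *: normal r)) < 1 / 2) = ~~ bu by near: e.
have oe : box N c (pos r + signed b e *: normal r) ->
  (set_val (oheight N c (pos r + signed b e *: normal r)) < 1 / 2) = ~~ bo by near: e.
have Fe : box N c (pos r + signed b e *: normal r) -> F (pos r + signed b e *: normal r) =
  ept g (L (pos r + signed b e *: normal r)) by near: e.
exists (L (pos r + signed b e *: normal r)), g; split.
- exact: (ChartBox C cpq).
- exact: Fe.
- by rewrite vertex_corner2 ue // oe // !negbK.
Unshelve. all: by end_near. Qed.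

(** Along the under-strand the over-height stays on one side of 1/2, given by the direction of
    travel, while the under-height passes 1/2 along the normal; two adjacent corners of the square
    result. *)
Lemma under_sides s (tau : R) A B : `|tau| = 1 -> germ p tau s -> points_to s A B ->
  let bo := 0 < tau * Num.sg (dot (vel p) (normal q)) in
  region_gam A = corner g (C s1) (C s2) false bo /\
  region_gam B = corner g (C s1) (C s2) true bo.
Proof.
move=> tau1 gs sAB bo; have [pc qc] := crossing_pos cpq.
have [d d0 hd] := param_window N cpq pc.
have [bc _ _ _ _] := box_center N cpq.
have hF : \forall w \near sval c, box N c w -> F w = ept g (L w) by exact: (near_box fE cpq bc b1 b2 Fc).
have lev := over_level_at_crossing N cpq tau1.
have path_c : pos_of p.1 (p.2 + tau * e) @[e --> 0^'+] --> sval c.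
  have e1 := @cvg_affine0 R p.2 tau.
  have -> : sval c = pos_of p.1 p.2 by rewrite -pc /pos_of -surjective_pairing.
  exact: cvg_comp e1 (@pos_continuous R D p.1 p.2).
have hFp : \forall e \near 0^'+, box N c (pos_of p.1 (p.2 + tau * e)) ->
  F (pos_of p.1 (p.2 + tau * e)) = ept g (L (pos_of p.1 (p.2 + tau * e))) by exact: (path_c _ hF).
have hex : \forall e \near (0 : R)^'+, region_gam A = corner g (C s1) (C s2) false bo /\
  region_gam B = corner g (C s1) (C s2) true bo.
  near=> e.
  pose r : strand D := (p.1, p.2 + tau * e).
  have e0 : 0 < e by near: e; exact: nbhs_right_gt.
  have ed : e < d by near: e; exact: nbhs_right_lt.
  have rd : `|p.2 + tau * e - p.2| < d.
    by rewrite addrAC subrr add0r normrM tau1 mul1r gtr0_norm.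
  have nr : nbhs (pos r) (box N c) by exact: hd.
  have cr : core (box N c) p r by exact: window_core hd _ rd.
  have sr : sval s r by rewrite /r; near: e; exact: gs.
  have lr : 0 < tau * Num.sg (dot (vel p) (normal q)) * (set_val (oheight N c (pos r)) - 1 / 2).
    by rewrite /r; near: e; exact: lev.
  have [ho hoN] := sign_half lr.
  have Fr : F (pos r) = ept g (L (pos r)).
    have h : box N c (pos r) -> F (pos r) = ept g (L (pos r)) by rewrite /r; near: e; exact: hFp.
    exact: h (nbhs_singleton nr).
  apply: (gam_sides fE (k := fun b => corner g (C s1) (C s2) b bo) (points_to_sides sAB sr)) => b.
  apply: box_sided_gam => //.
    exact: sided_normal (box_under_normal cpq cr).
  have [_ co] := box_height_cvg (nbhs_singleton nr).
  have := @sided_near R D r b _ (lt_half_near co hoN).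
  by apply: filterS => e' h ce; rewrite h.
by have [] := @filter_ex _ _ (at_right_proper_filter 0) _ hex.
Unshelve. all: by end_near. Qed.

Lemma over_sides s (tau : R) A B : `|tau| = 1 -> germ q tau s -> points_to s A B ->
  let bu := 0 < tau * Num.sg (dot (vel q) (normal p)) in
  region_gam A = corner g (C s1) (C s2) bu false /\
  region_gam B = corner g (C s1) (C s2) bu true.
Proof.
move=> tau1 gs sAB bu; have [pc qc] := crossing_pos cpq.
have [d d0 hd] := param_window N cpq qc.
have [bc _ _ _ _] := box_center N cpq.
have hF : \forall w \near sval c, box N c w -> F w = ept g (L w) by exact: (near_box fE cpq bc b1 b2 Fc).
have lev := under_level_at_crossing N cpq tau1.
have path_c : pos_of q.1 (q.2 + tau * e) @[e --> 0^'+] --> sval c.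
  have e1 := @cvg_affine0 R q.2 tau.
  have -> : sval c = pos_of q.1 q.2 by rewrite -qc /pos_of -surjective_pairing.
  exact: cvg_comp e1 (@pos_continuous R D q.1 q.2).
have hFp : \forall e \near 0^'+, box N c (pos_of q.1 (q.2 + tau * e)) ->
  F (pos_of q.1 (q.2 + tau * e)) = ept g (L (pos_of q.1 (q.2 + tau * e))) by exact: (path_c _ hF).
have hex : \forall e \near (0 : R)^'+, region_gam A = corner g (C s1) (C s2) bu false /\
  region_gam B = corner g (C s1) (C s2) bu true.
  near=> e.
  pose r : strand D := (q.1, q.2 + tau * e).
  have e0 : 0 < e by near: e; exact: nbhs_right_gt.
  have ed : e < d by near: e; exact: nbhs_right_lt.
  have rd : `|q.2 + tau * e - q.2| < d.
    by rewrite addrAC subrr add0r normrM tau1 mul1r gtr0_norm.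
  have nr : nbhs (pos r) (box N c) by exact: hd.
  have cr : core (box N c) q r by exact: window_core hd _ rd.
  have sr : sval s r by rewrite /r; near: e; exact: gs.
  have lr : 0 < tau * Num.sg (dot (vel q) (normal p)) * (set_val (uheight N c (pos r)) - 1 / 2).
    by rewrite /r; near: e; exact: lev.
  have [ho hoN] := sign_half lr.
  have Fr : F (pos r) = ept g (L (pos r)).
    have h : box N c (pos r) -> F (pos r) = ept g (L (pos r)) by rewrite /r; near: e; exact: hFp.
    exact: h (nbhs_singleton nr).
  apply: (gam_sides fE (k := fun b => corner g (C s1) (C s2) bu b) (points_to_sides sAB sr)) => b.
  apply: box_sided_gam => //; last exact: sided_normal (box_over_normal cpq cr).
  have [co _] := box_height_cvg (nbhs_singleton nr).
  have := @sided_near R D r b _ (lt_half_near co hoN).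
  by apply: filterS => e' h ce; rewrite h.
by have [] := @filter_ex _ _ (at_right_proper_filter 0) _ hex.
Unshelve. all: by end_near. Qed.

Lemma sg_sg_gt0 (x : R) : x != 0 -> (0 < - Num.sg x * Num.sg x) = false /\ 0 < Num.sg x * Num.sg x.
Proof.
move=> x0; have xx : Num.sg x * Num.sg x = 1 by rewrite -expr2 sqr_sg x0.
by rewrite mulNr xx ltr01; split=> //; apply/negbTE; rewrite -leNgt; lra.
Qed.

Lemma crossing_regions s3 s4 : ahead p q s3 -> ahead q p s4 ->
  forall A B, [/\ points_to s1 A B -> region_gam A = g /\ region_gam B = (g * as_gen (C s1))%g,
    points_to s2 A B -> region_gam A = g /\ region_gam B = (g * as_gen (C s2))%g,
    points_to s3 A B -> region_gam A = (g * as_gen (C s2))%g /\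
      region_gam B = (g * as_gen (C s2) * as_gen (C s3))%g &
    points_to s4 A B -> region_gam A = (g * as_gen (C s1))%g /\
      region_gam B = (g * as_gen (C s1) * as_gen (C s4))%g].
Proof.
move=> a3 a4 A B; have [c3 c4] := colorP C cpq.2 b1 b2 a3 a4.
have tr := transverse cpq.2.1; have tr' := transverse (double_sym cpq.2.1).
have [sn sp] := sg_sg_gt0 tr; have [sn' sp'] := sg_sg_gt0 tr'.
have n1 (x : R) : x != 0 -> `|- Num.sg x| = 1 by move=> x0; rewrite normrN normr_sg x0.
have n2 (x : R) : x != 0 -> `|Num.sg x| = 1 by move=> x0; rewrite normr_sg x0.
split.
- by move=> /(under_sides (n1 _ tr) b1); rewrite sn.
- by move=> /(over_sides (n1 _ tr') b2); rewrite sn'.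
- move=> /(under_sides (n2 _ tr) a3); rewrite sp /corner => -[-> ->].
  by rewrite -c3 -!mulgA as_relator.
- by move=> /(over_sides (n2 _ tr') a4); rewrite sp' /corner -c4.
Qed.

End AtCrossing.

Lemma crossing_lift c p q s1 s2 : crossing_at (sval c) p q -> behind p q s1 ->
  behind q p s2 -> exists g, F (sval c) =
    ept g [:: (uheight N c (sval c), C s1); (oheight N c (sval c), C s2)].
Proof.
move=> cpq b1 b2; have [bc _ _ _ _] := box_center N cpq.
by have [g h] := chart_lift fE (ChartBox C cpq bc b1 b2); exists g; exact: h.
Qed.

(** If no point of s lies in its strip, s is covered by boxes. Its component then has a crossing, s
    starts at some crossing m, and the regions beside s are corners of the box there. *)
Lemma region_gam_jump s A B : points_to s A B ->
  (region_gam A * as_gen (C s))%g = region_gam B.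
Proof.
move=> sAB; have [[p0 sp0 stp0]|nst] := pselect (exists2 p0, sval s p0 & strip N s (pos p0)).
  have [g Fp0] := chart_lift fE (ChartStrip C stp0).
  by have [-> ->] := strip_sides fE sp0 stp0 Fp0 (points_to_sides sAB sp0).
have [p0 np0 sp0] := semiarc_ex s.
have Sp0 : Defs.support N (pos p0) by apply: support_image; exists p0.
have [[s' sw]|[c cw]] := chart_strip_or_box Sp0.
  have Ip0 : Defs.image D (pos p0) by exists p0.
  have [r s'r rp] := strip_image (conj sw Ip0).
  have p0r := simple_same np0 rp.
  have ss : s = s'.
    exact: (piece_eq (@same_crossing _ _) sp0 (piece_same (@same_crossing _ _) (same_sym p0r) s'r)).
  by case: nst; exists p0 => //; rewrite ss.
have [t ct] : exists t, crossing_pt ((p0.1, t) : strand D).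
  have [p [q [_ [_ [cpq _ _]]]]] := box_strands c.
  have cp : crossing_pt p by exists q; exact: cpq.2.1.
  have cq : crossing_pt q by exists p; exact: double_sym cpq.2.1.
  have : (Defs.image D) (pos p0) by exists p0.
  move=> Ip; have [[r [r1 _] rp]|[r [r1 _] rp]] := box_image cpq (conj cw Ip).
    have [e _] := simple_same np0 rp; exists p.2.
    by rewrite e r1 -surjective_pairing.
  have [e _] := simple_same np0 rp; exists q.2.
  by rewrite e r1 -surjective_pairing.
have [m [m' mm'] gm] := semiarc_germ sp0 ct.
have sgE (x : R) : x != 0 -> 1 = Num.sg x \/ 1 = - Num.sg x.
  by move=> x0; case: sgrP x0 => // _ _; [left|right; rewrite opprK].
have both : behind m m' s \/ ahead m m' s.
  by case: (sgE _ (transverse mm')) => e; [right|left]; rewrite /behind /ahead -e.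
have mc : exists c : crossing D, sval c = pos m by apply: crossing_of; exists m'.
have {c cw} [c cm] := mc.
have [/negbTE om|/negbTE om] : ~~ overp m \/ ~~ overp m'.
  by rewrite (over_under mm'); case: (overp m'); [left|right].
- have cpq : crossing_at (sval c) m m' by split; [rewrite cm|split; rewrite ?om].
  have [s1 b1] := behind_ex mm'; have [s2 b2] := behind_ex (double_sym mm').
  have [s3 a3] := ahead_ex mm'; have [s4 a4] := ahead_ex (double_sym mm').
  have [g Fc] := crossing_lift cpq b1 b2.
  have [h1 h2 h3 h4] := crossing_regions cpq b1 b2 Fc a3 a4 A B.
  have un (s' s'' : semiarc D) u : germ m u s' -> germ m u s'' -> s' = s''.
    exact: (germ_eq (@same_crossing _ _) (same_refl m)).
  case: both => hs.
    by have ss := un _ _ _ hs b1; subst s1; have [-> ->] := h1 sAB.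
  by have ss := un _ _ _ hs a3; subst s3; have [-> ->] := h3 sAB.
- have cpq : crossing_at (sval c) m' m.
    by split; [rewrite cm; case: mm' => _ ->|split; rewrite ?om //; exact: double_sym].
  have [s1 b1] := behind_ex (double_sym mm'); have [s2 b2] := behind_ex mm'.
  have [s3 a3] := ahead_ex (double_sym mm'); have [s4 a4] := ahead_ex mm'.
  have [g Fc] := crossing_lift cpq b1 b2.
  have [h1 h2 h3 h4] := crossing_regions cpq b1 b2 Fc a3 a4 A B.
  have un (s' s'' : semiarc D) u : germ m u s' -> germ m u s'' -> s' = s''.
    exact: (germ_eq (@same_crossing _ _) (same_refl m)).
  case: both => hs.
    by have ss := un _ _ _ hs b2; subst s2; have [-> ->] := h2 sAB.
  by have ss := un _ _ _ hs a4; subst s4; have [-> ->] := h4 sAB.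
Qed.

Lemma region_gam_coloring : is_region_coloring C region_gam.
Proof.
split=> [A|s A B]; [exact: region_gam_unbounded fE A|exact: region_gam_jump].
Qed.

Lemma region_coloringE (A : region D) : region_coloring C A = region_gam A.
Proof.
apply: (region_coloring_unique N _ region_gam_coloring).
rewrite /region_coloring; case: xgetP => [CR _ //|/(_ region_gam) h].
by case: h; exact: region_gam_coloring.
Qed.

Lemma specified_colorE s A B : points_to s A B -> specified_color C s = region_gam A.
Proof.
move=> sAB; rewrite /specified_color; case: xgetP => [g _ /= [A' [B' [sAB' ->]]]|/(_ (region_coloring C A)) h].
  have [A0 [B0 [_ [_ h]]]] := points_to_ex s.
  by rewrite region_coloringE (h _ _ sAB).1 (h _ _ sAB').1.
by case: h; exists A, B.
Qed.

End LiftCrossing.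

(** * Specified colors and the lift *)

Section Fibers.
Variables (R : realType) (T : topologicalType).
Implicit Types (A K : set T).

Lemma within_sub K A (U : topologicalType) (h : T -> U) (z : T) :
  K `<=` A -> h v @[v --> within A (nbhs z)] --> h z ->
  h v @[v --> within K (nbhs z)] --> h z.
Proof.
move=> KA hc V nV.
have hV : \forall v \near z, A v -> V (h v) by exact: (hc V nV).
suff : \forall v \near z, K v -> V (h v) by [].
by apply: filterS hV => v hv /KA.
Qed.

Lemma compact_cut A (P : T -> Prop) : compact A ->
  (forall w, A w -> ~ P w -> \forall w' \near w, A w' -> ~ P w') ->
  compact (A `&` [set w | P w]).
Proof.
move=> cA hP.
have -> : A `&` [set w | P w] = A `&` ~` (interior [set w | A w -> ~ P w]).
  apply/seteqP; split=> w /= [Aw Pw]; split=> //.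
    by move=> h; exact: (nbhs_singleton h).
  by apply: contrapT => nP; apply: Pw; exact: hP.
by apply: compact_closedI => //; apply: open_closedC; exact: open_interior.
Qed.

Lemma compact_cut_closed (U : topologicalType) A (h : T -> U) (B : set U) :
  compact A -> closed B ->
  (forall w, A w -> h v @[v --> within A (nbhs w)] --> h w) -> compact (A `&` h @^-1` B).
Proof.
move=> cA cB hc; apply: compact_cut => // w Aw nB.
have oB : nbhs (h w) (~` B) by apply: open_nbhs_nbhs; split=> //; exact: closed_openC.
exact: hc Aw _ oB.
Qed.

(* The two level sets of P have disjoint closed images covering [a, b].       *)
Lemma fiber_constant K (h : T -> R) (P : T -> Prop) (a b : R) x y :
  compact K -> (forall w, K w -> h v @[v --> within K (nbhs w)] --> h w) ->
  (forall w w', K w -> K w' -> h w = h w' -> w = w') ->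
  (forall w, K w -> \forall w' \near w, K w' -> P w' = P w) ->
  (forall t, a <= t <= b -> exists2 w, K w & h w = t) ->
  K x -> K y -> a <= h x <= b -> a <= h y <= b -> P x = P y.
Proof.
move=> cK hc hinj hP hsurj Kx Ky hx hy.
have closed_image (Q : T -> Prop) : (forall w, K w -> \forall w' \near w, K w' -> Q w' = Q w) ->
    closed (h @` (K `&` [set w | Q w])).
  move=> hQ; apply: compact_closed; first exact: Rhausdorff.
  apply: continuous_compact.
    apply/subspace_continuousP => w [Kw _].
    by apply: (within_sub (A := K)); [move=> v []|exact: hc].
  apply: compact_cut => // w Kw nQ; apply: filterS (hQ w Kw) => w' h' Kw'.
  by rewrite h'.
have c1 := closed_image P hP.
have c2 : closed (h @` (K `&` [set w | ~ P w])).
  by apply: closed_image => w Kw; apply: filterS (hP w Kw) => w' h' Kw'; rewrite h'.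
pose f (t : R) : Prop := (h @` (K `&` [set w | P w])) t.
have fh w : K w -> f (h w) = P w.
  move=> Kw; apply/propext; split=> [[w' [Kw' Pw'] e]|Pw]; last by exists w.
  by rewrite -(hinj w' w).
rewrite -!fh //.
apply: (@connected_locally_constant _ _ `[a, b]%classic f) => [|t tab||].
- exact: segment_connected.
- have tab' : a <= t <= b by move: tab; rewrite /= in_itv.
  have [w Kw wt] := hsurj t tab'.
  have [ft|nft] := pselect (f t).
    have nt : ~ (h @` (K `&` [set w | ~ P w])) t.
      by move=> [w' [Kw' nP'] e]; apply: nP'; rewrite -fh // e.
    have ot := closed_openC c2; have : nbhs t (~` (h @` (K `&` [set w | ~ P w]))).
      exact: (open_nbhs_nbhs (conj ot nt)).
    apply: filterS => u nu uab; apply/propext; split=> // _.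
    have uab' : a <= u <= b by move: uab; rewrite /= in_itv.
    have [v Kv vu] := hsurj u uab'; exists v => //; split=> //=.
    by apply: contrapT => nPv; apply: nu; exists v.
  have ot := closed_openC c1; have : nbhs t (~` (h @` (K `&` [set w | P w]))).
    exact: (open_nbhs_nbhs (conj ot nft)).
  by apply: filterS => u nu uab; apply/propext; split=> [fu|ft];
    [case: (nu fu)|case: (nft ft)].
- by rewrite /= in_itv.
- by rewrite /= in_itv.
Qed.

End Fibers.

(** * The label of the lift as a specified color *)

Section LiftColors.
Variables (R : realType) (D : diagram R) (N : bicollar D).
Variables (X : biquandle) (C : coloring X D).
Local Notation I := (unit_interval R).
Local Notation ept := (cube_pt (fun (g : As X) x => g * as_gen x)%g).
Variable f : sphere_map R (EQ0 R X).
Hypothesis fE : forall v, covering (f v) = dual_map N C v.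
Let F (z : plane R) : EQ R X := f (Some z).
Local Notation region_gam := (region_gam N C f).
Implicit Types (g h k : As X) (z w : plane R) (s : semiarc D)
  (p q r : strand D) (A B : region D).

Lemma val_cvg (T : Type) (G : set_system T) {FG : Filter G} (h : T -> I) (t : I) :
  h w @[w --> G] --> t -> set_val (h w) @[w --> G] --> set_val t.
Proof.
by move=> ht; apply: (@cvg_comp _ _ _ h set_val _ (nbhs t)) => //; exact: initial_continuous.
Qed.

(** Labels of a point in a given chart are unique by [ept_inj]; thus carrying the label g is an open
    and closed condition on K. *)
Lemma ept_stable (K : set (plane R)) (P : plane R -> seq (I * X)) g :
  (forall z, K z -> exists k, F z = ept k (P z)) ->
  (forall z k, K z -> F z = ept k (P z) -> \forall w \near z, K w -> F w = ept k (P w)) ->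
  forall z, K z -> \forall w \near z, K w -> (F w = ept g (P w)) = (F z = ept g (P z)).
Proof.
move=> hex hnear z Kz; have [k Fz] := hex z Kz.
apply: filterS (hnear z k Kz Fz) => w h Kw; rewrite (h Kw) Fz.
by apply/propext; split=> [/ept_inj ->|/ept_inj ->].
Qed.

(** The label is carried along the fiber of [foot] from z to the point of s at height 1/2, where
    [strip_sides] identifies it. *)
Lemma strip_color s z g : strip N s z -> inside (height N s z) ->
  F z = ept g [:: (height N s z, C s)] -> specified_color C s = g.
Proof.
move=> sz ins Fz; have [hfun hinj hsurj] := strip_bij N s.
have [/= [sf tf] _] := hfun z (conj sz ins).
have [ff hf] := strip_core sf tf.
have insf : inside (height N s (foot N s z)) by rewrite /inside hf; lra.
pose h w : R := set_val (height N s w).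
(* Heights are kept in [m, M] inside ]0, 1[, since [foot] is continuous and the strip a product only
   there; this makes the fiber compact. *)
pose m := Num.min (h z) (1 / 2); pose M := Num.max (h z) (1 / 2).
have m0 : 0 < m by move: ins => /andP[h0 h1]; rewrite lt_min; apply/andP; split; [exact: h0|lra].
have M1 : M < 1 by move: ins => /andP[h0 h1]; rewrite gt_max; apply/andP; split; [exact: h1|lra].
pose K1 := strip N s `&` h @^-1` `[m, M]%classic.
have ins1 w : K1 w -> strip N s w /\ inside (height N s w).
  by move=> [sw]; rewrite /= in_itv /= => hw; split=> //; rewrite /inside -/(h w); lra.
have cK1 : compact K1.
  apply: compact_cut_closed; [exact: strip_compact|exact: interval_closed|].
  by move=> w sw; apply: val_cvg; exact: strip_height_cvg.
pose K := K1 `&` foot N s @^-1` [set foot N s z].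
have cK : compact K.
  apply: compact_cut_closed => //.
    by apply: accessible_closed_set1; apply: hausdorff_accessible; exact: norm_hausdorff.
  move=> w K1w; apply: (within_sub (A := strip N s `&` [set w | inside (height N s w)])).
    by move=> v /ins1.
  have /subspace_continuousP hc := @foot_continuous _ _ N s.
  by apply: hc; exact: ins1.
have Kz : K z by split=> //; split=> //=; rewrite in_itv /= ge_min le_max !lexx.
have Kf : K (foot N s z).
  split=> //; split=> //=; rewrite in_itv /= /h hf ge_min le_max !lexx !orbT //.
have hK w : K w -> h v @[v --> within K (nbhs w)] --> h w.
  move=> [[sw _] _]; apply: (within_sub (A := strip N s)); first by move=> v [[]].
  by apply: val_cvg; exact: strip_height_cvg.
have Kinj w w' : K w -> K w' -> h w = h w' -> w = w'.
  move=> [/ins1 w1 w2] [/ins1 w1' w2'] e.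
  apply: (hinj w w' (mem_set w1) (mem_set w1')).
  by rewrite w2 w2'; congr pair; apply: val_inj.
have KP w : K w -> \forall w' \near w, K w' ->
    (F w' = ept g [:: (height N s w', C s)]) = (F w = ept g [:: (height N s w, C s)]).
  apply: (ept_stable (P := fun w => [:: (height N s w, C s)])) => [v [[sv _] _]|v k [[sv _] _] Fv].
    by have [k hk] := chart_lift fE (ChartStrip C sv); exists k; exact: hk.
  by apply: filterS (near_strip fE sv Fv) => u hu [[su _] _]; exact: hu.
have Ksurj t : m <= t <= M -> exists2 w, K w & h w = t.
  move=> tmM; have tI : t \in `[0, 1]%classic by apply/mem_set; rewrite /= in_itv /=; lra.
  pose t' : I := @exist R (fun x => x \in `[0, 1]%classic) t tI.
  have [w [sw iw] e] : ((fun w => (foot N s w, height N s w)) @`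
      (strip N s `&` [set w | inside (height N s w)])) (foot N s z, t').
    have it : inside t' by rewrite /inside; have -> : set_val t' = t by []; lra.
    exact: (hsurj (foot N s z, t') (conj (conj sf tf) it)).
  have hw : h w = t by have e2 : height N s w = t' := congr1 snd e; rewrite /h e2.
  exists w => //; split; last exact: (congr1 fst e).
  by split=> //=; rewrite in_itv /= hw.
have := fiber_constant (a := m) (b := M) cK hK Kinj KP Ksurj Kz Kf.
rewrite /h hf !ge_min !le_max !lexx !orbT /= => /(_ isT isT) e.
have Ff : F (foot N s z) = ept g [:: (height N s (foot N s z), C s)] by rewrite -e.
have [p sp pz] := tf; rewrite -pz in sf Ff.
have [A [B [sAB [hs _]]]] := points_to_ex s.
rewrite (specified_colorE fE sAB).
by have [] := strip_sides fE sp sf Ff (hs p sp).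
Qed.

(** The label is carried to the center in two moves, first at constant over-height and then at
    constant under-height. *)
Lemma box_color (c : crossing D) p q s1 s2 z g : crossing_at (sval c) p q -> box N c z ->
  behind p q s1 -> behind q p s2 ->
  F z = ept g [:: (uheight N c z, C s1); (oheight N c z, C s2)] ->
  F (sval c) = ept g [:: (uheight N c (sval c), C s1); (oheight N c (sval c), C s2)].
Proof.
move=> cpq cz b1 b2 Fz; have [hfun hinj hsurj] := box_bij N c.
pose L w := [:: (uheight N c w, C s1); (oheight N c w, C s2)].
have [bc _ _ uc oc] := box_center N cpq.
have step (h1 h2 : plane R -> I) (x y : plane R) :
    (forall w, box N c w -> h1 v @[v --> within (box N c) (nbhs w)] --> h1 w) ->
    (forall w, box N c w -> h2 v @[v --> within (box N c) (nbhs w)] --> h2 w) ->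
    (forall w w', box N c w -> box N c w' -> h1 w = h1 w' -> h2 w = h2 w' -> w = w') ->
    (forall t u, exists2 w, box N c w & h1 w = t /\ h2 w = u) ->
    box N c x -> box N c y -> h2 x = h2 y ->
    (F x = ept g (L x)) = (F y = ept g (L y)).
  move=> c1 c2 inj surj cx cy e.
  pose K := box N c `&` (fun w => set_val (h2 w)) @^-1` [set set_val (h2 y)].
  have cK : compact K.
    apply: compact_cut_closed; [exact: box_compact|exact: closed_eq|].
    by move=> w cw; apply: val_cvg; exact: c2.
  apply: (@fiber_constant R _ K (fun w => set_val (h1 w)) (fun w => F w = ept g (L w)) 0 1) => //.
  - move=> w [cw _]; apply: (within_sub (A := box N c)); first by move=> v [].
    by apply: val_cvg; exact: c1.
  - move=> w w' [cw w2] [cw' w2'] e1; apply: inj => //; apply: val_inj => //.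
    by rewrite [LHS]w2 [RHS]w2'.
  - apply: (ept_stable (P := L)) => [v [cv _]|v k [cv _] Fv].
      by have [k hk] := chart_lift fE (ChartBox C cpq cv b1 b2); exists k; exact: hk.
    by apply: filterS (near_box fE cpq cv b1 b2 Fv) => u hu [cu _]; exact: hu.
  - move=> t t01; have tI : t \in `[0, 1]%classic by apply/mem_set; rewrite /= in_itv.
    have [w cw [w1 w2]] := surj (@exist R (fun x => x \in `[0, 1]%classic) t tI) (h2 y).
    by exists w; [split=> //=; rewrite w2|rewrite w1].
  - by split=> //=; rewrite e.
  - exact: unit_intervalP.
  - exact: unit_intervalP.
have cu w : box N c w -> uheight N c v @[v --> within (box N c) (nbhs w)] --> uheight N c w.
  by move=> /box_height_cvg[].
have co w : box N c w -> oheight N c v @[v --> within (box N c) (nbhs w)] --> oheight N c w.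
  by move=> /box_height_cvg[].
have inj w w' : box N c w -> box N c w' -> uheight N c w = uheight N c w' ->
    oheight N c w = oheight N c w' -> w = w'.
  by move=> cw cw' e1 e2; apply: (hinj w w' (mem_set cw) (mem_set cw')); rewrite e1 e2.
have surj t u : exists2 w, box N c w & uheight N c w = t /\ oheight N c w = u.
  have [w cw e] := hsurj (t, u) Logic.I; exists w => //.
  by split; [exact: (congr1 fst e)|exact: (congr1 snd e)].
have [y cy [yu yo]] := surj (uheight N c (sval c)) (oheight N c z).
have e1 := step (uheight N c) (oheight N c) z y cu co inj surj cz cy (esym yo).
have inj' w w' : box N c w -> box N c w' -> oheight N c w = oheight N c w' ->
    uheight N c w = uheight N c w' -> w = w'.
  by move=> cw cw' h1 h2; exact: inj.
have surj' t u : exists2 w, box N c w & oheight N c w = t /\ uheight N c w = u.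
  by have [w cw [w1 w2]] := surj u t; exists w.
have e2 := step (oheight N c) (uheight N c) y (sval c) co cu inj' surj' cy bc yu.
by rewrite -/(L (sval c)) -e2 -e1.
Qed.

Lemma specified_crossing p q si sj sk sl : crosses_under p q ->
  behind p q si -> behind q p sj -> ahead p q sk -> ahead q p sl ->
  [/\ specified_color C sj = specified_color C si,
      specified_color C sk = (specified_color C si * as_gen (C sj))%g &
      specified_color C sl = (specified_color C si * as_gen (C si))%g].
Proof.
move=> pq b1 b2 a3 a4.
have [c cp] : exists c : crossing D, sval c = pos p by apply: crossing_of; exists q; exact: pq.1.
have cpq : crossing_at (sval c) p q by rewrite cp.
have [g Fc] := crossing_lift fE cpq b1 b2.
have hr := crossing_regions fE cpq b1 b2 Fc a3 a4.
have spec s : exists A B, points_to s A B /\ specified_color C s = region_gam A.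
  have [A [B [sAB _]]] := points_to_ex s.
  by exists A, B; split=> //; exact: (specified_colorE fE sAB).
have [A1 [B1 [p1 ->]]] := spec si; have [A2 [B2 [p2 ->]]] := spec sj.
have [A3 [B3 [p3 ->]]] := spec sk; have [A4 [B4 [p4 ->]]] := spec sl.
have [/(_ p1)[-> _] _ _ _] := hr A1 B1; have [_ /(_ p2)[-> _] _ _] := hr A2 B2.
by have [_ _ /(_ p3)[-> _] _] := hr A3 B3; have [_ _ _ /(_ p4)[-> _]] := hr A4 B4.
Qed.

Lemma box_specified (c : crossing D) p q s1 s2 z g : crossing_at (sval c) p q -> box N c z ->
  behind p q s1 -> behind q p s2 ->
  F z = ept g [:: (uheight N c z, C s1); (oheight N c z, C s2)] ->
  specified_color C s1 = g /\ specified_color C s2 = g.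
Proof.
move=> cpq cz b1 b2 Fz; have Fc := box_color cpq cz b1 b2 Fz.
have [s3 a3] := ahead_ex cpq.2.1; have [s4 a4] := ahead_ex (double_sym cpq.2.1).
have hr := crossing_regions fE cpq b1 b2 Fc a3 a4.
have [A1 [B1 [p1 _]]] := points_to_ex s1; have [A2 [B2 [p2 _]]] := points_to_ex s2.
rewrite (specified_colorE fE p1) (specified_colorE fE p2).
by have [/(_ p1)[-> _] _ _ _] := hr A1 B1; have [_ /(_ p2)[-> _] _ _] := hr A2 B2.
Qed.

End LiftColors.

(** * Existence of region colorings and the image of the lift *)

Section RegionColors.
Variables (R : realType) (D : diagram R) (N : bicollar D).
Variables (X : biquandle) (C : coloring X D).

Lemma region_coloringP : is_region_coloring C (region_coloring C).
Proof.
have [f fE] := dual_lift_ex N C; have [h1 h2] := region_gam_coloring fE.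
by split=> [A /h1|s A B /h2]; rewrite !(region_coloringE fE).
Qed.

Lemma specified_color_region s A B : points_to s A B ->
  specified_color C s = region_coloring C A.
Proof.
have [f fE] := dual_lift_ex N C.
by move=> sAB; rewrite (specified_colorE fE sAB) (region_coloringE fE).
Qed.

Lemma specified_color_crossing p q si sj sk sl : crosses_under p q ->
  behind p q si -> behind q p sj -> ahead p q sk -> ahead q p sl ->
  [/\ specified_color C sj = specified_color C si,
      specified_color C sk = (specified_color C si * as_gen (C sj))%g &
      specified_color C sl = (specified_color C si * as_gen (C si))%g].
Proof. have [f fE] := dual_lift_ex N C; exact: specified_crossing fE _ _ _ _ _ _. Qed.

End RegionColors.

Section ShadowColoring.
Variables (R : realType) (D : diagram R) (N : bicollar D) (X : biquandle).
Variable C : coloring (QX X) D.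
Local Notation I := (unit_interval R).

Definition psi_shadow (s : semiarc D) : X := psi (specified_color C s) (C s).

Lemma psi_shadowP : is_coloring psi_shadow.
Proof.
move=> p q si sj sk sl pq bi bj ak al.
have [ej ek el] := specified_color_crossing N C pq bi bj ak al.
have [ck cl] := colorP C pq bi bj ak al.
rewrite /psi_shadow ej ek el -ck -cl; split; first by rewrite psi_bun.
by rewrite psiM.
Qed.

Definition psi_coloring : coloring X D := Coloring psi_shadowP.

(** In every chart the label of the lift is the specified color, so applying psi to it and to the
    colors of the chart gives the shadow-transformed colors. *)
Lemma psi_dual_map (f : sphere_map R (EQ0 R (QX X))) :
  (forall v, covering (f v) = dual_map N C v) ->
  forall v, covering (psiB (f v)) = dual_map N psi_coloring v.
Proof.
move=> fE [z|]; last by rewrite smap_base psiB_base covering_base.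
have [L zL] := chart_ex N C z; have [g Fz] := chart_lift fE zL.
rewrite Fz psiB_pt covering_pt; case: zL Fz => [s sz|c p q s1 s2 cpq cz b1 b2|nz] Fz.
- rewrite (dual_map_strip psi_coloring sz) /=.
  (* At height 0 or 1 both points are the 0-cell, whatever the colors. *)
  have [ins|nins] := pselect (inside (height N s z)); last by rewrite !bpt_end.
  by rewrite /psi_shadow (strip_color fE sz ins Fz).
- have [e1 e2] := box_specified fE cpq cz b1 b2 Fz.
  symmetry; apply: dual_mapE; right; exists c, p, q, s1, s2; split=> //.
  by rewrite /= /psi_shadow e1 e2.
- by rewrite dual_map_out.
Qed.

Lemma psi_star_Xi : psi_star (Xi N C) = Xi N psi_coloring.
Proof.
have [f fE] := dual_lift_ex N C.
have -> : Xi N C = pi2_class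
    (sphere_comp (@covering_continuous R (QX X)) (covering_base _ _) f).
  by congr pi2_class; apply: sphere_map_ext => v; rewrite /= fE.
rewrite psi_star_lift; congr pi2_class; apply: sphere_map_ext => v.
exact: psi_dual_map.
Qed.

End ShadowColoring.

(** * Bijectivity of Psi *)

Lemma as_gen_ind (Y : biquandle) (P : As Y -> Prop) : P 1%g ->
  (forall g x, P g -> P (g * as_gen x)%g) ->
  (forall g x, P g -> P (g * (as_gen x)^-1)%g) -> forall g, P g.
Proof.
move=> P1 PM PV; elim/(@as_ind Y); elim/last_ind => [//|u [x b] IH].
by rewrite as_class_cons; case: b; [exact: PM|exact: PV].
Qed.

Section PsiBijective.
Variable X : biquandle.
Implicit Types (g : As X) (p : As (QX X)) (x : X) (a b : QX X).

Lemma psi_inj p : injective (psi p).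
Proof.
elim/as_gen_ind: p => [|p b IH|p b IH] x y; first by rewrite !psi1.
- by rewrite !psiM => /bov_inj /IH.
- by rewrite !psiMV => /(can_inj (bovVK _)) /IH.
Qed.

Lemma psi_surj p x : exists a : QX X, psi p a = x.
Proof.
elim/as_gen_ind: p x => [|p b IH|p b IH] x; first by exists x; rewrite psi1.
- by have [a e] := IH (bovV x (psi p b)); exists a; rewrite psiM e bovVK.
- by have [a e] := IH (bov x (kmap (psi p b))); exists a; rewrite psiMV e bovK.
Qed.

Definition psi_inv p x : QX X := xget x [set a | psi p a = x].

Lemma psi_invK p : cancel (psi_inv p) (psi p).
Proof.
by move=> x; rewrite /psi_inv; case: xgetP => // h; have [a /h] := psi_surj p x.
Qed.

Lemma psiK p : cancel (psi p) (psi_inv p).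
Proof. by move=> a; apply: (@psi_inj p); rewrite psi_invK. Qed.

(* psi(p a^-1, a) = x amounts to psi(p, a) = bov x x.                         *)
Definition psiAs_inv_letter p (l : X * bool) : As (QX X) :=
  (if l.2 then p * as_gen (psi_inv p l.1)
   else p * (as_gen (psi_inv p (bov l.1 l.1)))^-1)%g.

Lemma kmap_bovV x : bovV x (kmap x) = kmap x.
Proof. by rewrite -{1}[x]kmapE bovK. Qed.

(** Each letter is rewritten as a value of psi at the state reached so far; undoing psi turns a
    relation of As(X) into the corresponding one for Q(X). *)
Lemma psiAs_inv_letter_rel p w w' : as_rel (w : word X) w' ->
  foldl psiAs_inv_letter p w = foldl psiAs_inv_letter p w'.
Proof.
case=> [x []|x y]; rewrite /= /psiAs_inv_letter /=.
- set a := psi_inv p x.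
  have -> : bov x x = psi (p * as_gen a)%g a by rewrite psiM psi_invK.
  by rewrite psiK mulgK.
- set a := psi_inv p _; have e : psi p a = bov x x by rewrite psi_invK.
  have -> : x = psi (p * (as_gen a)^-1)%g a by rewrite psiMV e kmap_bovV kmapK.
  by rewrite psiK mulgVK.
- set a := psi_inv p x; set b := psi_inv p y.
  have ax : psi p a = x by rewrite psi_invK.
  have bx : psi p b = y by rewrite psi_invK.
  have -> : bov y x = psi (p * as_gen a)%g b by rewrite psiM ax bx.
  have -> : bun x y = psi (p * as_gen b)%g (bun a b) by rewrite psi_bun ax bx.
  by rewrite !psiK -!mulgA -as_relator.
Qed.

Definition psiAs_inv g : As (QX X) := foldl psiAs_inv_letter 1%g (repr g).

Lemma psiAs_invE (w : word X) :
  psiAs_inv (gen_class _ w) = foldl psiAs_inv_letter 1%g w.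
Proof.
apply: (gen_class_lift (f := foldl psiAs_inv_letter 1%g)).
move=> _ _ [u [v [w1 [w2 [h -> ->]]]]].
by rewrite !foldl_cat (psiAs_inv_letter_rel _ h).
Qed.

Lemma psiAs_inv1 : psiAs_inv 1%g = 1%g.
Proof. exact: (psiAs_invE [::]). Qed.

Lemma psiAs_invM g x :
  (psiAs_inv (g * as_gen x) = psiAs_inv g * as_gen (psi_inv (psiAs_inv g) x))%g.
Proof.
elim/(@as_ind X): g => w.
by rewrite -(as_class_cons _ true) !psiAs_invE -cats1 foldl_cat.
Qed.

Lemma psiAs_invMV g x : (psiAs_inv (g * (as_gen x)^-1) =
  psiAs_inv g * (as_gen (psi_inv (psiAs_inv g) (bov x x)))^-1)%g.
Proof.
elim/(@as_ind X): g => w.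
by rewrite -(as_class_cons _ false) !psiAs_invE -cats1 foldl_cat.
Qed.

Lemma psiAsK : cancel (@psiAs X) psiAs_inv.
Proof.
elim/as_gen_ind => [|p a IH|p a IH]; first by rewrite psiAs1 psiAs_inv1.
- by rewrite psiAsM psiAs_invM IH psiK.
- by rewrite psiAsMV psiAs_invMV IH psiMV kmap_bovV kmapE psiK.
Qed.

End PsiBijective.

(** * Bijectivity on colorings of semi-arcs *)

Section ColoringBijection.
Variables (R : realType) (D : diagram R) (N : bicollar D) (X : biquandle).
Implicit Types (C : coloring (QX X) D) (K : coloring X D).

Lemma coloring_ext (Y : biquandle) (C C' : coloring Y D) : C =1 C' -> C = C'.
Proof.
case: C C' => f hf [f' hf'] /= ff; have {}ff : f = f' by apply/funext.
by subst f'; congr Coloring; exact: Prop_irrelevance.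
Qed.

(** The recursion for psi_As at a generator is exactly the jump condition for the transformed
    colors; uniqueness of region colorings does the rest. *)
Lemma psiAs_region_coloring C :
  @psiAs X \o region_coloring C =1 region_coloring (psi_coloring N C).
Proof.
have [h1 h2] := region_coloringP N C.
apply: (region_coloring_unique N _ (region_coloringP N _)).
split=> [A /h1 /= ->|s A B sAB /=]; first exact: psiAs1.
by rewrite -(h2 _ _ _ sAB) psiAsM /psi_shadow (specified_color_region N C sAB).
Qed.

Lemma psi_coloring_inj : injective (psi_coloring (X := X) N).
Proof.
move=> C C' CC; apply: coloring_ext => s.
have [A [B [sAB _]]] := points_to_ex s.
have e : region_coloring C A = region_coloring C' A.
  apply: (can_inj (@psiAsK X)).
  have := psiAs_region_coloring C A; rewrite CC => e; rewrite [LHS]e.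
  by symmetry; exact: psiAs_region_coloring.
have := congr1 (fun K : coloring X D => K s) CC; rewrite /= /psi_shadow.
by rewrite !(specified_color_region N _ sAB) e => /psi_inj.
Qed.

(** The specified colors of the preimage are found first, as the images of those of K under
    [psiAs_inv]; each color of K is then pulled back by the bijection psi at that label. *)
Lemma psi_coloring_surj K : exists C, psi_coloring N C = K.
Proof.
pose g s := psiAs_inv (specified_color K s); pose c s : QX X := psi_inv (g s) (K s).
have cP : is_coloring c.
  move=> p q si sj sk sl pq bi bj ak al.
  have [ej ek el] := specified_color_crossing N K pq bi bj ak al.
  have [ck cl] := colorP K pq bi bj ak al.
  have gj : g sj = g si by rewrite /g ej.
  have psij : psi (g si) (c sj) = K sj by rewrite /c gj psi_invK.
  have psii : psi (g si) (c si) = K si by rewrite psi_invK.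
  have gk : g sk = (g si * as_gen (c sj))%g by rewrite {1}/g ek psiAs_invM /c gj.
  have gl : g sl = (g si * as_gen (c si))%g by rewrite {1}/g el psiAs_invM.
  split.
    by rewrite [RHS]/c gk -ck -psij -{1}psii -psi_bun psiK.
  by rewrite [RHS]/c gl -cl -psii -{1}psij -psiM psiK.
exists (Coloring cP); apply: coloring_ext => s; rewrite /= /psi_shadow /=.
(* [psiAs_inv] applied to the region coloring of K satisfies the conditions for c, hence is the
   region coloring of c. *)
suff -> : specified_color c s = g s by rewrite psi_invK.
have [A [B [sAB _]]] := points_to_ex s.
rewrite (specified_color_region N (Coloring cP) sAB) /g (specified_color_region N K sAB).
have [h1 h2] := region_coloringP N K.
apply: (region_coloring_unique N (region_coloringP N (Coloring cP)) (CR' := @psiAs_inv X \o _)).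
split=> [A' /h1 /= ->|s' A' B' sAB' /=]; first exact: psiAs_inv1.
by rewrite -(h2 _ _ _ sAB') psiAs_invM /c /g (specified_color_region N K sAB').
Qed.

End ColoringBijection.

(** * Quandle colorings of arcs as colorings of semi-arcs *)

Section QuandleColorings.
Variables (R : realType) (D : diagram R) (X : biquandle).
Implicit Types (p q : strand D) (s : semiarc D) (K : coloring (QX X) D).

Lemma germ_near p u s : `|u| = 1 -> germ p u s -> exists2 d : R, 0 < d &
  forall e, 0 < e < d -> sval s (p.1, p.2 + u * e).
Proof.
move=> u1 /nbhs_ballP[d d0 hd]; exists d => // e /andP[e0 ed]; apply: (hd e) => //.
by rewrite /ball /= sub0r normrN gtr0_norm.
Qed.

Lemma sign_cases (u : R) : `|u| = 1 -> u = 1 \/ u = -1.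
Proof.
by move=> u1; have [u0|u0] := leP 0 u; [left; rewrite -u1 ger0_norm|
  right; rewrite -u1 ltr0_norm // opprK].
Qed.

(** Crossing parameters are isolated, so a single width serves all germs at p. *)
Lemma germ_window p : exists2 d : R, 0 < d & forall s u, `|u| = 1 -> germ p u s ->
  forall e, 0 < e < d -> sval s (p.1, p.2 + u * e).
Proof.
have [d d0 hd] := cut_isolated (@same_crossing _ _) (@crossing_finite R D) p.
exists d => // s u u1 /(germ_near u1)[d' d'0 hd'] e /andP[e0 ed].
pose e' := Num.min (d' / 2) e.
have e'0 : 0 < e' by rewrite lt_min e0 andbT; lra.
have e'd' : e' < d' by rewrite gt_min; apply/orP; left; lra.
have e'e : e' <= e by rewrite ge_min lexx orbT.
have se' : sval s (p.1, p.2 + u * e') by apply: hd'; rewrite e'0.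
have [p1 np1 sE] := svalP s; rewrite sE in se' *.
apply: (cut_trans (@same_crossing _ _) se'); split=> //=; exists 0 => t ht; apply: hd.
case: (sign_cases u1) ht => ->; rewrite ?mul1r ?mulN1r addr0 => ht.
- by rewrite gtr0_norm; lra.
- by rewrite ltr0_norm; lra.
Qed.

Lemma germ_simple p u s : ~ crossing_pt p -> `|u| = 1 -> germ p u s -> sval s p.
Proof.
move=> np u1 gs; have [d d0 hd] := germ_window p.
have [s' s'p] := semiarc_of np.
suff -> : s = s' by [].
have d2 : 0 < d / 2 < d by lra.
apply: (piece_eq (@same_crossing _ _) (hd _ _ u1 gs _ d2)).
have [p1 np1 sE] := svalP s'; rewrite sE in s'p *.
apply: (cut_trans (@same_crossing _ _) s'p); split=> //=; exists 0 => t ht ct.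
have [d' d'0 hd'] := cut_isolated (@same_crossing _ _) (@crossing_finite R D) p.
have [tp|tp] := eqVneq t p.2; first by apply: np; move: ct; rewrite tp -surjective_pairing.
pose e := u * (t - p.2).
have he : 0 < e < d.
  by rewrite /e; case: (sign_cases u1) ht => ->; rewrite ?mul1r ?mulN1r addr0; move: tp; lra.
apply: (piece_notin (@same_crossing _ _) (hd _ _ u1 gs _ he)).
have -> : p.2 + u * e = t by rewrite /e; case: (sign_cases u1) => ->; lra.
exact: ct.
Qed.

Section ArcColor.
Variable K : coloring (QX X) D.

(** At an over-crossing the operation on the over-color is trivial in a quandle; away from crossings
    both germs belong to one semi-arc. *)
Lemma over_color p s s' u u' : ~ under_pt p -> `|u| = 1 -> `|u'| = 1 ->
  germ p u s -> germ p u' s' -> K s = K s'.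
Proof.
move=> nu u1 u1' gs gs'.
have [cp|np] := pselect (crossing_pt p); last first.
  by rewrite (piece_eq (@same_crossing _ _) (germ_simple np u1 gs) (germ_simple np u1' gs')).
have [q pq] := cp; have op : overp p by apply: contrapT => /negP op; apply: nu.
have qp : crosses_under q p.
  by split; [exact: double_sym|rewrite (over_under (double_sym pq)) op].
have [sj bj] := behind_ex pq; have [sl al] := ahead_ex pq.
have [si bi] := behind_ex qp.1; have [sk ak] := ahead_ex qp.1.
have [_ jl] := colorP K qp bi bj ak al.
have un (s1 s2 : semiarc D) v : germ p v s1 -> germ p v s2 -> s1 = s2.
  exact: (germ_eq (@same_crossing _ _) (same_refl p)).
have color_j (s1 : semiarc D) v : `|v| = 1 -> germ p v s1 -> K s1 = K sj.
  move=> v1 g1; have w1 := sg_normal pq.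
  have [e|e] : v = Num.sg (dot (vel p) (normal q)) \/ v = - Num.sg (dot (vel p) (normal q)).
    by case: (sign_cases v1) (sign_cases w1) => -> [] ->; rewrite ?opprK; [left|right|right|left].
  - by rewrite e in g1; rewrite (un _ _ _ g1 al) -jl.
  - by rewrite e in g1; rewrite (un _ _ _ g1 bj).
by rewrite (color_j _ _ u1 gs) (color_j _ _ u1' gs').
Qed.

Let right_germ p := cid (germ_ex (@same_crossing _ _) (@crossing_finite R D) p (normr1 R)).
(** The color just after p. Off under-crossings it is also the color just before, so it is locally
    constant along an arc. *)
Let strand_color p : X := K (sval (right_germ p)).

Lemma strand_colorE p u s : ~ under_pt p -> `|u| = 1 -> germ p u s -> strand_color p = K s.
Proof.
move=> nu u1; exact: over_color nu (normr1 R) u1 (svalP (right_germ p)).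
Qed.

Lemma strand_color_mem s p : sval s p -> strand_color p = K s.
Proof.
move=> sp; have np := piece_notin (@same_crossing _ _) sp.
have gp := germ_simple np (normr1 R) (svalP (right_germ p)).
by rewrite /strand_color (piece_eq (@same_crossing _ _) gp sp).
Qed.

Lemma strand_color_segment i (a b : R) :
  (forall t, a <= t <= b -> ~ under_pt ((i, t) : strand D)) -> a <= b ->
  strand_color (i, a) = strand_color (i, b).
Proof.
move=> nu ab.
apply: (@connected_locally_constant _ _ `[a, b]%classic (fun t => strand_color (i, t))).
- exact: segment_connected.
- move=> t; rewrite /= in_itv /= => /nu nt.
  have [d d0 hd] := germ_window (i, t).
  near=> t' => _; have [->//|tt'] := eqVneq t' t.
  have t'd : `|t' - t| < d by rewrite distrC; near: t'; exact: nbhsx_ballx.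
  have u1 : `|Num.sg (t' - t)| = 1 by rewrite normr_sg subr_eq0 tt'.
  have [s gs] := germ_ex (@same_crossing _ _) (@crossing_finite R D) (i, t) u1.
  rewrite (strand_colorE nt u1 gs); apply: strand_color_mem.
  have := hd _ _ u1 gs `|t' - t|; rewrite normr_gt0 subr_eq0 tt' t'd => /(_ isT) /=.
  by rewrite mulr_sg_norm addrC subrK.
- by rewrite /= in_itv /= lexx.
- by rewrite /= in_itv /= lexx andbT.
Unshelve. all: by end_near. Qed.

Lemma arc_color s s' : arc_of s = arc_of s' -> K s = K s'.
Proof.
move=> ss; have [p np sp] := semiarc_ex s; have [p' np' sp'] := semiarc_ex s'.
have Ap := arc_ofP sp; have Ap' := arc_ofP sp'; rewrite -ss in Ap'.
have [p1 np1 AE] := svalP (arc_of s); rewrite AE in Ap Ap'.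
have [e [k hk]] := cut_trans (@same_under _ _) (cut_sym (@same_under _ _) Ap) Ap'.
pose t' := p'.2 + k%:~R.
have s't' : sval s' (p.1, t').
  by apply: (piece_same (@same_crossing _ _) _ sp'); split; [rewrite e|exists k].
have {}sp : sval s (p.1, p.2) by rewrite -surjective_pairing.
rewrite -(strand_color_mem sp) -(strand_color_mem s't').
have [le|/ltW le] := leP p.2 t'.
- by apply: strand_color_segment => // t ht; apply: hk; rewrite ht.
- by symmetry; apply: strand_color_segment => // t ht; apply: hk; rewrite -/t' ht orbT.
Qed.

End ArcColor.

Lemma arc_of_surj (a : Defs.arc D) : exists s, arc_of s = a.
Proof.
have [p np aE] := svalP a.
have [s gs] := germ_ex (@same_crossing _ _) (@crossing_finite R D) p (normr1 R).
exists s; apply: (piece_eq (@same_under _ _) (germ_arc_mem (normr1 R) gs np)).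
by rewrite aE; exact: cut_refl.
Qed.

Lemma semiarc_coloring_inj : injective (@semiarc_coloring R X D).
Proof.
move=> [f hf] [f' hf'] e; have ff : f = f'.
  apply/funext => a; have [s <-] := arc_of_surj a.
  exact: (congr1 (fun K : coloring (QX X) D => K s) e).
by subst f'; congr QColoring; exact: Prop_irrelevance.
Qed.

Lemma semiarc_coloring_surj K : exists C, semiarc_coloring C = K.
Proof.
pose c (a : Defs.arc D) : quandle_of_biquandle X := K (sval (cid (arc_of_surj a))).
have cE s : c (arc_of s) = K s by apply: arc_color; exact: (svalP (cid (arc_of_surj (arc_of s)))).
have cP : is_qcoloring c.
  move=> p q ai aj ak pq bi aq ak'.
  have qp := double_sym pq.1.
  have nq : ~ under_pt q by move=> [_]; rewrite (crosses_under_over pq).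
  have [si bsi] := behind_ex pq.1; have [sk ask] := ahead_ex pq.1.
  have [sj bsj] := behind_ex qp; have [sl asl] := ahead_ex qp.
  have un (a1 a2 : Defs.arc D) v : germ p v a1 -> germ p v a2 -> a1 = a2.
    exact: (germ_eq (@same_under _ _) (same_refl p)).
  have -> : ai = arc_of si by exact: un bi (germ_arc_of bsi).
  have -> : ak = arc_of sk by exact: un ak' (germ_arc_of ask).
  have -> : aj = arc_of sj.
    by apply: (piece_eq (@same_under _ _) aq); apply: germ_arc_mem bsj nq; rewrite normrN sg_normal.
  by rewrite !cE; have [] := colorP K pq bsi bsj ask asl.
by exists (QColoring cP); apply: coloring_ext => s; exact: cE.
Qed.

End QuandleColorings.

(** * Sums in the group ring *)

Lemma group_elt_neq0 (R : realType) (Y : topologicalType) (y : Y) (a : pi2 R y) :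
  group_elt a != 0.
Proof. by rewrite freegU_eq0. Qed.

Section GroupRingSums.
Variables (R : realType) (Y Z : topologicalType) (y : Y) (z : Z).
Variable h : pi2 R y -> pi2 R z.

Lemma fglift_sum (T : choiceType) (F : T -> pi2 R y) :
  fglift (fun b => group_elt (h b)) (\sum_(i \in [set: T]) group_elt (F i)) =
  \sum_(i \in [set: T]) group_elt (h (F i)).
Proof.
pose H (a : group_ring R y) : group_ring R z := fglift (fun b => group_elt (h b)) a.
have HB a b : H (a - b) = H a - H b by exact: lift_is_additive.
have H0 : H 0 = 0 by rewrite -(subrr 0) HB subrr.
have HD a b : H (a + b) = H a + H b.
  by rewrite -{1}[b]opprK HB -[in X in _ - X](sub0r b) HB H0 sub0r opprK.
have [fT|nT] := pselect (finite_set [set: T]).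
  rewrite !fsbig_finite // -/(H _) (big_morph H HD H0); apply: eq_bigr => i _.
  by rewrite /H /group_elt liftU scale1r.
(* Over an infinite index set every term is nonzero, so the sum has infinite support and takes the
   default value 0, on both sides. *)
have inf (W : topologicalType) (w : W) (G : T -> pi2 R w) :
    \sum_(i \in [set: T]) group_elt (G i) = 0.
  apply: fsbig_dflt; rewrite setTI (_ : _ @^-1` _ = [set: T]) //.
  by apply/seteqP; split=> // i _; apply/eqP; exact: group_elt_neq0.
by rewrite !inf -/(H _) H0.
Qed.

End GroupRingSums.

Theorem theorem6p5 (R : realType) (X : biquandle) (D : diagram R)
    (N : bicollar D) :
  (forall C : qcoloring (quandle_of_biquandle X) D,
     exists h : is_coloring (Psi C),
       psi_star (Xi N (semiarc_coloring C)) = Xi N (Coloring h)) /\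
  (finite_set [set: X] -> psi_star_ring (Xi_sum_Q N X) = Xi_sum N X).
Proof.
split=> [C|_].
  (* [Psi C] is convertible to [psi_shadow (semiarc_coloring C)]. *)
  by exists (psi_shadowP N (semiarc_coloring C)); exact: psi_star_Xi.
rewrite /psi_star_ring /Xi_sum_Q fglift_sum /Xi_sum.
pose Phi (C : qcoloring (quandle_of_biquandle X) D) :=
  psi_coloring N (semiarc_coloring C).
rewrite (reindex_fsbig Phi [set: _]).
  by apply: eq_fsbigr => C _; rewrite psi_star_Xi.
split=> // [C C' _ _ /psi_coloring_inj /semiarc_coloring_inj //|K _].
have [C' <-] := psi_coloring_surj N K; have [C <-] := semiarc_coloring_surj C'.
by exists C.
Qed.
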